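(* Let $\mathcal{H}$ be a finite-dimensional Hilbert space and $\mathcal{A}_1,\mathcal{B}_1\subseteq\mathcal{D}(\mathcal{H})$ non-empty closed sets. Then $$\mathrm{Stein}(\mathcal{A}_1^{\mathrm{iid}}\|\mathcal{B}_1^{\mathrm{iid}})=\operatorname{min^*}_{\mu\in\mathcal{P}(\mathcal{B}_1)}\lim_{n\to\infty}\frac1n\inf_{\rho\in\mathcal{A}_1}D\Big(\rho^{\otimes n}\Big\|\int_{\mathcal{B}_1}\mathrm{d}\mu(\sigma)\,\sigma^{\otimes n}\Big),$$ $$\mathrm{Stein}(\mathcal{A}_1^{\mathrm{av}}\|\mathcal{B}_1^{\mathrm{iid}})=\operatorname{min^*}_{\mu\in\mathcal{P}(\mathcal{B}_1)}\lim_{n\to\infty}\frac1n\inf_{\rho_n\in\mathrm{co}(\mathcal{A}_1^{\otimes n,\mathrm{av}})}D\Big(\rho_n\Big\|\int_{\mathcal{B}_1}\mathrm{d}\mu(\sigma)\,\sigma^{\otimes n}\Big).$$ If moreover $\mathcal{B}_1$ is convex, then $$\mathrm{Stein}(\mathcal{A}_1^{\mathrm{iid}}\|\mathcal{B}_1^{\mathrm{iid}})=\operatorname{min^*}_{\rho\in\mathcal{A}_1,\ \mu\in\mathcal{P}(\mathcal{B}_1)}\lim_{n\to\infty}\frac1n D\Big(\rho^{\otimes n}\Big\|\int_{\mathcal{B}_1}\mathrm{d}\mu(\sigma)\,\sigma^{\otimes n}\Big).$$ Finally, for arbitrarily varying alternative hypotheses (with no convexity assumption on $\mathcal{B}_1$):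 $$\mathrm{Stein}(\mathcal{A}_1^{\mathrm{iid}}\|\mathcal{B}_1^{\mathrm{av}})=\mathrm{Stein}(\mathcal{A}_1^{\mathrm{iid}}\|\mathrm{co}(\mathcal{B}_1)^{\mathrm{av}})=\mathrm{Stein}(\mathcal{A}_1^{\mathrm{iid}}\|\mathrm{co}(\mathcal{B}_1)^{\mathrm{iid}})=\operatorname{min^*}_{\rho\in\mathcal{A}_1,\ \mu\in\mathcal{P}(\mathrm{co}(\mathcal{B}_1))}\lim_{n\to\infty}\frac1n D\Big(\rho^{\otimes n}\Big\|\int_{\mathrm{co}(\mathcal{B}_1)}\mathrm{d}\mu(\sigma)\,\sigma^{\otimes n}\Big),$$ $$\mathrm{Stein}(\mathcal{A}_1^{\mathrm{av}}\|\mathcal{B}_1^{\mathrm{av}})=\mathrm{Stein}(\mathcal{A}_1^{\mathrm{av}}\|\mathrm{co}(\mathcal{B}_1)^{\mathrm{av}})=\mathrm{Stein}(\mathcal{A}_1^{\mathrm{av}}\|\mathrm{co}(\mathcal{B}_1)^{\mathrm{iid}})=\operatorname{min^*}_{\mu\in\mathcal{P}(\mathrm{co}(\mathcal{B}_1))}\lim_{n\to\infty}\frac1n\inf_{\rho_n\in\mathrm{co}(\mathcal{A}_1^{\otimes n,\mathrm{av}})}D\Big(\rho_n\Big\|\int_{\mathrm{co}(\mathcal{B}_1)}\mathrm{d}\mu(\sigma)\,\sigma^{\otimes n}\Big).$$ In every formula, the set of arguments (measures, or pairs) for which the inner limit exists is non-empty and the minimum over it is attained.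
   Context: $\mathcal{D}(\mathcal{K})$ is the set of density operators on $\mathcal{K}$. For $\mathcal{F}_1\subseteq\mathcal{D}(\mathcal{H})$: $\mathcal{F}_1^{\otimes n,\mathrm{iid}}=\{\rho^{\otimes n}:\rho\in\mathcal{F}_1\}$, $\mathcal{F}_1^{\mathrm{iid}}=(\mathcal{F}_1^{\otimes n,\mathrm{iid}})_n$, $\mathcal{F}_1^{\otimes n,\mathrm{av}}=\{\rho_1\otimes\cdots\otimes\rho_n:\rho_i\in\mathcal{F}_1\}$, $\mathcal{F}_1^{\mathrm{av}}=(\mathcal{F}_1^{\otimes n,\mathrm{av}})_n$; $\mathrm{co}$ is convex hull. For sequences $\mathcal{A}=(\mathcal{A}_n)_n,\mathcal{B}=(\mathcal{B}_n)_n$ of sets of states on $\mathcal{H}^{\otimes n}$: $\beta_\varepsilon(\mathcal{A}_n\|\mathcal{B}_n)=\inf\{\sup_{\sigma\in\mathcal{B}_n}\mathrm{Tr}[\sigma E]:0\le E\le\mathbb{1},\sup_{\rho\in\mathcal{A}_n}\mathrm{Tr}[\rho(\mathbb{1}-E)]\le\varepsilon\}$, $\mathrm{Stein}(\mathcal{A}\|\mathcal{B})=\lim_{\varepsilon\to0^+}\liminf_n-\frac1n\log\beta_\varepsilon(\mathcal{A}_n\|\mathcal{B}_n)$. $D$ is the Umegaki relative entropy $D(\rho\|\sigma)=\mathrm{Tr}[\rho(\log\rho-\log\sigma)]$ ($+\infty$ if supports are not nested). $\mathcal{P}(\mathcal{C})$ is the set of Borel probability measures on compact $\mathcal{C}$;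 $\operatorname{min^*}$ restricts the minimum to arguments for which the inner limit exists. *)

(* Defs.v *)
From HB Require Import structures.
From mathcomp Require Import all_boot all_order all_algebra.
From mathcomp Require Import all_classical all_reals all_analysis.
From mathcomp Require Import complex mxtens.

Set Implicit Arguments.
Unset Strict Implicit.
Unset Printing Implicit Defensive.

Import Order.TTheory GRing.Theory Num.Theory.
Import numFieldNormedType.Exports.

Local Open Scope classical_set_scope.
Local Open Scope ring_scope.

Section QDefs.
Variable R : realType.
Local Notation C := (R[i]).

Definition adjmx m n (A : 'M[C]_(m, n)) : 'M[C]_(n, m) := (map_mx conjc A)^T.

Definition psd m (A : 'M[C]_m) : Prop :=
  adjmx A = A /\ forall x : 'cV[C]_m, 0 <= complex.Re ((adjmx x *m A *m x) 0 0).

Definition density m (A : 'M[C]_m) : Prop := psd A /\ \tr A = 1.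

Definition retr m (A : 'M[C]_m) : R := complex.Re (\tr A).

Definition unitary m (U : 'M[C]_m) : Prop := U *m adjmx U = 1%:M.

Definition spec_decomp m (A : 'M[C]_m) (Ul : 'M[C]_m * 'rV[R]_m) : Prop :=
  unitary Ul.1 /\
  A = Ul.1 *m diag_mx (map_mx (fun r : R => (r%:C)%C) Ul.2) *m adjmx Ul.1.

Definition mxfun m (f : R -> R) (A : 'M[C]_m) : 'M[C]_m :=
  let Ul := xget (0, 0) (spec_decomp A) in
  Ul.1 *m diag_mx (map_mx (fun r : R => ((f r)%:C)%C) Ul.2) *m adjmx Ul.1.

(* matrix logarithm (on the support; convention ln 0 = 0 of the library) *)
Definition logmx m (A : 'M[C]_m) : 'M[C]_m := mxfun (@ln R) A.

(* Umegaki relative entropy, +oo if supp rho is not contained in supp sigma *)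
Definition relent m (rho sigma : 'M[C]_m) : \bar R :=
  if `[< forall x : 'cV[C]_m, sigma *m x = 0 -> rho *m x = 0 >]
  then (retr (rho *m (logmx rho - logmx sigma)))%:E
  else +oo%E.

Fixpoint ptens_rec m (f : nat -> 'M[C]_m) k : 'M[C]_(m ^ k.+1) :=
  if k is k'.+1 then f 0%N *t ptens_rec (fun i => f i.+1) k' else f 0%N.

Definition ptens m (f : nat -> 'M[C]_m) k : 'M[C]_(m ^ k) :=
  if k is k'.+1 return 'M[C]_(m ^ k) then ptens_rec f k' else 1.

Definition co m (S : set 'M[C]_m) : set 'M[C]_m :=
  [set M | exists (k : nat) (w : 'I_k -> R) (x : 'I_k -> 'M[C]_m),
     [/\ forall i, 0 <= w i, \sum_i w i = 1, forall i, S (x i) &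
         M = \sum_i ((w i)%:C)%C *: x i]].

Definition convex_mxset m (S : set 'M[C]_m) : Prop :=
  forall x y, S x -> S y -> forall t : R, 0 <= t <= 1 ->
    S ((t%:C)%C *: x + ((1 - t)%:C)%C *: y).

Definition iidset m (F : set 'M[C]_m) (n : nat) : set 'M[C]_(m ^ n) :=
  [set ntensmx rho n | rho in F].

Definition avset m (F : set 'M[C]_m) (n : nat) : set 'M[C]_(m ^ n) :=
  [set ptens f n | f in [set f : nat -> 'M[C]_m | forall i, F (f i)]].


Definition ereal_nlog (x : \bar R) : \bar R :=
  match x with
  | r%:E => if 0 < r then (- ln r)%:E else +oo%E
  | +oo%E => -oo%E
  | -oo%E => +oo%E
  end.

Definition beta_err m (eps : R) (An Bn : set 'M[C]_m) : \bar R :=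
  ereal_inf [set ereal_sup [set (retr (sigma *m E))%:E | sigma in Bn]
            | E in [set E : 'M[C]_m | psd E /\ psd (1%:M - E) /\
                  (ereal_sup [set (retr (rho *m (1%:M - E)))%:E | rho in An]
                     <= eps%:E)%E]].

Definition stein_eps m (A B : forall n, set 'M[C]_(m ^ n)) (eps : R) : \bar R :=
  limn_einf (fun n => ((n%:R)^-1)%:E * ereal_nlog (beta_err eps (A n) (B n)))%E.

Definition Stein m (A B : forall n, set 'M[C]_(m ^ n)) : \bar R :=
  lim (stein_eps A B eps @[eps --> 0^'+]).

(* real coordinates of a complex matrix; the topology (hence the Borel
   sigma-algebra) on 'M[C]_m is the one transported by this bijection *)
Definition mxcoord m (A : 'M[C]_m) : 'M[R]_m * 'M[R]_m :=
  (map_mx (@complex.Re R) A, map_mx (@complex.Im R) A).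

Definition cmx_closed m (S : set 'M[C]_m) : Prop := closed (@mxcoord m @` S).

Definition cmx_opens m : set (set 'M[C]_m) :=
  [set @mxcoord m @^-1` U | U in [set U : set ('M[R]_m * 'M[R]_m) | open U]].

End QDefs.

Arguments iidset {R m} F n.
Arguments avset {R m} F n.

(* pointed alias of complex matrices (needed to build the measurable type) *)
Definition cmx (R : realType) (m : nat) := 'M[R[i]]_m.
HB.instance Definition _ (R : realType) m := Choice.on (cmx R m).
HB.instance Definition _ (R : realType) m := isPointed.Build (cmx R m) 0.

Section QDefs2.
Variable R : realType.
Local Notation C := (R[i]).

Definition BorelMx m := g_sigma_algebraType (@cmx_opens R m : set (set (cmx R m))).

Definition probOn m (S : set 'M[C]_m) (mu : probability (BorelMx m) R) : Prop :=
  mu S = 1%E.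

Definition mixture m (S : set 'M[C]_m) (mu : probability (BorelMx m) R) (n : nat)
  : 'M[C]_(m ^ n) :=
  \matrix_(i, j)
    ((Rintegral mu S (fun s : BorelMx m => complex.Re ((ntensmx (s : 'M[C]_m) n) i j)))
     +i* (Rintegral mu S (fun s : BorelMx m => complex.Im ((ntensmx (s : 'M[C]_m) n) i j))))%C.

Definition minstar (X : Type) (P : X -> Prop) (g : X -> nat -> \bar R) (v : \bar R)
  : Prop :=
  exists x, [/\ P x, g x n @[n --> \oo] --> v &
    forall y l, P y -> g y n @[n --> \oo] --> l -> (v <= l)%E].

End QDefs2.

(* Main.v *)
Require Import Defs.
From HB Require Import structures.
From mathcomp Require Import all_boot all_order all_algebra.
From mathcomp Require Import all_classical all_reals all_analysis.
From mathcomp Require Import complex mxtens spectral sesquilinear ring lra zify.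
From mathcomp Require finmap.
From mathcomp Require Import measurable_realfun.

Set Implicit Arguments.
Unset Strict Implicit.
Unset Printing Implicit Defensive.

Import Order.TTheory GRing.Theory Num.Theory.
Import numFieldNormedType.Exports.

Local Open Scope classical_set_scope.
Local Open Scope ring_scope.

(** Converse: by the Nussbaum-Szkola comparison, a test with errors (eps, beta)
    forces D(rho || sigma) >= ln t (1 - 2 (eps + t beta)) - 1 for all t >= 1.
    Hence, if r < Stein(A || B), eventually D(rho || sigma) >= n r for all rho
    in co(A_n) and all states sigma dominated by B_n on tests, in particular for
    all mixtures of B_n.

    Achievability: measuring the eigenspaces of a permutation-invariant sigma on
    m copies, of which there are polynomially many, loses only O(ln m) in
    D(rho || sigma). A minimax theorem makes the measurement universal over
    co(A_m) x co(B_m), and its independent repetition yields tests. So there are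
    rho_m, sigma_m in co(A_m), co(B_m) with
    D(rho_m || sigma_m) <= m Stein(A || B) + O(ln m); for i.i.d. A,
    Caratheodory's theorem turns rho_m into some rho^(tensor m). Operator
    monotonicity of ln shows that mu = sum_n mu_n / ((n+1)(n+2)), where mu_n
    represents sigma_n, attains the minimum. For pairs, a cluster point rho of
    near minimizers has the same exponent as A: otherwise one block measurement
    would do better on a whole neighbourhood of rho.

    Arbitrarily varying B: multilinearity passes from B1 to co(B1). Given
    delta > 0, a finite net tau of co(B1) satisfies
    sigma <= e^delta tau_j for some j = j(sigma); on permutation-invariant tests
    a product of tau_j's is dominated, up to a polynomial factor, by the i.i.d.
    power of its empirical mean. *)

(** * Adjoints, positive matrices, spectral decomposition *)

Section Adjoint.
Variable R : realType.
Local Notation C := (R[i]).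

(** States may be singular, so relative entropies and exponents may be infinite. The measured
    quantity is therefore kept in variational form, sum_x ln t_x Tr(rho M_x) + 1 - sum_x t_x
    Tr(sigma M_x), with a finite POVM M and positive scores t. It is finite, continuous and affine
    in the pair (rho, sigma), as minimax requires, and a convex combination of strategies (M, t) is
    again one strategy. Rescaling t by its largest mean under B separates it into a lower bound on
    the mean of ln t under A and the bound 1 on the mean of t under B. These bounds hold at every
    block, even when the state varies from block to block, and give Chernoff and Markov estimates
    for the accumulated score. Hypotheses are sets of infinite sequences of states closed under
    shifts, so that i.i.d. and arbitrarily varying A form one case. B is i.i.d. in the block
    arguments because elements of its hull are then permutation invariant. The weights
    1/((n+1)(n+2)) sum to 1 and have logarithm o(n), so a single measure loses nothing in the
    rate. *)

Definition sqn (z : C) : R := complex.Re z ^+ 2 + complex.Im z ^+ 2.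

Lemma sqn_ge0 z : 0 <= sqn z. Proof. by rewrite addr_ge0 ?sqr_ge0. Qed.
Lemma sqn_eq0 z : sqn z = 0 -> z = 0.
Proof.
move/eqP; rewrite paddr_eq0 ?sqr_ge0// !sqrf_eq0 => /andP[/eqP a /eqP b].
by case: z a b => x y /= -> ->.
Qed.
Lemma sqnE (z : C) : ((sqn z)%:C)%C = conjc z * z.
Proof. by case: z => a b; rewrite /sqn /=; apply/eqP; rewrite eq_complex /=; apply/andP; split; apply/eqP; ring. Qed.
Lemma sqnM (z w : C) : sqn (z * w) = sqn z * sqn w.
Proof. by case: z w => [a b] [c d]; rewrite /sqn /=; ring. Qed.
Lemma sqn_conj z : sqn (conjc z) = sqn z.
Proof. by case: z => a b; rewrite /sqn /=; ring. Qed.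
Lemma sqnR (r : R) : sqn (r%:C)%C = r ^+ 2.
Proof. by rewrite /sqn /= expr0n addr0. Qed.
Lemma sqnD_le (z w : C) : sqn (z + w) <= 2 * (sqn z + sqn w).
Proof.
case: z w => [a b] [c d]; rewrite /sqn /= -subr_ge0.
have -> : 2 * (a ^+ 2 + b ^+ 2 + (c ^+ 2 + d ^+ 2)) - ((a + c) ^+ 2 + (b + d) ^+ 2) = (a - c) ^+ 2 + (b - d) ^+ 2 by ring.
by rewrite addr_ge0 ?sqr_ge0.
Qed.

Lemma cReD (z w : C) : complex.Re (z + w) = complex.Re z + complex.Re w.
Proof. by case: z w => [? ?] [? ?]. Qed.
Lemma cImD (z w : C) : complex.Im (z + w) = complex.Im z + complex.Im w.
Proof. by case: z w => [? ?] [? ?]. Qed.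
Lemma cReN (z : C) : complex.Re (- z) = - complex.Re z.
Proof. by case: z. Qed.
Lemma cReM (z w : C) : complex.Re (z * w) = complex.Re z * complex.Re w - complex.Im z * complex.Im w.
Proof. by case: z w => [? ?] [? ?]. Qed.
Lemma cImM (z w : C) : complex.Im (z * w) = complex.Re z * complex.Im w + complex.Im z * complex.Re w.
Proof. by case: z w => [? ?] [? ?]. Qed.
Lemma ReZ (r : R) (z : C) : complex.Re ((r%:C)%C * z) = r * complex.Re z.
Proof. by case: z => a b /=; ring. Qed.
Lemma ImZ (r : R) (z : C) : complex.Im ((r%:C)%C * z) = r * complex.Im z.
Proof. by case: z => a b /=; ring. Qed.
Lemma Re_sum I (r : seq I) P (F : I -> C) :
  complex.Re (\sum_(i <- r | P i) F i) = \sum_(i <- r | P i) complex.Re (F i).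
Proof. by apply: (big_morph _ cReD) => //. Qed.
Lemma Im_sum I (r : seq I) P (F : I -> C) :
  complex.Im (\sum_(i <- r | P i) F i) = \sum_(i <- r | P i) complex.Im (F i).
Proof. by apply: (big_morph _ cImD) => //. Qed.

Lemma adjmxE m n (A : 'M[C]_(m, n)) i j : adjmx A i j = conjc (A j i).
Proof. by rewrite !mxE. Qed.
Lemma adjmxK m n (A : 'M[C]_(m, n)) : adjmx (adjmx A) = A.
Proof. by apply/matrixP => i j; rewrite !adjmxE conjcK. Qed.
Lemma adjmxM m n p (A : 'M[C]_(m, n)) (B : 'M[C]_(n, p)) :
  adjmx (A *m B) = adjmx B *m adjmx A.
Proof. by rewrite /adjmx map_mxM trmx_mul. Qed.
Lemma adjmxD m n (A B : 'M[C]_(m, n)) : adjmx (A + B) = adjmx A + adjmx B.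
Proof. by apply/matrixP => i j; rewrite adjmxE mxE [RHS]mxE !adjmxE rmorphD. Qed.
Lemma adjmxN m n (A : 'M[C]_(m, n)) : adjmx (- A) = - adjmx A.
Proof. by apply/matrixP => i j; rewrite adjmxE mxE [RHS]mxE !adjmxE rmorphN. Qed.
Lemma adjmxB m n (A B : 'M[C]_(m, n)) : adjmx (A - B) = adjmx A - adjmx B.
Proof. by rewrite adjmxD adjmxN. Qed.
Lemma adjmxZ m n (r : R) (A : 'M[C]_(m, n)) : adjmx ((r%:C)%C *: A) = (r%:C)%C *: adjmx A.
Proof. by apply/matrixP => i j; rewrite adjmxE mxE [RHS]mxE adjmxE rmorphM /= oppr0. Qed.
Lemma adjmx1 m : adjmx (1%:M : 'M[C]_m) = 1%:M.
Proof. by apply/matrixP => i j; rewrite adjmxE !mxE conjc_nat eq_sym. Qed.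
Lemma adjmx0 m n : adjmx (0 : 'M[C]_(m,n)) = 0.
Proof. by apply/matrixP => i j; rewrite adjmxE !mxE conjc0. Qed.
Lemma adjmx_sum m n I (r : seq I) P (F : I -> 'M[C]_(m,n)) :
  adjmx (\sum_(i <- r | P i) F i) = \sum_(i <- r | P i) adjmx (F i).
Proof. by apply: (big_morph _ (@adjmxD m n) (@adjmx0 m n)). Qed.

Lemma retrD m (A B : 'M[C]_m) : retr (A + B) = retr A + retr B.
Proof. by rewrite /retr mxtraceD cReD. Qed.
Lemma retrN m (A : 'M[C]_m) : retr (- A) = - retr A.
Proof. by rewrite /retr raddfN cReN. Qed.
Lemma retrB m (A B : 'M[C]_m) : retr (A - B) = retr A - retr B.
Proof. by rewrite retrD retrN. Qed.
Lemma retrZ m (r : R) (A : 'M[C]_m) : retr ((r%:C)%C *: A) = r * retr A.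
Proof. by rewrite /retr mxtraceZ ReZ. Qed.
Lemma retr0 m : retr (0 : 'M[C]_m) = 0.
Proof. by rewrite /retr mxtrace0. Qed.
Lemma retr_sum m I (r : seq I) P (F : I -> 'M[C]_m) :
  retr (\sum_(i <- r | P i) F i) = \sum_(i <- r | P i) retr (F i).
Proof. by apply: (big_morph _ (@retrD m) (@retr0 m)). Qed.
Lemma retr_mulC m n (A : 'M[C]_(m, n)) (B : 'M[C]_(n, m)) : retr (A *m B) = retr (B *m A).
Proof. by rewrite /retr mxtrace_mulC. Qed.

Definition qf m (A : 'M[C]_m) (x : 'cV[C]_m) : R := complex.Re ((adjmx x *m A *m x) 0 0).

Lemma qf_retr m (A : 'M[C]_m) x : qf A x = retr (A *m (x *m adjmx x)).
Proof. by rewrite mulmxA retr_mulC mulmxA /retr /mxtrace big_ord1. Qed.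

Lemma qfD m (A B : 'M[C]_m) x : qf (A + B) x = qf A x + qf B x.
Proof. by rewrite !qf_retr mulmxDl retrD. Qed.
Lemma qfN m (A : 'M[C]_m) x : qf (- A) x = - qf A x.
Proof. by rewrite !qf_retr mulNmx retrN. Qed.
Lemma qfB m (A B : 'M[C]_m) x : qf (A - B) x = qf A x - qf B x.
Proof. by rewrite qfD qfN. Qed.
Lemma qfZ m r (A : 'M[C]_m) x : qf ((r%:C)%C *: A) x = r * qf A x.
Proof. by rewrite !qf_retr -scalemxAl retrZ. Qed.
Lemma qf0 m x : qf (0 : 'M[C]_m) x = 0.
Proof. by rewrite !qf_retr mul0mx retr0. Qed.
Lemma qf_conj m n (A : 'M[C]_m) (G : 'M[C]_(m, n)) x : qf (adjmx G *m A *m G) x = qf A (G *m x).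
Proof. by rewrite /qf adjmxM !mulmxA. Qed.

Lemma adjmx_self m (x : 'cV[C]_m) : adjmx x *m x = ((\sum_i sqn (x i 0))%:C)%C%:M.
Proof.
apply/matrixP => i j; rewrite !ord1 !mxE /= mulr1n rmorph_sum /=.
by apply: eq_bigr => k _; rewrite adjmxE sqnE.
Qed.

Lemma qf_diag m (l : 'rV[R]_m) x :
  qf (diag_mx (map_mx (fun r : R => (r%:C)%C) l)) x = \sum_i l 0 i * sqn (x i 0).
Proof.
rewrite /qf -mulmxA mul_diag_mx mxE Re_sum; apply: eq_bigr => i _.
by rewrite adjmxE !mxE mulrCA -sqnE -rmorphM.
Qed.

Lemma qf1 m (x : 'cV[C]_m) : qf 1%:M x = \sum_i sqn (x i 0).
Proof. by rewrite /qf mulmx1 adjmx_self mxE mulr1n. Qed.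

Definition herm m (A : 'M[C]_m) := adjmx A = A.

Lemma psd_herm m (A : 'M[C]_m) : psd A -> herm A. Proof. by case. Qed.
Lemma psd_qf m (A : 'M[C]_m) x : psd A -> 0 <= qf A x. Proof. by case=> _; exact. Qed.

Lemma psdD m (A B : 'M[C]_m) : psd A -> psd B -> psd (A + B).
Proof.
move=> [hA pA] [hB pB]; split; first by rewrite adjmxD hA hB.
by move=> x; rewrite -/(qf _ _) qfD addr_ge0//; [exact: pA|exact: pB].
Qed.
Lemma psdZ m r (A : 'M[C]_m) : 0 <= r -> psd A -> psd ((r%:C)%C *: A).
Proof.
move=> r0 [hA pA]; split; first by rewrite adjmxZ hA.
by move=> x; rewrite -/(qf _ _) qfZ mulr_ge0//; exact: pA.
Qed.
Lemma psd0 m : psd (0 : 'M[C]_m).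
Proof. by split; [exact: adjmx0|move=> x; rewrite -/(qf _ _) qf0]. Qed.
Lemma psd1 m : psd (1%:M : 'M[C]_m).
Proof.
split; first exact: adjmx1.
by move=> x; rewrite -/(qf _ _) qf1 sumr_ge0// => i _; exact: sqn_ge0.
Qed.
Lemma psd_sum m I (r : seq I) (P : pred I) (F : I -> 'M[C]_m) :
  (forall i, P i -> psd (F i)) -> psd (\sum_(i <- r | P i) F i).
Proof. by move=> H; apply: (big_ind (@psd R m)); [exact: psd0|move=> A B; exact: psdD|exact: H]. Qed.
Lemma psd_conj m n (A : 'M[C]_m) (G : 'M[C]_(m, n)) : psd A -> psd (adjmx G *m A *m G).
Proof.
move=> [hA pA]; split; first by rewrite !adjmxM adjmxK hA mulmxA.
by move=> x; rewrite -/(qf _ _) qf_conj; exact: pA.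
Qed.
Lemma psd_gram m n (G : 'M[C]_(m, n)) : psd (adjmx G *m G).
Proof. by rewrite -[adjmx G]mulmx1; apply: psd_conj; exact: psd1. Qed.
Definition rdiag m (l : 'rV[R]_m) : 'M[C]_m := diag_mx (map_mx (fun r : R => (r%:C)%C) l).

Lemma unitary_adj m (U : 'M[C]_m) : unitary U -> adjmx U *m U = 1%:M.
Proof. exact: mulmx1C. Qed.
Lemma unitary_adjK m (U : 'M[C]_m) : unitary U -> unitary (adjmx U).
Proof. by move=> h; rewrite /unitary adjmxK; exact: unitary_adj. Qed.
Lemma unitaryM m (U V : 'M[C]_m) : unitary U -> unitary V -> unitary (U *m V).
Proof.
by rewrite /unitary => hU hV; rewrite adjmxM mulmxA -(mulmxA U) hV mulmx1.
Qed.

Lemma herm_spectral m (A : 'M[C]_m) : herm A -> exists Ul, spec_decomp A Ul.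
Proof.
move=> hA.
have cE (z : C) : Num.conj z = conjc z by [].
have hs : A \is hermsymmx.
  by apply/is_hermitianmxP; rewrite expr0 scale1r /= -map_trmx -[LHS]hA.
have := hermitian_normalmx hs => /orthomx_spectralP; set P := spectralmx A; set D := spectral_diag A => AE.
have uP : P \is unitarymx by exact: spectral_unitarymx.
have /mxOverP Dr := hermitian_spectral_diag_real hs.
have PE : invmx P = adjmx P by rewrite invmx_unitary // /adjmx map_trmx.
exists (adjmx P, map_mx (@complex.Re R) D); split => /=.
  rewrite /unitary adjmxK -PE mulVmx //; exact: unitarymx_unit.
rewrite adjmxK -PE AE; congr (_ *m diag_mx _ *m _).
by apply/rowP => i; rewrite !mxE RRe_real.
Qed.

Lemma spec_psd m (A : 'M[C]_m) U l : spec_decomp A (U, l) -> psd A -> forall i, 0 <= l 0 i.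
Proof.
move=> [/= uU AE] pA i.
have := psd_qf (U *m delta_mx i 0) pA.
rewrite AE -/(rdiag l) -{1}[U]adjmxK qf_conj mulmxA unitary_adj// mul1mx qf_diag.
rewrite (bigD1 i)//= big1 ?addr0; last first.
  by move=> j ji; rewrite mxE (negbTE ji) /= /sqn /= expr0n /= addr0 mulr0.
by rewrite mxE !eqxx /sqn /= expr1n expr0n /= addr0 mulr1.
Qed.

Lemma rdiag_herm m (l : 'rV[R]_m) : adjmx (rdiag l) = rdiag l.
Proof.
apply/matrixP => i j; rewrite adjmxE !mxE; case: eqP => [->|ne].
  by rewrite eqxx !mulr1n conjc_real.
by rewrite eq_sym; case: eqP => // _; rewrite conjc0.
Qed.

Lemma psd_rdiag m (l : 'rV[R]_m) : (forall i, 0 <= l 0 i) -> psd (rdiag l).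
Proof.
move=> l0; split; first exact: rdiag_herm.
move=> x; rewrite -/(qf _ _) qf_diag sumr_ge0// => i _; by rewrite mulr_ge0// sqn_ge0.
Qed.

Lemma rdiagM m (l l' : 'rV[R]_m) : rdiag l *m rdiag l' = rdiag (\row_i (l 0 i * l' 0 i)).
Proof.
apply/matrixP => i j; rewrite mul_diag_mx !mxE; case: eqP => [->|_].
  by rewrite !mulr1n rmorphM.
by rewrite !mulr0n mulr0.
Qed.

Lemma psd_factor m (A : 'M[C]_m) : psd A -> exists G : 'M[C]_m, A = adjmx G *m G.
Proof.
move=> pA; have [[U l] sd] := herm_spectral (psd_herm pA).
have l0 := spec_psd sd pA; have [/= uU AE] := sd.
exists (rdiag (\row_i Num.sqrt (l 0 i)) *m adjmx U).
rewrite adjmxM adjmxK rdiag_herm mulmxA -(mulmxA U) rdiagM AE.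
congr (_ *m _ *m _); congr (diag_mx _).
by apply/rowP => i; rewrite !mxE -expr2 sqr_sqrtr.
Qed.

Lemma retr_gram m n (G : 'M[C]_(m, n)) : 0 <= retr (adjmx G *m G).
Proof.
rewrite /retr /mxtrace Re_sum sumr_ge0// => i _; rewrite !mxE Re_sum sumr_ge0// => k _.
by rewrite adjmxE -sqnE /= sqn_ge0.
Qed.

(** With A = G^* G and B = H^* H, cyclicity turns the trace into that of the Gram matrix of H
    G^*. *)
Lemma psd_retr_mul m (A B : 'M[C]_m) : psd A -> psd B -> 0 <= retr (A *m B).
Proof.
move=> /psd_factor[G ->] /psd_factor[H ->].
rewrite -mulmxA retr_mulC.
suff -> : G *m (adjmx H *m H) *m adjmx G = adjmx (H *m adjmx G) *m (H *m adjmx G) by exact: retr_gram.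
by rewrite adjmxM adjmxK !mulmxA.
Qed.

Lemma psd_retr_ge0 m (A : 'M[C]_m) : psd A -> 0 <= retr A.
Proof. by move=> pA; rewrite -[A]mulmx1; exact: psd_retr_mul pA (psd1 m). Qed.

Lemma density_retr m (A : 'M[C]_m) : density A -> retr A = 1.
Proof. by case=> _; rewrite /retr => ->. Qed.

Lemma herm_tr_real m (A : 'M[C]_m) : herm A -> \tr A = ((retr A)%:C)%C.
Proof.
move=> hA; rewrite /retr.
have : complex.Im (\tr A) = 0.
  rewrite /mxtrace Im_sum big1// => i _.
  have := congr1 (fun M : 'M[C]_m => complex.Im (M i i)) hA.
  rewrite adjmxE; case: (A i i) => a b /= h; lra.
by case: (\tr A) => a b /= ->.
Qed.

End Adjoint.

(** * Weak converse *)

Section Relent.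
Variable R : realType.
Local Notation C := (R[i]).

Lemma ln_le_subr1 (x : R) : 0 < x -> ln x <= x - 1.
Proof. by move=> x0; rewrite -{1}[x](subrKC 1); apply: le_ln1Dx; lra. Qed.

(* Two spectral decompositions are intertwined by X = U'^* U, whose entry X_ij vanishes unless the i-th and j-th eigenvalues agree. *)
Lemma mxfunE m (f : R -> R) (A : 'M[C]_m) U l :
  spec_decomp A (U, l) -> mxfun f A = U *m rdiag (map_mx f l) *m adjmx U.
Proof.
move=> sd; rewrite /mxfun.
have : spec_decomp A (xget (0, 0) (spec_decomp A)) by exact: (xgetPex _ (ex_intro _ _ sd)).
case: (xget _ _) => V k [/= uV AV]; have [/= uU AU] := sd.
rewrite -/(rdiag _) in AV; rewrite -/(rdiag _) in AU.
rewrite (_ : map_mx _ k = map_mx (fun r : R => (r%:C)%C) (map_mx f k)); last by apply/rowP => i; rewrite !mxE.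
rewrite -/(rdiag _).
have key : rdiag k *m (adjmx V *m U) = (adjmx V *m U) *m rdiag l.
  have : V *m rdiag k *m adjmx V = U *m rdiag l *m adjmx U by rewrite -AV.
  move=> /(congr1 (fun M => adjmx V *m M *m U)).
  rewrite !mulmxA unitary_adj// mul1mx => ->.
  by rewrite -(mulmxA _ (adjmx U)) unitary_adj// mulmx1.
have keyf : rdiag (map_mx f k) *m (adjmx V *m U) = (adjmx V *m U) *m rdiag (map_mx f l).
  move: (adjmx V *m U) key => X key.
  apply/matrixP => i j; have := congr1 (fun M : 'M[C]_m => M i j) key.
  rewrite /rdiag !mul_diag_mx !mul_mx_diag !mxE.
  case: (eqVneq (X i j) 0) => [->|x0]; first by rewrite !mulr0 !mul0r.
  by rewrite mulrC => /(mulfI x0) /complexI ->; rewrite mulrC.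
have := congr1 (fun M => V *m M *m adjmx U) keyf.
rewrite !mulmxA uV mul1mx => <-.
by rewrite -(mulmxA _ U) uU mulmx1.
Qed.

(** For unitary U and W the weights sqn X_ij, X = U^* W, form a doubly stochastic matrix; quantum
    traces become classical double sums against it. *)
Lemma retr_spec_mul m (U W : 'M[C]_m) (a b : 'rV[R]_m) :
  retr ((U *m rdiag a *m adjmx U) *m (W *m rdiag b *m adjmx W)) =
  \sum_i \sum_j a 0 i * b 0 j * sqn ((adjmx U *m W) i j).
Proof.
set X := adjmx U *m W.
have -> : (U *m rdiag a *m adjmx U) *m (W *m rdiag b *m adjmx W) =
   U *m (rdiag a *m (X *m rdiag b *m adjmx W)) by rewrite /X !mulmxA.
rewrite retr_mulC.
have -> : rdiag a *m (X *m rdiag b *m adjmx W) *m U = rdiag a *m (X *m rdiag b *m adjmx X).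
  by rewrite /X adjmxM adjmxK !mulmxA.
rewrite /retr /mxtrace Re_sum; apply: eq_bigr => i _.
rewrite mul_diag_mx mxE [X in _ * X]mxE mulr_sumr Re_sum; apply: eq_bigr => j _.
rewrite mul_mx_diag adjmxE !mxE ReZ -mulrA -!mulrA; congr (_ * _).
by rewrite mulrCA ReZ mulrC -[_ * conjc _]mulrC -sqnE /= mulrC.
Qed.

Lemma unitary_row_sqn m (X : 'M[C]_m) i : unitary X -> \sum_j sqn (X i j) = 1.
Proof.
move=> uX; apply: complexI; rewrite rmorph_sum /= rmorph1.
have := congr1 (fun M : 'M[C]_m => M i i) uX; rewrite !mxE eqxx => h.
by rewrite -[RHS]h; apply: eq_bigr => j _; rewrite adjmxE sqnE mulrC.
Qed.

Lemma unitary_col_sqn m (X : 'M[C]_m) j : unitary X -> \sum_i sqn (X i j) = 1.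
Proof.
move=> /unitary_adjK /unitary_row_sqn -/(_ j) <-; apply: eq_bigr => i _.
by rewrite adjmxE sqn_conj.
Qed.

Lemma retr_spec m (A : 'M[C]_m) U a : spec_decomp A (U, a) -> retr A = \sum_i a 0 i.
Proof.
move=> [/= uU AE]; rewrite -[A]mulmx1 -uU AE.
have := retr_spec_mul U U a (const_mx 1); rewrite -/(rdiag a).
have -> : rdiag (const_mx 1) = 1%:M :> 'M[C]_m.
  by apply/matrixP => i j; rewrite !mxE; case: eqP.
rewrite mulmx1 => ->; apply: eq_bigr => i _.
rewrite (eq_bigr (fun j => a 0 i * sqn ((adjmx U *m U) i j))); last by move=> j _; rewrite mxE mulr1.
rewrite -mulr_sumr unitary_row_sqn ?mulr1//; apply: unitaryM => //; exact: unitary_adjK.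
Qed.

(** This is the classical relative entropy of P_ij = a_i |X_ij|^2 and Q_ij = b_j |X_ij|^2: the
    factors |X_ij|^2 cancel in P_ij / Q_ij, and nested supports become P_ij = 0 wherever b_j = 0. *)
Lemma relentE m (rho sigma : 'M[C]_m) U W a b :
  spec_decomp rho (U, a) -> spec_decomp sigma (W, b) ->
  (forall i, 0 <= a 0 i) -> (forall i, 0 <= b 0 i) ->
  let X := adjmx U *m W in
  relent rho sigma =
  if `[< forall i j, b 0 j = 0 -> a 0 i * sqn (X i j) = 0 >]
  then (\sum_i \sum_j a 0 i * sqn (X i j) * (ln (a 0 i) - ln (b 0 j)))%:E
  else +oo%E.
Proof.
move=> sr ss a0 b0 X.
have [/= uU rE] := sr; have [/= uW sE] := ss.
have uX : unitary X by apply: unitaryM => //; exact: unitary_adjK.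
rewrite -/(rdiag _) in rE; rewrite -/(rdiag _) in sE.
have XW : U *m X = W by rewrite /X mulmxA uU mul1mx.
rewrite /relent.
have -> : `[< forall x : 'cV_m, sigma *m x = 0 -> rho *m x = 0 >] = `[< forall i j, b 0 j = 0 -> a 0 i * sqn (X i j) = 0 >].
  apply: asbool_equiv_eq; split=> [H i j bj|H x sx].
    pose e : 'cV[C]_m := delta_mx j 0.
    have := H (W *m e); rewrite sE.
    have -> : W *m rdiag b *m adjmx W *m (W *m e) = 0.
      rewrite -!mulmxA (mulmxA (adjmx W)) unitary_adj// mul1mx.
      suff -> : rdiag b *m e = 0 by rewrite mulmx0.
      apply/matrixP => k l; rewrite mul_diag_mx !mxE; case: eqP => [->|_]; last by rewrite mulr0.
      by rewrite bj mul0r.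
    move=> /(_ erefl) hr.
    have : qf rho (W *m e) = 0 by rewrite /qf -mulmxA hr mulmx0 mxE.
    rewrite rE -{1}[U]adjmxK qf_conj qf_diag => /eqP.
    rewrite psumr_eq0; last by move=> k _; rewrite mulr_ge0// sqn_ge0.
    move=> /allP /(_ i); rewrite mem_index_enum => /(_ isT)/eqP.
    by rewrite mulmxA -/X -colE mxE.
  have H0 : qf sigma x = 0 by rewrite /qf -mulmxA sx mulmx0 mxE.
  move: H0; rewrite sE -{1}[W]adjmxK qf_conj qf_diag => /eqP.
  rewrite psumr_eq0; last by move=> k _; rewrite mulr_ge0// sqn_ge0.
  move=> /allP H0.
  have -> : x = W *m (adjmx W *m x) by rewrite mulmxA uW mul1mx.
  have : forall j, b 0 j * sqn ((adjmx W *m x) j 0) = 0.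
    by move=> j; apply/eqP/H0; rewrite mem_index_enum.
  move: (adjmx W *m x) => y {}H0.
  rewrite rE -!mulmxA (mulmxA (adjmx U)) -/X.
  suff -> : rdiag a *m (X *m y) = 0 by rewrite mulmx0.
  apply/matrixP => i k; rewrite mul_diag_mx !mxE mulr_sumr big1// => j _.
  rewrite ord1; have /eqP := H0 j; rewrite mulf_eq0 => /orP[/eqP/H|/eqP/sqn_eq0 ->]; last by rewrite !mulr0.
  move=> /(_ i) /eqP; rewrite mulf_eq0 => /orP[/eqP ->|/eqP/sqn_eq0 ->].
    by rewrite mul0r.
  by rewrite mul0r mulr0.
case: ifP => // _; congr (_%:E).
rewrite mulmxBr retrB /logmx (mxfunE _ sr) (mxfunE _ ss) rE !retr_spec_mul.
rewrite -sumrB; apply: eq_bigr => i _.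
have -> : \sum_j a 0 i * map_mx (@ln R) a 0 j * sqn ((adjmx U *m U) i j) = \sum_j a 0 i * ln (a 0 i) * sqn (X i j).
  rewrite unitary_adj// -mulr_sumr unitary_row_sqn// mulr1 (bigD1 i)//= big1 ?addr0.
    by rewrite !mxE eqxx /sqn /= expr1n expr0n /= addr0 mulr1.
  by move=> j ji; rewrite !mxE eq_sym (negbTE ji) /sqn /= expr0n /= addr0 mulr0.
by rewrite -sumrB; apply: eq_bigr => j _; rewrite !mxE /X; ring.
Qed.

(** Inserting W W^* = 1 between the two factors F resolves the trace over pairs (i, j). The two
    errors of a test, each taken in its own eigenbasis, can then be compared term by term. *)
Lemma retr_sandwich m (U W F : 'M[C]_m) (a : 'rV[R]_m) : unitary W -> herm F ->
  retr (U *m rdiag a *m adjmx U *m (F *m F)) = \sum_i \sum_j a 0 i * sqn ((adjmx U *m F *m W) i j).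
Proof.
move=> uW hF.
rewrite -mulmxA retr_mulC.
set Y := adjmx U *m F *m W.
have -> : adjmx U *m (F *m F) *m (U *m rdiag a) = (Y *m adjmx Y) *m rdiag a.
  by rewrite /Y !adjmxM adjmxK hF !mulmxA -(mulmxA _ W) uW mulmx1.
rewrite /retr /mxtrace Re_sum; apply: eq_bigr => i _.
rewrite mul_mx_diag mxE [X in X * _]mxE mulr_suml Re_sum; apply: eq_bigr => j _.
by rewrite adjmxE [Y i j * _]mulrC -sqnE [X in _ * X]mxE -rmorphM /= mulrC.
Qed.

Lemma psd_sub_sqr m (E : 'M[C]_m) : psd E -> psd (1%:M - E) -> psd (E - E *m E).
Proof.
move=> pE pF.
(* A sum of two conjugations of positive matrices, which avoids functional calculus. *)
have -> : E - E *m E = adjmx E *m (1%:M - E) *m E + adjmx (1%:M - E) *m E *m (1%:M - E).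
  rewrite adjmxB adjmx1 (psd_herm pE) !mulmxBr !mulmxBl !mulmx1 !mul1mx -!mulmxA.
  by rewrite [RHS]addrC subrK.
by apply: psdD; apply: psd_conj.
Qed.

(* The Nussbaum-Szkola bound: quantum test errors dominate those of the classical pair P_ij = a_i |X_ij|^2, Q_ij = b_j |X_ij|^2. *)
Lemma nussbaum_szkola m (U W E : 'M[C]_m) (a b : 'rV[R]_m) (t : R) :
  unitary U -> unitary W -> (forall i, 0 <= a 0 i) -> (forall i, 0 <= b 0 i) -> 0 <= t ->
  psd E -> psd (1%:M - E) ->
  \sum_i \sum_j Num.min (a 0 i) (t * b 0 j) * sqn ((adjmx U *m W) i j) <=
  2 * (retr (U *m rdiag a *m adjmx U *m (1%:M - E)) + t * retr (W *m rdiag b *m adjmx W *m E)).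
Proof.
move=> uU uW a0 b0 t0 pE pF.
set F := 1%:M - E.
have p1 : psd (1%:M - F) by rewrite /F opprB addrC subrK.
have pr : forall (V : 'M[C]_m) (l : 'rV[R]_m), (forall i, 0 <= l 0 i) -> psd (V *m rdiag l *m adjmx V).
  by move=> V l l0; rewrite -{1}[V]adjmxK; apply: psd_conj; exact: psd_rdiag.
have H1 : retr (U *m rdiag a *m adjmx U *m (F *m F)) <= retr (U *m rdiag a *m adjmx U *m F).
  rewrite -subr_ge0 -retrB -mulmxBr; apply: psd_retr_mul; [exact: pr U _ a0|exact: psd_sub_sqr].
have H2 : retr (W *m rdiag b *m adjmx W *m (E *m E)) <= retr (W *m rdiag b *m adjmx W *m E).
  rewrite -subr_ge0 -retrB -mulmxBr; apply: psd_retr_mul; [exact: pr W _ b0|exact: psd_sub_sqr].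
rewrite (retr_sandwich _ _ uW (psd_herm pF)) in H1.
rewrite (retr_sandwich _ _ uU (psd_herm pE)) in H2.
apply: (@le_trans _ _ (2 * (\sum_i \sum_j a 0 i * sqn ((adjmx U *m F *m W) i j) + t * \sum_i \sum_j b 0 i * sqn ((adjmx W *m E *m U) i j)))); last first.
  by rewrite ler_pM2l// lerD// ler_wpM2l.
rewrite [X in t * X]exchange_big /= mulr_sumr -big_split /= mulr_sumr; apply: ler_sum => i _.
rewrite mulr_sumr -big_split /= mulr_sumr; apply: ler_sum => j _.
have -> : (adjmx W *m E *m U) j i = conjc ((adjmx U *m E *m W) i j).
  by rewrite -adjmxE !adjmxM adjmxK (psd_herm pE) mulmxA.
rewrite sqn_conj.
(* F + E = 1 splits the overlap; |z + w|^2 <= 2 (|z|^2 + |w|^2) is the source of the factor 2, and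
   the minimum is bounded by a_i on the z part and by t b_j on the w part. *)
have -> : (adjmx U *m W) i j = (adjmx U *m F *m W) i j + (adjmx U *m E *m W) i j.
  by rewrite /F mulmxBr mulmxBl mulmx1 !mxE subrK.
set z := (adjmx U *m F *m W) i j; set w := (adjmx U *m E *m W) i j.
have := sqnD_le z w; have := sqn_ge0 z; have := sqn_ge0 w.
set c := Num.min _ _ => w0 z0 zw.
have ca : c <= a 0 i by rewrite ge_min lexx.
have cb : c <= t * b 0 j by rewrite ge_min lexx orbT.
have c0 : 0 <= c by rewrite le_min a0 mulr_ge0.
nra.
Qed.

(** Pointwise, p ln(p/q) >= ln t (p - min(p, t q)) - q. After summation the minimum is controlled by
    the Nussbaum-Szkola bound and the last term by the mass of Q, whence the -1. *)
Lemma relent_test_ge m (rho sigma E : 'M[C]_m) (eps beta t : R) :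
  density rho -> psd sigma -> retr sigma <= 1 -> psd E -> psd (1%:M - E) ->
  retr (rho *m (1%:M - E)) <= eps -> retr (sigma *m E) <= beta -> 1 <= t ->
  ((ln t * (1 - 2 * (eps + t * beta)) - 1)%:E <= relent rho sigma)%E.
Proof.
move=> dr ps ts pE pF h1 h2 t1.
have pr := dr.1.
have [[U a] sr] := herm_spectral (psd_herm pr).
have [[W b] ss] := herm_spectral (psd_herm ps).
have a0 := spec_psd sr pr; have b0 := spec_psd ss ps.
rewrite (relentE sr ss a0 b0) /=; case: ifP => [/asboolP H|_]; last by rewrite leey.
have [/= uU rE] := sr; have [/= uW sE] := ss.
have uX : unitary (adjmx U *m W) by apply: unitaryM => //; exact: unitary_adjK.
rewrite lee_fin.
have t0 : 0 <= t by exact: le_trans t1.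
have := nussbaum_szkola uU uW a0 b0 t0 pE pF.
rewrite /rdiag -rE -sE; set X := adjmx U *m W => NS.
set S := \sum_i _ in NS.
have SB : S <= 2 * (eps + t * beta).
  apply: (le_trans NS); rewrite ler_pM2l// lerD// ler_wpM2l//.
have lt0 : 0 <= ln t by exact: ln_ge0.
have P1 : \sum_i \sum_j a 0 i * sqn (X i j) = 1.
  rewrite -[RHS](density_retr dr) (retr_spec sr); apply: eq_bigr => i _.
  by rewrite -mulr_sumr unitary_row_sqn// mulr1.
have Q1 : \sum_i \sum_j b 0 j * sqn (X i j) <= 1.
  apply: le_trans ts; rewrite (retr_spec ss) exchange_big /=; apply: ler_sum => j _.
  by rewrite -mulr_sumr unitary_col_sqn// mulr1.
apply: (@le_trans _ _ (ln t - ln t * S - 1)); first by nra.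
apply: (@le_trans _ _ (\sum_i \sum_j (ln t * (a 0 i * sqn (X i j)) - ln t * (Num.min (a 0 i) (t * b 0 j) * sqn (X i j)) - b 0 j * sqn (X i j)))).
  rewrite (eq_bigr (fun i => ln t * (\sum_j a 0 i * sqn (X i j)) - ln t * (\sum_j Num.min (a 0 i) (t * b 0 j) * sqn (X i j)) - \sum_j b 0 j * sqn (X i j))); last first.
    by move=> i _; rewrite !sumrB -!mulr_sumr.
  by rewrite !sumrB -!mulr_sumr P1 mulr1 -/S lerB.
apply: ler_sum => i _; apply: ler_sum => j _.
have x0 := sqn_ge0 (X i j); have ai0 := a0 i; have bj0 := b0 j; have Hij := H i j.
move: (sqn (X i j)) x0 (a 0 i) ai0 (b 0 j) bj0 Hij => x x0 p p0 q q0 Hpq.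
have [->|pn] := eqVneq p 0.
  rewrite minEle !mul0r mulr_ge0// mul0r mulr0 subr0 sub0r; by rewrite oppr_le0 mulr_ge0.
have [q0'|qn] := eqVneq q 0.
  rewrite q0' mulr0 minEle; have := Hpq q0' => /eqP; rewrite mulf_eq0 (negbTE pn) /= => /eqP ->.
  by rewrite !mulr0 !subr0 mul0r.
have pp : 0 < p by rewrite lt_neqAle eq_sym pn.
have qp : 0 < q by rewrite lt_neqAle eq_sym qn.
(* If p <= t q the left side is -q, while p ln(p/q) >= p - q. Otherwise p/q > t, and the subtracted
   terms are nonnegative. *)
suff : ln t * p - ln t * Num.min p (t * q) - q <= p * (ln p - ln q) by nra.
rewrite minEle; case: ifP => [_|/negbT].
  rewrite subrr sub0r.
  (* ln (q/p) <= q/p - 1 *)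
  have : ln (q / p) <= q / p - 1 by apply: ln_le_subr1; rewrite divr_gt0.
  rewrite ln_div ?posrE// => h.
  have : p * (ln q - ln p) <= p * (q / p - 1) by rewrite ler_pM2l.
  rewrite mulrBr mulrBr mulr1 mulrCA divff// mulr1; lra.
rewrite -ltNge => tqp.
have : ln (t * q) <= ln p by rewrite ler_ln ?posrE ?mulr_gt0 ?(lt_le_trans _ t1)// ltW.
rewrite lnM ?posrE ?(lt_le_trans _ t1)// => h.
have : 0 <= ln t * (t * q) by rewrite mulr_ge0// mulr_ge0.
nra.
Qed.

End Relent.

(** * Measured relative entropy *)

Section Pinching.
Variable R : realType.
Local Notation C := (R[i]).

Lemma sum_row_gram m n (A : 'M[C]_(m, n)) : \sum_y adjmx (row y A) *m row y A = adjmx A *m A.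
Proof.
apply/matrixP => i j; rewrite summxE [RHS]mxE; apply: eq_bigr => y _.
by rewrite mxE big_ord1 !adjmxE !mxE.
Qed.

Lemma retr_row_gram m n (A : 'M[C]_(m, n)) (B : 'M[C]_n) y :
  retr (B *m (adjmx (row y A) *m row y A)) = complex.Re ((A *m B *m adjmx A) y y).
Proof.
rewrite mulmxA retr_mulC mulmxA /retr /mxtrace big_ord1.
congr complex.Re; rewrite mxE [RHS]mxE; apply: eq_bigr => j _; congr (_ * _); last first.
  by rewrite !adjmxE mxE.
by rewrite !mxE; apply: eq_bigr => k _; rewrite mxE.
Qed.

Lemma retr_spec_qf m (U B : 'M[C]_m) (a : 'rV[R]_m) :
  retr (U *m rdiag a *m adjmx U *m B) = \sum_i a 0 i * qf B (col i U).
Proof.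
rewrite -2!mulmxA retr_mulC -mulmxA retr_mulC /retr /mxtrace Re_sum; apply: eq_bigr => i _.
rewrite mul_mx_diag mxE [X in _ * X]mxE mulrC ReZ; congr (_ * _).
rewrite /qf colE adjmxM; congr complex.Re.
have -> : adjmx (delta_mx i 0) = delta_mx 0 i :> 'rV[C]_m.
  by apply/matrixP => j k; rewrite adjmxE !mxE andbC conjc_nat.
by rewrite [in RHS]mulmxA -colE [RHS]mxE -!mulmxA -rowE [RHS]mxE !mulmxA.
Qed.

Lemma qf_rank1 m (u z : 'cV[C]_m) : qf (u *m adjmx u) z = sqn ((adjmx u *m z) 0 0).
Proof.
rewrite /qf !mulmxA -mulmxA.
have -> : adjmx z *m u = adjmx (adjmx u *m z) by rewrite adjmxM adjmxK.
by rewrite mxE big_ord1 adjmxE -sqnE.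
Qed.

(* Test the operator inequality on the vector with coordinates <w_y|u> / x_y. *)
Lemma rank1_le_spec m (W : 'M[C]_m) (x : 'rV[R]_m) (u : 'cV[C]_m) (a : R) :
  unitary W -> (forall y, 0 <= x 0 y) -> 0 < a ->
  psd (W *m rdiag x *m adjmx W - (a%:C)%C *: (u *m adjmx u)) ->
  (forall y, x 0 y = 0 -> (adjmx W *m u) y 0 = 0) /\
  \sum_y sqn ((adjmx W *m u) y 0) / x 0 y <= a^-1.
Proof.
move=> uW x0 a0 /(psd_conj W).
have -> : adjmx W *m (W *m rdiag x *m adjmx W - (a%:C)%C *: (u *m adjmx u)) *m W =
  rdiag x - (a%:C)%C *: ((adjmx W *m u) *m adjmx (adjmx W *m u)).
  rewrite mulmxBr mulmxBl !mulmxA unitary_adj// mul1mx -mulmxA unitary_adj// mulmx1.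
  by rewrite adjmxM adjmxK -scalemxAr -scalemxAl !mulmxA.
move: (adjmx W *m u) => v pX.
have H (z : 'cV[C]_m) : a * sqn ((adjmx v *m z) 0 0) <= \sum_i x 0 i * sqn (z i 0).
  rewrite -qf_rank1 -qf_diag -/(rdiag _) -qfZ -subr_ge0 -qfB; exact: psd_qf.
split=> [y xy0|].
  have := H (delta_mx y 0); rewrite -colE mxE adjmxE sqn_conj.
  rewrite (bigD1 y)//= big1 ?addr0 ?xy0 ?mul0r; last first.
    by move=> j jy; rewrite mxE (negbTE jy) /sqn /= expr0n /= addr0 mulr0.
  rewrite pmulr_rle0// => h; apply/sqn_eq0/eqP; by rewrite eq_le h sqn_ge0.
set q := \sum_y _.
have := H (\col_y (((x 0 y)^-1%:C)%C * v y 0)).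
have -> : \sum_i x 0 i * sqn ((\col_y (((x 0 y)^-1%:C)%C * v y 0)) i 0) = q.
  apply: eq_bigr => y _; rewrite mxE sqnM sqnR.
  have [->|xn] := eqVneq (x 0 y) 0; first by rewrite invr0 mul0r mulr0.
  by field.
have -> : (adjmx v *m (\col_y (((x 0 y)^-1%:C)%C * v y 0))) 0 0 = (q%:C)%C.
  rewrite mxE rmorph_sum /=; apply: eq_bigr => y _.
  by rewrite adjmxE mxE mulrCA -sqnE -rmorphM /= mulrC.
rewrite sqnR => h.
have q0 : 0 <= q by apply: sumr_ge0 => y _; rewrite divr_ge0// sqn_ge0.
have [->|qn] := eqVneq q 0; first by rewrite invr_ge0 ltW.
have qp : 0 < q by rewrite lt_neqAle eq_sym qn.
rewrite -[leRHS]mul1r ler_pdivlMr// mulrC -(ler_pM2r qp) mul1r.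
by rewrite -mulrA -expr2.
Qed.

Lemma spec_col m (rho : 'M[C]_m) U a i : spec_decomp rho (U, a) -> (forall i, 0 <= a 0 i) ->
  psd (rho - ((a 0 i)%:C)%C *: (col i U *m adjmx (col i U))).
Proof.
move=> [/= uU ->] a0; rewrite -/(rdiag a).
pose l := \row_j (if j == i then 0 else a 0 j).
suff -> : U *m rdiag a *m adjmx U - ((a 0 i)%:C)%C *: (col i U *m adjmx (col i U)) = adjmx (adjmx U) *m rdiag l *m adjmx U.
  by apply: psd_conj; apply: psd_rdiag => j; rewrite mxE; case: ifP.
rewrite adjmxK colE adjmxM !mulmxA -(mulmxA U) -!mulmxA.
rewrite scalemxAr -mulmxBr; congr (_ *m _).
rewrite !mulmxA scalemxAl -mulmxBl; congr (_ *m _).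
apply/matrixP => j k; rewrite !mxE big_ord1 adjmxE !mxE eqxx !andbT.
have [<-|jk] := eqVneq j k.
  have [->|ji] := eqVneq j i; first by rewrite !mulr1n conjc1 mulr1 mulr1 subrr.
  by rewrite !mulr0n conjc0 !mulr0 subr0 mulr1n.
rewrite !mulr0n; have [ji|ji] := eqVneq j i; last by rewrite !mulr0n mul0r mulr0 subrr.
by have [ki|ki] := eqVneq k i; [rewrite ji ki eqxx in jk|rewrite !mulr0n conjc0 !mulr0 subrr].
Qed.

(** The shift by eta keeps all logarithms finite, so that finite and infinite relative entropy are
    treated alike. With nested supports it costs at most eta times the sum of P_ij / b_j; without, a
    term P_ij ln(1/eta) with b_j = 0 exceeds any bound. *)
Lemma relent_reg m (rho sigma U W : 'M[C]_m) (a b : 'rV[R]_m) (K : R) :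
  spec_decomp rho (U, a) -> spec_decomp sigma (W, b) ->
  (forall i, 0 <= a 0 i) -> (forall i, 0 <= b 0 i) ->
  (K%:E < relent rho sigma)%E ->
  exists2 eta, 0 < eta & K < \sum_i \sum_j a 0 i * sqn ((adjmx U *m W) i j) * (ln (a 0 i) - ln (b 0 j + eta)).
Proof.
move=> sr ss a0 b0; rewrite (relentE sr ss a0 b0) /=; set X := adjmx U *m W.
case: ifP => [/asboolP H|/asboolPn H].
  rewrite lte_fin; set D := \sum_i _ => KD.
  set L := \sum_i \sum_j a 0 i * sqn (X i j) / b 0 j.
  have L0 : 0 <= L by apply: sumr_ge0 => i _; apply: sumr_ge0 => j _; rewrite divr_ge0// mulr_ge0// sqn_ge0.
  exists ((D - K) / (L + 1)); first by rewrite divr_gt0 ?subr_gt0 ?ltr_wpDl.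
  set eta := _ / _.
  have eta0 : 0 < eta by rewrite divr_gt0 ?subr_gt0 ?ltr_wpDl.
  have etaL : eta * L < D - K.
    rewrite /eta mulrAC ltr_pdivrMr ?ltr_wpDl// ltr_pM2l ?subr_gt0//; lra.
  have : D - eta * L <= \sum_i \sum_j a 0 i * sqn (X i j) * (ln (a 0 i) - ln (b 0 j + eta)).
    rewrite /D /L mulr_sumr -sumrB; apply: ler_sum => i _.
    rewrite mulr_sumr -sumrB; apply: ler_sum => j _.
    have := H i j; have := b0 j; have : 0 <= a 0 i * sqn (X i j) by rewrite mulr_ge0// sqn_ge0.
    move: (a 0 i * _) (b 0 j) => p q p0 q0 Hpq.
    have [/Hpq ->|qn] := eqVneq q 0; first by rewrite !mul0r mulr0 subr0.
    have qp : 0 < q by rewrite lt_neqAle eq_sym qn.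
    have : ln ((q + eta) / q) <= (q + eta) / q - 1 by apply: ln_le_subr1; rewrite divr_gt0// addr_gt0.
    rewrite ln_div ?posrE ?addr_gt0// mulrDl divff// => h.
    have : 0 <= p * (eta / q - (ln (q + eta) - ln q)) by rewrite mulr_ge0//; lra.
    rewrite (mulrCA eta p); lra.
  lra.
move=> _.
have [i0 [j0 [bj0 Pn]]] : exists i j, b 0 j = 0 /\ a 0 i * sqn (X i j) != 0.
  apply: contrapT => Hn; apply: H => i j bj; apply: contrapT => /eqP h; apply: Hn.
  by exists i, j.
pose P i j := a 0 i * sqn (X i j).
have P0 i j : 0 <= P i j by rewrite mulr_ge0// sqn_ge0.
have Pp : 0 < P i0 j0 by rewrite lt_neqAle eq_sym Pn P0.
(* ln (b + eta) <= b + eta - 1 <= b *)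
set B := \sum_i \sum_j P i j * (ln (a 0 i) - b 0 j).
(* Chosen so that P i0 j0 * (- ln eta) equals |K - B| + 1; the remaining contributions add up to at
   least B. *)
pose eta := expR (- (`|K - B| + 1) / P i0 j0).
have eta0 : 0 < eta by exact: expR_gt0.
have eta1 : eta <= 1 by rewrite -expR0 ler_expR mulNr oppr_le0 divr_ge0// addr_ge0.
exists eta => //.
apply: (@lt_le_trans _ _ (B + P i0 j0 * - ln eta)).
  rewrite /eta expRK mulNr opprK mulrC divfK ?gt_eqF//.
  have := ler_norm (K - B); lra.
have -> : P i0 j0 * - ln eta = \sum_i \sum_j (if (i == i0) && (j == j0) then P i j * - ln eta else 0).
  rewrite (bigD1 i0)//= [X in _ + X]big1 ?addr0; last first.
    by move=> i ii; rewrite big1// => j _; rewrite (negbTE ii).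
  rewrite (bigD1 j0)//= [X in _ + X]big1 ?addr0 ?eqxx//.
  by move=> j jj; rewrite (negbTE jj).
rewrite /B -big_split /=; apply: ler_sum => i _; rewrite -big_split /=; apply: ler_sum => j _.
rewrite -/(P i j); case: ifP => [/andP[/eqP -> /eqP ->]|_].
  by rewrite bj0 subr0 add0r -mulrDr.
rewrite addr0 ler_wpM2l// lerB//.
have : ln (b 0 j + eta) <= b 0 j + eta - 1 by apply: ln_le_subr1; rewrite ltr_wpDl.
lra.
Qed.

(* Measuring first the eigenspaces of sigma (v of them) and then the pinched rho costs at most ln v. *)
Lemma measured_relent m (rho sigma : 'M[C]_m) (V : R) (W : 'M[C]_m) (b : 'rV[R]_m)
    (phi : 'I_m -> 'I_m) (c : 'I_m -> R) :
  density rho -> psd sigma -> retr sigma <= 1 -> spec_decomp sigma (W, b) ->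
  (forall j, b 0 j = c (phi j)) -> (forall k, 0 <= c k) ->
  (V%:E + (ln (#|[set phi j | j : 'I_m]%SET|%:R))%:E < relent rho sigma)%E ->
  exists (M : 'I_m * 'I_m -> 'M[C]_m) (t : 'I_m * 'I_m -> R),
    [/\ forall x, psd (M x), \sum_x M x = 1%:M, forall x, 0 < t x &
     V < \sum_x ln (t x) * retr (rho *m M x) + 1 - \sum_x t x * retr (sigma *m M x)].
Proof.
move=> dr ps ts ss bc c0.
set S := [set phi j | j : 'I_m]%SET; set v := #|S| => HV.
have pr := dr.1; have b0 := spec_psd ss ps.
have [[U a] sr] := herm_spectral (psd_herm pr).
have a0 := spec_psd sr pr.
have [/= uU rE] := sr; have [/= uW sE] := ss.
rewrite -/(rdiag _) in rE; rewrite -/(rdiag _) in sE.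
pose Pi (k : 'I_m) := W *m rdiag (\row_j (phi j == k)%:R) *m adjmx W.
have hPi (k : 'I_m) : herm (Pi k) by rewrite /herm /Pi !adjmxM adjmxK rdiag_herm mulmxA.
have PiPi k : Pi k *m Pi k = Pi k.
  rewrite /Pi !mulmxA -(mulmxA _ (adjmx W) W) (unitary_adj uW) mulmx1 -(mulmxA W) rdiagM.
  by congr (_ *m rdiag _ *m _); apply/rowP => j; rewrite !mxE -natrM mulnb andbb.
have sumPi : \sum_k Pi k = 1%:M.
  rewrite /Pi -mulmx_suml -mulmx_sumr -[RHS]uW; congr (_ *m _).
  rewrite -[RHS]mulmx1; congr (_ *m _).
  apply/matrixP => i j; rewrite summxE.
  rewrite (bigD1 (phi i))//= big1 ?addr0; first by rewrite !mxE eqxx.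
  by move=> k ki; rewrite !mxE eq_sym (negbTE ki) mul0rn.
have sPi k : sigma *m Pi k = ((c k)%:C)%C *: Pi k.
  rewrite sE /Pi !mulmxA -(mulmxA _ (adjmx W) W) (unitary_adj uW) mulmx1 -(mulmxA W) rdiagM.
  rewrite scalemxAl scalemxAr; congr (_ *m _ *m _).
  apply/matrixP => i j; rewrite !mxE; case: (eqVneq i j) => [_|_]; last by rewrite !mulr0n mulr0.
  rewrite !mulr1n -rmorphM /= bc; case: eqP => [->|_] //.
  by rewrite !mulr0.
have pP k : psd (Pi k *m rho *m Pi k) by rewrite -{1}[Pi k]hPi; exact: psd_conj.
have /choice[Wr hWr] : forall k, exists Ul : 'M[C]_m * 'rV[R]_m, spec_decomp (Pi k *m rho *m Pi k) Ul.
  by move=> k; exact: herm_spectral (psd_herm (pP k)).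
pose w (k : 'I_m) := (Wr k).1; pose r (k : 'I_m) := (Wr k).2.
have sp k : spec_decomp (Pi k *m rho *m Pi k) (w k, r k).
  by have := hWr k; rewrite /w /r; case: (Wr k).
have uw k : unitary (w k) by have [] := sp k.
have r0 k : forall y, 0 <= r k 0 y by exact: spec_psd (sp k) (pP k).
pose A (k : 'I_m) := adjmx (w k) *m Pi k.
(* Eigenvectors of the pinched block, compressed by Pi k: these operators add up to Pi k although
   the basis in [w k] spans the whole space. *)
pose M (x : 'I_m * 'I_m) := adjmx (row x.2 (A x.1)) *m row x.2 (A x.1).
have pM x : psd (M x) by exact: psd_gram.
have sMk k : \sum_y M (k, y) = Pi k.
  by rewrite /M /= sum_row_gram /A adjmxM adjmxK hPi mulmxA -(mulmxA (Pi k)) uw mulmx1 PiPi.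
have sM : \sum_x M x = 1%:M.
  rewrite -sumPi -(pair_bigA _ (fun k y => M (k, y))) /=; apply: eq_bigr => k _; exact: sMk.
have rM k y : retr (rho *m M (k, y)) = r k 0 y.
  rewrite /M /= retr_row_gram /A adjmxM adjmxK hPi.
  have -> : adjmx (w k) *m Pi k *m rho *m (Pi k *m w k) = adjmx (w k) *m (Pi k *m rho *m Pi k) *m w k.
    by rewrite !mulmxA.
  have [/= _ ->] := sp k.
  by rewrite !mulmxA unitary_adj// mul1mx -mulmxA unitary_adj// mulmx1 !mxE eqxx mulr1n.
have sMM k y : sigma *m M (k, y) = ((c k)%:C)%C *: M (k, y).
  rewrite /M /= row_mul adjmxM mulmxA.
  have -> : adjmx (Pi k) = Pi k by exact: hPi.
  by rewrite (mulmxA sigma) sPi -!scalemxAl.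
pose n k y := retr (M (k, y)).
have n01 k y : 0 <= n k y <= 1.
  rewrite (psd_retr_ge0 (pM (k, y))) /= /n.
  have -> : M (k, y) = adjmx (Pi k) *m (adjmx (row y (adjmx (w k))) *m row y (adjmx (w k))) *m Pi k.
    by rewrite /M /= /A row_mul adjmxM !mulmxA.
  rewrite retr_mulC mulmxA (hPi k) PiPi.
  apply: (@le_trans _ _ (retr (adjmx (row y (adjmx (w k))) *m row y (adjmx (w k))))); last first.
    rewrite -[X in retr X]mul1mx retr_row_gram mulmx1 adjmxK unitary_adj//.
    by rewrite !mxE eqxx.
  rewrite -subr_ge0 -retrB -{1}[_ *m row y _]mul1mx -mulmxBl; apply: psd_retr_mul; last exact: psd_gram.
  suff -> : 1%:M - Pi k = adjmx (1%:M - Pi k) *m (1%:M - Pi k) by exact: psd_gram.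
  by rewrite adjmxB adjmx1 hPi mulmxBl !mulmxBr !mul1mx !mulmx1 PiPi subrr subr0.
have sumr : \sum_k \sum_y r k 0 y = 1.
  rewrite -(density_retr dr) -[rho in RHS]mulmx1 -sM mulmx_sumr retr_sum.
  rewrite -(pair_bigA _ (fun k y => retr (rho *m M (k, y)))) /=.
  by apply: eq_bigr => k _; apply: eq_bigr => y _; rewrite rM.
pose X := adjmx U *m W.
have uX : unitary X by apply: unitaryM => //; exact: unitary_adjK.
have sumP f : \sum_k f (c k) * (\sum_y r k 0 y) = \sum_i \sum_j a 0 i * sqn (X i j) * f (b 0 j).
  transitivity (retr (rho *m (W *m rdiag (map_mx f b) *m adjmx W))); last first.
    rewrite rE retr_spec_mul; apply: eq_bigr => i _; apply: eq_bigr => j _.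
    by rewrite mxE -/X; ring.
  transitivity (\sum_k f (c k) * retr (rho *m Pi k)).
    apply: eq_bigr => k _; rewrite -sMk mulmx_sumr retr_sum; congr (_ * _).
    by apply: eq_bigr => y _; rewrite rM.
  rewrite (eq_bigr (fun k => retr (rho *m (((f (c k))%:C)%C *: Pi k)))); last first.
    by move=> k _; rewrite -scalemxAr retrZ.
  rewrite -retr_sum -mulmx_sumr; congr (retr (_ *m _)).
  rewrite (eq_bigr (fun k => W *m (((f (c k))%:C)%C *: rdiag (\row_j (phi j == k)%:R)) *m adjmx W)); last first.
    by move=> k _; rewrite /Pi scalemxAl scalemxAr.
  rewrite -mulmx_suml -mulmx_sumr; congr (_ *m _ *m _).
  apply/matrixP => i j; rewrite summxE (bigD1 (phi i))//= big1 ?addr0.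
    by rewrite !mxE eqxx bc mulrnAr mulr1.
  by move=> k ki; rewrite !mxE eq_sym (negbTE ki) mul0rn mulr0.
pose ci i k y := qf (M (k, y)) (col i U).
have ciE i k y : ci i k y = sqn ((adjmx (w k) *m (Pi k *m col i U)) y 0).
  rewrite /ci -[M _]mulmx1 /M /= -{2}(adjmxK (row y (A k))) -[adjmx (row y _) *m _]mul1mx.
  rewrite mulmx1 mul1mx qf_rank1 adjmxK /A -row_mul mxE.
  by rewrite -mulmxA.
have rci k y : r k 0 y = \sum_i a 0 i * ci i k y.
  by rewrite -rM rE retr_spec_qf.
have ci0 i k y : 0 <= ci i k y by exact: psd_qf (pM (k, y)).
have sci i : \sum_k \sum_y ci i k y = 1.
  have -> : \sum_k \sum_y ci i k y = qf (\sum_x M x) (col i U).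
    rewrite qf_retr mulmx_suml retr_sum.
    rewrite -(pair_bigA _ (fun k y => retr (M (k, y) *m (col i U *m adjmx (col i U))))) /=.
    by apply: eq_bigr => k _; apply: eq_bigr => y _; rewrite -qf_retr.
  rewrite sM qf1 -[RHS](unitary_col_sqn i uU).
  by apply: eq_bigr => j _; rewrite mxE.
(* Compressing rho >= a_i |u_i><u_i| to block k and applying [rank1_le_spec] bounds the sum by 1 /
   a_i; blocks outside the image of [phi] contribute nothing. *)
have L1 i k : 0 < a 0 i -> (forall y, r k 0 y = 0 -> ci i k y = 0) /\
   \sum_y ci i k y / r k 0 y <= (a 0 i)^-1 *+ (k \in S).
  move=> ai.
  have [kS|kS] := boolP (k \in S); last first.
    have c0' y : ci i k y = 0.
      rewrite ciE; suff -> : Pi k = 0 by rewrite mul0mx mulmx0 mxE /sqn /= expr0n /= addr0.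
      rewrite /Pi; suff -> : rdiag (\row_j (phi j == k)%:R) = 0 :> 'M[C]_m by rewrite mulmx0 mul0mx.
      apply/matrixP => p q; rewrite !mxE; case: eqP => [pk|_]; last by rewrite mul0rn.
      by move: kS; rewrite -pk imset_f.
    by split=> //; rewrite mulr0n big1// => y _; rewrite c0' mul0r.
  have := @rank1_le_spec _ (w k) (r k) (Pi k *m col i U) (a 0 i) (uw k) (r0 k) ai.
  have [/= _ <-] := sp k.
  have -> : Pi k *m rho *m Pi k - ((a 0 i)%:C)%C *: (Pi k *m col i U *m adjmx (Pi k *m col i U)) =
    adjmx (Pi k) *m (rho - ((a 0 i)%:C)%C *: (col i U *m adjmx (col i U))) *m Pi k.
    by rewrite adjmxM !(hPi k) mulmxBr mulmxBl -scalemxAr -scalemxAl !mulmxA.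
  move=> /(_ (psd_conj _ (spec_col i sr a0))) [H1 H2]; split=> [y ry|].
    by rewrite ciE H1// /sqn /= expr0n /= addr0.
  by rewrite mulr1n; under eq_bigr do rewrite ciE.
(* The measurement raises the entropy by at most ln v. For fixed i the ci are probabilities; the
   tangent bound ln r >= 1 + ln kap - kap / r at kap = a_i / v is averaged over them, and by L1 the
   last term averages to at most 1. *)
have Ent : \sum_i a 0 i * ln (a 0 i) - ln v%:R <= \sum_k \sum_y r k 0 y * ln (r k 0 y).
  have -> : \sum_k \sum_y r k 0 y * ln (r k 0 y) = \sum_i a 0 i * (\sum_k \sum_y ci i k y * ln (r k 0 y)).
    under eq_bigr => k _ do under eq_bigr => y _ do rewrite {1}rci mulr_suml.
    under eq_bigr => k _ do rewrite exchange_big /=.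
    rewrite exchange_big /=; apply: eq_bigr => i _; rewrite mulr_sumr; apply: eq_bigr => k _.
    by rewrite mulr_sumr; apply: eq_bigr => y _; rewrite mulrA.
  have -> : ln v%:R = \sum_i a 0 i * ln v%:R.
    by rewrite -mulr_suml -(retr_spec sr) (density_retr dr) mul1r.
  rewrite -sumrB; apply: ler_sum => i _; rewrite -mulrBr.
  have [->|ain] := eqVneq (a 0 i) 0; first by rewrite !mul0r.
  have ai : 0 < a 0 i by rewrite lt_neqAle eq_sym ain a0.
  rewrite ler_pM2l//.
  have v0 : 0 < v%:R :> R by rewrite ltr0n; apply/card_gt0P; exists (phi i); rewrite imset_f.
  rewrite -ln_div ?posrE//; set kap := a 0 i / v%:R.
  have kap0 : 0 < kap by rewrite divr_gt0.
  apply: (@le_trans _ _ (\sum_k \sum_y (ci i k y * (1 + ln kap) - kap * (ci i k y / r k 0 y)))).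
    rewrite (eq_bigr (fun k => (\sum_y ci i k y) * (1 + ln kap) - kap * \sum_y (ci i k y / r k 0 y))); last first.
      by move=> k _; rewrite sumrB -mulr_suml -mulr_sumr.
    rewrite sumrB -mulr_suml sci mul1r -mulr_sumr.
    have : \sum_k \sum_y ci i k y / r k 0 y <= (a 0 i)^-1 * v%:R.
      apply: (@le_trans _ _ (\sum_k (a 0 i)^-1 *+ (k \in S))).
        by apply: ler_sum => k _; have [] := L1 i k ai.
      rewrite sumrMnr mulr_natr.
      suff -> : v = (\sum_(k < m) (k \in S))%N by [].
      by rewrite /v -sum1_card big_mkcond /=; apply: eq_bigr => k _; case: ifP.
    rewrite -(ler_pM2l kap0).
    have -> : kap * ((a 0 i)^-1 * v%:R) = 1 by rewrite /kap; field; rewrite ain gt_eqF.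
    lra.
  apply: ler_sum => k _; apply: ler_sum => y _.
  have [H1 _] := L1 i k ai.
  have [ry|ry] := eqVneq (r k 0 y) 0; first by rewrite H1// !mul0r mulr0 subrr.
  have rp : 0 < r k 0 y by rewrite lt_neqAle eq_sym ry r0.
  have := @ln_le_subr1 _ (kap / r k 0 y) (divr_gt0 kap0 rp).
  rewrite ln_div ?posrE// => h.
  have := ci0 i k y; rewrite -subr_ge0 => c1.
  have : 0 <= ci i k y * (kap / r k 0 y - 1 - (ln kap - ln (r k 0 y))) by rewrite mulr_ge0// subr_ge0.
  rewrite mulrA [kap * _]mulrC; lra.
have Veta : ((V + ln v%:R)%:E < relent rho sigma)%E by rewrite EFinD.
have [eta eta0] := relent_reg sr ss a0 b0 Veta.
rewrite -/X => Heta.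
set HE := \sum_i a 0 i * ln (a 0 i) in Ent.
pose Lg := \sum_i \sum_j a 0 i * sqn (X i j) * ln (b 0 j + eta).
have {}Heta : V + ln v%:R < HE - Lg.
  apply: (lt_le_trans Heta); rewrite /HE /Lg -sumrB; apply: ler_sum => i _.
  under eq_bigr do rewrite mulrBr.
  by rewrite sumrB -mulr_suml -mulr_sumr unitary_row_sqn// mulr1.
(* [del] keeps the scores positive where r vanishes; over m^2 outcomes it costs less than the
   available slack. The scores t below are likelihood ratios r / c, regularised in numerator and
   denominator. *)
pose del := (HE - Lg - (V + ln v%:R)) / ((m * m)%:R + 1).
have mm0 : 0 < (m * m)%:R + 1 :> R by rewrite ltr_wpDl.
have del0 : 0 < del by rewrite divr_gt0// subr_gt0.
have delm : (m * m)%:R * del < HE - Lg - (V + ln v%:R).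
  rewrite /del mulrCA gtr_pMr ?subr_gt0// ltr_pdivrMr// mul1r; lra.
pose t (x : 'I_m * 'I_m) := (r x.1 0 x.2 + del) / (c x.1 + eta).
have ce k : 0 < c k + eta by rewrite ltr_wpDl.
have rd k y : 0 < r k 0 y + del by rewrite ltr_wpDl// r0.
exists M, t; split=> //; first by move=> x; rewrite divr_gt0.
have T1 : \sum_x t x * retr (sigma *m M x) <= 1 + (m * m)%:R * del.
  apply: (@le_trans _ _ (\sum_k \sum_y (r k 0 y + del))).
    rewrite (pair_bigA _ (fun k y => r k 0 y + del)) /=; apply: ler_sum => -[k y] _ /=.
    rewrite sMM retrZ -/(n k y) /t /=.
    have /andP[n0 n1] := n01 k y.
    rewrite mulrAC ler_pdivrMr// ler_pM2l//.
    have := c0 k; nra.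
  under eq_bigr do rewrite big_split /=.
  by rewrite big_split /= sumr lerD2l !sumr_const card_ord -mulrnA mulr_natl.
have T2 : HE - ln v%:R - Lg <= \sum_x ln (t x) * retr (rho *m M x).
  rewrite -(pair_bigA _ (fun k y => ln (t (k, y)) * retr (rho *m M (k, y)))) /=.
  have -> : Lg = \sum_k \sum_y r k 0 y * ln (c k + eta).
    by rewrite /Lg -(sumP (fun z => ln (z + eta))); apply: eq_bigr => k _; rewrite mulrC mulr_suml.
  apply: (@le_trans _ _ (\sum_k \sum_y r k 0 y * ln (r k 0 y) - \sum_k \sum_y r k 0 y * ln (c k + eta))).
    by rewrite lerD2r.
  rewrite -sumrB; apply: ler_sum => k _; rewrite -sumrB; apply: ler_sum => y _.
  rewrite rM /t /= ln_div ?posrE// -mulrBr [leRHS]mulrC.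
  have [->|ry] := eqVneq (r k 0 y) 0; first by rewrite !mul0r.
  have rp : 0 < r k 0 y by rewrite lt_neqAle eq_sym ry r0.
  rewrite ler_pM2l// lerB// ler_ln ?posrE//; lra.
lra.
Qed.

End Pinching.

(** * Operator monotonicity of the logarithm *)

Section OpMonotone.
Variable R : realType.
Local Notation C := (R[i]).

Lemma psd_qf0 m (A : 'M[C]_m) x : psd A -> qf A x = 0 -> A *m x = 0.
Proof.
move=> /psd_factor[G ->] h.
have : \sum_i sqn ((G *m x) i 0) = 0 by rewrite -qf1 -qf_conj mulmx1.
move=> /eqP; rewrite psumr_eq0; last by move=> i _; exact: sqn_ge0.
move=> /allP H; rewrite -mulmxA; suff -> : G *m x = 0 by rewrite mulmx0.
apply/matrixP => i j; rewrite ord1 [RHS]mxE; apply/sqn_eq0/eqP/H.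
by rewrite mem_index_enum.
Qed.

Lemma spec_mxfun m (f : R -> R) (A : 'M[C]_m) U l :
  spec_decomp A (U, l) -> spec_decomp (mxfun f A) (U, map_mx f l).
Proof. by move=> sd; split; [case: sd|rewrite (mxfunE f sd)]. Qed.

Lemma psd_spec m (A : 'M[C]_m) U l : spec_decomp A (U, l) -> (forall i, 0 <= l 0 i) -> psd A.
Proof. by move=> [/= _ ->] l0; rewrite -{1}[U]adjmxK; apply: psd_conj; exact: psd_rdiag. Qed.

Lemma psd_mxfun m (f : R -> R) (A : 'M[C]_m) :
  (forall x, 0 <= f x) -> herm A -> psd (mxfun f A).
Proof.
move=> f0 /herm_spectral[[U l] sd]; apply: (psd_spec (spec_mxfun f sd)) => i.
by rewrite mxE.
Qed.

Lemma mxfun_comp m (f g : R -> R) (A : 'M[C]_m) :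
  herm A -> mxfun (f \o g) A = mxfun f (mxfun g A).
Proof.
move=> /herm_spectral[[U l] sd]; rewrite (mxfunE _ sd) (mxfunE _ (spec_mxfun g sd)).
by congr (_ *m rdiag _ *m _); apply/rowP => i; rewrite !mxE.
Qed.

Lemma mxfun_sqrt_sqr m (A : 'M[C]_m) : psd A -> mxfun Num.sqrt A *m mxfun Num.sqrt A = A.
Proof.
move=> pA; have [[U l] sd] := herm_spectral (psd_herm pA).
have l0 := spec_psd sd pA; rewrite (mxfunE _ sd).
have [/= uU AE] := sd; rewrite [RHS]AE !mulmxA -(mulmxA _ _ U) (unitary_adj uU) mulmx1.
rewrite -(mulmxA U) rdiagM; congr (_ *m rdiag _ *m _).
by apply/rowP => i; rewrite !mxE -expr2 sqr_sqrtr.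
Qed.

(* An eigenvector v of sqrt X - sqrt Y with eigenvalue h satisfies <v,(X - Y)v> = h <v,(sqrt X + sqrt Y)v>. *)
Lemma sqrt_op_monotone m (X Y : 'M[C]_m) : psd Y -> psd (X - Y) ->
  psd (mxfun Num.sqrt X - mxfun Num.sqrt Y).
Proof.
move=> pY pXY.
have pX : psd X by rewrite -(subrK Y X); exact: psdD.
have pA : psd (mxfun Num.sqrt X) by apply: psd_mxfun (psd_herm pX); exact: sqrtr_ge0.
have pB : psd (mxfun Num.sqrt Y) by apply: psd_mxfun (psd_herm pY); exact: sqrtr_ge0.
rewrite -{1}(mxfun_sqrt_sqr pX) -{1}(mxfun_sqrt_sqr pY) in pXY.
move: (mxfun _ X) (mxfun _ Y) pA pB pXY => A B pA pB pAB.
have hH : herm (A - B) by rewrite /herm adjmxB !psd_herm.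
have [[V h] sd] := herm_spectral hH.
apply: (psd_spec sd) => i.
have [/= uV HE] := sd; rewrite -/(rdiag h) in HE.
pose v := col i V.
have Hv : (A - B) *m v = ((h 0 i)%:C)%C *: v.
  rewrite HE /v colE -!mulmxA (mulmxA (adjmx V)) unitary_adj// mul1mx scalemxAr; congr (_ *m _).
  apply/matrixP => k j; rewrite mul_diag_mx !mxE ord1 eqxx andbT.
  by case: eqP => [->|_]; rewrite // !mulr0.
have v1 : qf 1%:M v = 1.
  by rewrite qf1 -(unitary_col_sqn i uV); apply: eq_bigr => j _; rewrite mxE.
have qH : qf (A - B) v = h 0 i.
  by rewrite /qf -mulmxA Hv -scalemxAr mxE ReZ -[RHS]mulr1 -v1 /qf mulmx1.
have key : qf (A *m A - B *m B) v = h 0 i * (qf A v + qf B v).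
  have -> : A *m A - B *m B = A *m (A - B) + (A - B) *m B.
    by rewrite mulmxBr mulmxBl addrA subrK.
  rewrite qfD mulrDr; congr (_ + _).
    by rewrite /qf -mulmxA -mulmxA Hv -!scalemxAr mxE ReZ mulmxA.
  have aH : adjmx v *m (A - B) = ((h 0 i)%:C)%C *: adjmx v.
    by rewrite -adjmxZ -Hv adjmxM hH.
  by rewrite /qf (mulmxA (adjmx v)) aH -!scalemxAl mxE ReZ.
rewrite leNgt; apply/negP => hn.
have := psd_qf v pAB; rewrite key nmulr_rge0// => hs.
have := psd_qf v pA; have := psd_qf v pB => qB qA.
move: qH; rewrite qfB; move: (qf A v) (qf B v) (h 0 i) hn hs qA qB => x y z; clear; lra.
Qed.

(** x^(1/2^k): with dyadic roots, operator monotonicity reduces to that of the square root. *)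
Definition itersqrt k (x : R) := iter k Num.sqrt x.

Lemma itersqrt_ge0 k x : 0 <= x -> 0 <= itersqrt k x.
Proof. by case: k => //= k _; exact: sqrtr_ge0. Qed.
Lemma itersqrt_gt0 k x : 0 < x -> 0 < itersqrt k x.
Proof. by elim: k => //= k IH x0; rewrite sqrtr_gt0 IH. Qed.
Lemma ln_itersqrt k x : 0 < x -> ln x = 2 ^+ k * ln (itersqrt k x).
Proof.
move=> x0; elim: k => [|k IH]; first by rewrite mul1r.
rewrite IH exprSr -mulrA; congr (_ * _).
have h := itersqrt_gt0 k x0; rewrite -[in LHS](sqr_sqrtr (ltW h)) /= lnXn ?sqrtr_gt0//.
by rewrite mulr_natl.
Qed.
Lemma itersqrt_le k x : 0 <= x -> itersqrt k x <= Num.max 1 x.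
Proof.
move=> x0; elim: k => [|k IH]; first by rewrite le_max lexx orbT.
rewrite /=; apply: le_trans (_ : Num.sqrt ((Num.max 1 x)^+2) <= _).
  rewrite ler_sqrt; last by rewrite sqr_ge0.
  apply: (le_trans IH); rewrite expr2 ler_peMr// ?le_max ?lexx// ?ler01//.
by rewrite sqrtr_sqr ger0_norm// le_max ler01.
Qed.
Lemma ln_le_itersqrt k x : 0 < x -> ln x <= 2 ^+ k * (itersqrt k x - 1).
Proof.
move=> x0; rewrite (ln_itersqrt k x0) ler_pM2l ?exprn_gt0//.
by apply: ln_le_subr1; exact: itersqrt_gt0.
Qed.
(** With y = x^(1/2^k), y - 1 <= y ln y gives y - 1 - ln y <= (y - 1) ln y <= max(1, x) (ln y)^2,
    and ln y = ln x / 2^k. The explicit rate lets finitely many eigenvalues be handled together. *)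
Lemma itersqrt_le_ln k x : 0 < x ->
  2 ^+ k * (itersqrt k x - 1) <= ln x + Num.max 1 x * (ln x) ^+ 2 / 2 ^+ k.
Proof.
move=> x0.
have y0 := itersqrt_gt0 k x0; have yM := itersqrt_le k (ltW x0).
have lE := ln_itersqrt k x0.
set y := itersqrt k x in y0 yM lE *; set p : R := 2 ^+ k in lE *.
have p0 : 0 < p by rewrite exprn_gt0.
have h1 : y - 1 <= y * ln y.
  have := @ln_le_subr1 _ (y^-1); rewrite invr_gt0 => /(_ y0); rewrite lnV ?posrE// => h.
  have : y * - ln y <= y * (y^-1 - 1) by rewrite ler_pM2l.
  rewrite mulrBr divff ?gt_eqF// mulr1; lra.
set M := Num.max 1 x in yM *.
have M1 : 1 <= M by rewrite le_max lexx.
have l2 : 0 <= ln y ^+ 2 by exact: sqr_ge0.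
have h1' : (y - 1) * ln y <= M * (ln y) ^+ 2.
  have [l0|l0] := leP 0 (ln y).
    by have := ler_wpM2r l0 h1; have := ler_wpM2r l2 yM; rewrite expr2; lra.
  have h2 : ln y <= y - 1 by exact: ln_le_subr1.
  have := ler_wnM2r (ltW l0) h2; have := ler_wpM2r l2 M1; rewrite expr2; lra.
have -> : M * ln x ^+ 2 / p = p * (M * (ln y) ^+ 2) by rewrite lE; field; rewrite gt_eqF.
rewrite lE -mulrDr ler_pM2l//; lra.
Qed.

Lemma itersqrt_op_monotone m (X Y : 'M[C]_m) k : psd Y -> psd (X - Y) ->
  psd (mxfun (itersqrt k) X - mxfun (itersqrt k) Y).
Proof.
move=> pY pXY.
have pX : psd X by rewrite -(subrK Y X); exact: psdD.
have pk Z l : psd Z -> psd (mxfun (itersqrt l) Z).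
  move=> pZ; have [[U z] sd] := herm_spectral (psd_herm pZ).
  by apply: (psd_spec (spec_mxfun _ sd)) => i; rewrite mxE itersqrt_ge0// (spec_psd sd).
elim: k => [|k IH].
  have i0 Z : psd Z -> mxfun (itersqrt 0) Z = Z.
    move=> pZ; have [[U z] sd] := herm_spectral (psd_herm pZ).
    rewrite (mxfunE _ sd); have [/= _ ->] := sd; congr (_ *m rdiag _ *m _).
    by apply/rowP => i; rewrite mxE.
  by rewrite !i0.
have E Z : psd Z -> mxfun (itersqrt k.+1) Z = mxfun Num.sqrt (mxfun (itersqrt k) Z).
  by move=> pZ; rewrite -mxfun_comp//; exact: psd_herm.
by rewrite (E _ X pX) (E _ Y pY); apply: sqrt_op_monotone IH; exact: pk.
Qed.

(* ln is the decreasing limit of 2^k (x^(1/2^k) - 1), so operator monotonicity of the square root passes to ln. *)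
Lemma relent_op_antitone m (rho sigma tau : 'M[C]_m) (c : R) :
  density rho -> psd sigma -> 0 < c -> psd (tau - (c%:C)%C *: sigma) ->
  (relent rho tau <= relent rho sigma - (ln c)%:E)%E.
Proof.
move=> dr ps c0 pts.
have pt : psd tau by rewrite -(subrK ((c%:C)%C *: sigma) tau); exact: psdD pts (psdZ (ltW c0) ps).
have pr := dr.1.
have [[U a] sr] := herm_spectral (psd_herm pr).
have [[W b] ss] := herm_spectral (psd_herm ps).
have [[Z t] st] := herm_spectral (psd_herm pt).
have a0 := spec_psd sr pr; have b0 := spec_psd ss ps; have t0 := spec_psd st pt.
have [/= uU rE] := sr; have [/= uW sE] := ss; have [/= uZ tE] := st.
rewrite -/(rdiag _) in rE; rewrite -/(rdiag _) in sE; rewrite -/(rdiag _) in tE.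
have kts (x : 'cV[C]_m) : tau *m x = 0 -> sigma *m x = 0.
  move=> tx; apply: psd_qf0 => //; apply/eqP; rewrite eq_le psd_qf// andbT.
  have := psd_qf x pts; rewrite qfB qfZ /qf -mulmxA tx mulmx0 mxE sub0r oppr_ge0.
  by rewrite pmulr_rle0.
have [H|H] := pselect (forall x : 'cV[C]_m, sigma *m x = 0 -> rho *m x = 0); last first.
  by rewrite [relent rho sigma]/relent asboolF// leey.
have Ht : forall x : 'cV[C]_m, tau *m x = 0 -> rho *m x = 0 by move=> x /kts/H.
pose P i j := a 0 i * sqn ((adjmx U *m W) i j).
pose Q i j := a 0 i * sqn ((adjmx U *m Z) i j).
have HP : forall i j, b 0 j = 0 -> P i j = 0.
  have := relentE sr ss a0 b0; rewrite /relent asboolT//=; case: ifP => [/asboolP//|_ //].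
have HQ : forall i j, t 0 j = 0 -> Q i j = 0.
  have := relentE sr st a0 t0; rewrite /relent asboolT//=; case: ifP => [/asboolP//|_ //].
rewrite (relentE sr ss a0 b0) (relentE sr st a0 t0) /= !asboolT//.
rewrite -EFinB lee_fin.
have P0 i j : 0 <= P i j by rewrite mulr_ge0// sqn_ge0.
have Q0 i j : 0 <= Q i j by rewrite mulr_ge0// sqn_ge0.
have sa : \sum_i a 0 i = 1 by rewrite -(retr_spec sr) density_retr.
have sP i : \sum_j P i j = a 0 i.
  by rewrite -mulr_sumr unitary_row_sqn ?mulr1//; apply: unitaryM => //; exact: unitary_adjK.
have sQ i : \sum_j Q i j = a 0 i.
  by rewrite -mulr_sumr unitary_row_sqn ?mulr1//; apply: unitaryM => //; exact: unitary_adjK.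
have -> : \sum_i \sum_j a 0 i * sqn ((adjmx U *m Z) i j) * (ln (a 0 i) - ln (t 0 j)) =
   \sum_i a 0 i * ln (a 0 i) - \sum_i \sum_j Q i j * ln (t 0 j).
  rewrite -sumrB; apply: eq_bigr => i _; under eq_bigr do rewrite mulrBr -/(Q i _).
  by rewrite sumrB -mulr_suml sQ.
have -> : \sum_i \sum_j a 0 i * sqn ((adjmx U *m W) i j) * (ln (a 0 i) - ln (b 0 j)) - ln c =
   \sum_i a 0 i * ln (a 0 i) - \sum_i \sum_j P i j * ln (c * b 0 j).
  have -> : ln c = \sum_i \sum_j P i j * ln c.
    by under eq_bigr do rewrite -mulr_suml sP; rewrite -mulr_suml sa mul1r.
  have -> : \sum_i a 0 i * ln (a 0 i) = \sum_i \sum_j P i j * ln (a 0 i).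
    by apply: eq_bigr => i _; rewrite -mulr_suml sP.
  rewrite -!sumrB; apply: eq_bigr => i _; rewrite -!sumrB; apply: eq_bigr => j _; rewrite -/(P i j).
  have [/HP|bn] := eqVneq (b 0 j) 0; first by move=> /(_ i) ->; rewrite !mul0r !subr0.
  have bp : 0 < b 0 j by rewrite lt_neqAle eq_sym bn b0.
  by rewrite lnM ?posrE//; ring.
rewrite lerD2l lerN2.
have FX V (l : 'rV[R]_m) k : unitary V -> retr (rho *m (V *m rdiag (map_mx (itersqrt k) l) *m adjmx V)) =
   \sum_i \sum_j a 0 i * sqn ((adjmx U *m V) i j) * itersqrt k (l 0 j).
  move=> uV; rewrite rE retr_spec_mul; apply: eq_bigr => i _; apply: eq_bigr => j _.
  by rewrite mxE; ring.
have cs : spec_decomp ((c%:C)%C *: sigma) (W, c *: b).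
  split=> //=; rewrite sE scalemxAl scalemxAr; congr (_ *m _ *m _).
  by apply/matrixP => i j; rewrite !mxE mulrnAr rmorphM.
have mono k : \sum_i \sum_j P i j * itersqrt k (c * b 0 j) <= \sum_i \sum_j Q i j * itersqrt k (t 0 j).
  have pk : psd (mxfun (itersqrt k) tau - mxfun (itersqrt k) ((c%:C)%C *: sigma)).
    exact: itersqrt_op_monotone (psdZ (ltW c0) ps) pts.
  have := psd_retr_mul pr pk; rewrite mulmxBr retrB subr_ge0.
  rewrite (mxfunE _ st) (mxfunE _ cs) !FX// => h; apply: le_trans h.
  by apply: ler_sum => i _; apply: ler_sum => j _; rewrite -/(P i j) [(c *: b) 0 j]mxE.
pose K := \sum_i \sum_j Q i j * (Num.max 1 (t 0 j) * (ln (t 0 j)) ^+ 2).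
have K0 : 0 <= K.
  by apply: sumr_ge0 => i _; apply: sumr_ge0 => j _; rewrite mulr_ge0// mulr_ge0 ?sqr_ge0// le_max ler01.
(* On positive eigenvalues ln lies below 2^k (x^(1/2^k) - 1), which is used for c sigma, and above
   it up to an error that sums to K / 2^k, which is used for tau. P and Q have the same marginal a,
   so the constant -1 contributes equally to both sides. *)
have main k : \sum_i \sum_j P i j * ln (c * b 0 j) <= \sum_i \sum_j Q i j * ln (t 0 j) + K / 2 ^+ k.
  have p0 : 0 < (2 : R) ^+ k by rewrite exprn_gt0.
  apply: (@le_trans _ _ (\sum_i \sum_j P i j * (2 ^+ k * (itersqrt k (c * b 0 j) - 1)))).
    apply: ler_sum => i _; apply: ler_sum => j _.
    have [/HP|bn] := eqVneq (b 0 j) 0; first by move=> /(_ i) ->; rewrite !mul0r.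
    have bp : 0 < b 0 j by rewrite lt_neqAle eq_sym bn b0.
    by rewrite ler_wpM2l//; apply: ln_le_itersqrt; rewrite mulr_gt0.
  have split_ F (G : 'I_m -> R) : (forall i, \sum_j F i j = a 0 i) ->
     \sum_i \sum_j F i j * (2 ^+ k * (G j - 1)) = 2 ^+ k * (\sum_i \sum_j F i j * G j - 1).
    move=> sF; rewrite -[X in _ - X]sa -sumrB mulr_sumr; apply: eq_bigr => i _.
    by rewrite -sF -sumrB mulr_sumr; apply: eq_bigr => j _; ring.
  rewrite split_//.
  apply: (@le_trans _ _ (\sum_i \sum_j Q i j * (2 ^+ k * (itersqrt k (t 0 j) - 1)))).
    by rewrite split_// ler_pM2l// lerD2r.
  rewrite /K mulr_suml -big_split /=; apply: ler_sum => i _.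
  rewrite mulr_suml -big_split /=; apply: ler_sum => j _.
  have [/HQ|tn] := eqVneq (t 0 j) 0; first by move=> /(_ i) ->; rewrite !mul0r addr0.
  have tp : 0 < t 0 j by rewrite lt_neqAle eq_sym tn t0.
  by rewrite -mulrA -mulrDr ler_wpM2l//; apply: itersqrt_le_ln.
apply/ler_addgt0Pr => e e0.
pose k := Num.bound (K / e).
apply: (le_trans (main k)); rewrite lerD2l ler_pdivrMr ?exprn_gt0// mulrC -ler_pdivrMr//.
apply: (@le_trans _ _ k%:R); first by apply/ltW/archi_boundP; rewrite divr_ge0// ltW.
by rewrite -natrX ler_nat ltnW// ltn_expl.
Qed.

Lemma relent_self m (rho : 'M[C]_m) : relent rho rho = 0%E.
Proof. by rewrite /relent asboolT// subrr mulmx0 retr0. Qed.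

End OpMonotone.

(** * Entropy of finite mixtures *)

Section MixtureEntropy.
Variable R : realType.
Local Notation C := (R[i]).

Lemma shannon_le_ln k (w : 'I_k -> R) : (forall j, 0 <= w j) -> \sum_j w j = 1 ->
  - \sum_j w j * ln (w j) <= ln k%:R.
Proof.
move=> w0 w1.
have k0 : (0 < k)%N by case: k w w0 w1 => // w _; rewrite big_ord0 => /esym/eqP; rewrite oner_eq0.
have kR : 0 < k%:R :> R by rewrite ltr0n.
have : - \sum_j w j * ln (w j) - ln k%:R <= \sum_(j < k) (k%:R^-1 - w j).
  have lnk : ln k%:R = \sum_j w j * ln k%:R :> R by rewrite -mulr_suml w1 mul1r.
  rewrite {1}lnk -opprD -big_split /= -sumrN; apply: ler_sum => j _.
  have [->|wn] := eqVneq (w j) 0; first by rewrite !mul0r addr0 oppr0 addr0 invr_ge0 ler0n.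
  have wp : 0 < w j by rewrite lt_neqAle eq_sym wn w0.
  have := @ln_le_subr1 _ ((k%:R * w j)^-1); rewrite invr_gt0 mulr_gt0// => /(_ isT).
  rewrite lnV ?posrE ?mulr_gt0// lnM ?posrE// => h.
  have : w j * - (ln k%:R + ln (w j)) <= w j * ((k%:R * w j)^-1 - 1) by rewrite ler_pM2l.
  have -> : w j * ((k%:R * w j)^-1 - 1) = k%:R^-1 - w j by field; rewrite wn gt_eqF.
  lra.
rewrite sumrB w1 sumr_const card_ord -[_^-1 *+ _]mulr_natl divff ?gt_eqF//; lra.
Qed.

(** From X >= w_j rho_j follows D(rho_j || X) <= - ln w_j. Hence the average of D(rho_j || sigma)
    exceeds D(X || sigma) by at most the Shannon entropy of w, so by at most ln k, and some
    component is no worse than the average. *)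
Lemma relent_mix_component m k (w : 'I_k -> R) (rho : 'I_k -> 'M[C]_m) (sigma : 'M[C]_m) :
  (forall j, 0 <= w j) -> \sum_j w j = 1 -> (forall j, density (rho j)) -> psd sigma ->
  exists j, (relent (rho j) sigma <= relent (\sum_j ((w j)%:C)%C *: rho j) sigma + (ln k%:R)%:E)%E.
Proof.
move=> w0 w1 dr ps; set X := \sum_j _.
have k0 : (0 < k)%N by case: k w rho w0 w1 @X dr => // w rho _; rewrite big_ord0 => /esym/eqP; rewrite oner_eq0.
have pX : psd X by apply: psd_sum => j _; exact: psdZ (w0 j) (dr j).1.
have [HX|HX] := pselect (forall x : 'cV[C]_m, sigma *m x = 0 -> X *m x = 0); last first.
  by exists (Ordinal k0); rewrite [relent X sigma]/relent asboolF// addye// leey.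
apply: contrapT => Hn.
have {}Hn j : (relent X sigma + (ln k%:R)%:E < relent (rho j) sigma)%E.
  by rewrite ltNge; apply/negP => h; apply: Hn; exists j.
have pXj j : psd (X - ((w j)%:C)%C *: rho j).
  rewrite /X (bigD1 j)//= addrAC subrr add0r; apply: psd_sum => i _; exact: psdZ (w0 i) (dr i).1.
have kj j (x : 'cV[C]_m) : 0 < w j -> X *m x = 0 -> rho j *m x = 0.
  move=> wj Xx; apply: psd_qf0; first exact: (dr j).1.
  apply/eqP; rewrite eq_le (psd_qf _ (dr j).1) andbT.
  by have := psd_qf x (pXj j); rewrite qfB qfZ /qf -mulmxA Xx mulmx0 mxE sub0r oppr_ge0 pmulr_rle0.
pose e j := retr (rho j *m logmx (rho j)).
have E1 j : 0 < w j -> relent (rho j) sigma = (e j - retr (rho j *m logmx sigma))%:E.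
  by move=> wj; rewrite /relent asboolT ?mulmxBr ?retrB// => x /HX; exact: kj.
have E2 j : 0 < w j -> e j - retr (rho j *m logmx X) <= - ln (w j).
  move=> wj; have := relent_op_antitone (dr j) (dr j).1 wj (pXj j).
  rewrite relent_self add0e /relent asboolT ?mulmxBr ?retrB// => x; exact: kj.
have EX : relent X sigma = (retr (X *m logmx X) - retr (X *m logmx sigma))%:E.
  by rewrite /relent asboolT ?mulmxBr ?retrB.
have lin L : retr (X *m L) = \sum_j w j * retr (rho j *m L).
  rewrite /X mulmx_suml retr_sum; apply: eq_bigr => j _.
  by rewrite -scalemxAl retrZ.
have := shannon_le_ln w0 w1.
set r := retr (X *m logmx X) - retr (X *m logmx sigma) in EX.
have rE : r = \sum_j w j * (retr (rho j *m logmx X) - retr (rho j *m logmx sigma)).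
  rewrite /r (lin (logmx X)) (lin (logmx sigma)) -sumrB; apply: eq_bigr => j _; exact: esym (mulrBr _ _ _).
suff : r + ln k%:R < r - \sum_j w j * ln (w j) by lra.
have [j0 wj0] : exists j, 0 < w j.
  apply: contrapT => h; have : \sum_j w j = 0.
    apply: big1 => j _; apply/eqP; rewrite eq_le w0 andbT leNgt; apply/negP => wj; apply: h; by exists j.
  by rewrite w1 => /eqP; rewrite oner_eq0.
have key j : 0 < w j -> w j * (r + ln k%:R) < w j * (retr (rho j *m logmx X) - retr (rho j *m logmx sigma) - ln (w j)).
  move=> wj; rewrite ltr_pM2l//.
  have := Hn j; rewrite EX (E1 j wj) -EFinD lte_fin => h1; have := E2 j wj => h2.
  apply: (lt_le_trans h1); rewrite addrAC lerD2r -lerBlDl; exact: h2.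
have sE : r + ln k%:R = \sum_j w j * (r + ln k%:R) by rewrite -mulr_suml w1 mul1r.
rewrite {1}sE [X in _ < X - _]rE -sumrB.
apply: (@lt_le_trans _ _ (\sum_j w j * (retr (rho j *m logmx X) - retr (rho j *m logmx sigma) - ln (w j)))); last first.
  by apply: ler_sum => j _; rewrite mulrBr.
rewrite (bigD1 j0)//= [ltRHS](bigD1 j0)//=; apply: ltr_leD; first exact: key.
apply: ler_sum => j _; have := w0 j; rewrite le_eqVlt => /orP[/eqP <-|wj]; first by rewrite !mul0r.
exact/ltW/key.
Qed.

End MixtureEntropy.

(** * Tensor powers *)

Section Digits.
Variable d : nat.

(** Base-d digits of an index, following the recursion of [ptens_rec]; it starts at one factor
    because ['I_(d ^ 1)] is ['I_d] by conversion. On digits, cutting into blocks and permuting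
    factors are reindexings. *)
Fixpoint dig_rec n : 'I_(d ^ n.+1) -> 'I_n.+1 -> 'I_d :=
  if n is n'.+1 then fun i k =>
    let u := mxtens_unindex (i : 'I_(d * d ^ n'.+1)) in
    if unlift ord0 k is Some k' then dig_rec u.2 k' else u.1
  else fun i _ => i.

Definition dig n : 'I_(d ^ n) -> {ffun 'I_n -> 'I_d} :=
  match n return 'I_(d ^ n) -> {ffun 'I_n -> 'I_d} with
  | 0 => fun _ => [ffun k : 'I_0 => match k with Ordinal _ h => False_rect _ (notF h) end]
  | n'.+1 => fun i => [ffun k => dig_rec i k] end.

Lemma dig_rec0 n (i : 'I_(d ^ n.+2)) :
  dig_rec i ord0 = (mxtens_unindex (i : 'I_(d * d ^ n.+1))).1.
Proof. by rewrite /= unlift_none. Qed.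

Lemma dig_recS n (i : 'I_(d ^ n.+2)) k :
  dig_rec i (lift ord0 k) = dig_rec (mxtens_unindex (i : 'I_(d * d ^ n.+1))).2 k.
Proof. by rewrite /= liftK. Qed.

Lemma dig_rec_inj n : injective (@dig_rec n).
Proof.
elim: n => [|n IH] i j /= h; first by have := congr1 (fun f => f ord0) h.
rewrite -(@mxtens_unindexK d (d ^ n.+1) i) -(@mxtens_unindexK d (d ^ n.+1) j); congr mxtens_index.
have h1 : (@mxtens_unindex d (d ^ n.+1) i).1 = (@mxtens_unindex d (d ^ n.+1) j).1.
  by have := congr1 (fun f => f ord0) h; rewrite unlift_none.
have h2 : (@mxtens_unindex d (d ^ n.+1) i).2 = (@mxtens_unindex d (d ^ n.+1) j).2.
  by apply: IH; apply/funext => k; have := congr1 (fun f => f (lift ord0 k)) h; rewrite liftK.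
by rewrite [LHS]surjective_pairing [RHS]surjective_pairing h1 h2.
Qed.

Lemma dig_inj n : injective (@dig n).
Proof.
case: n => [|n] i j h; first by apply: val_inj; case: i j {h} => [[|i] hi] [[|j] hj].
apply: dig_rec_inj; apply/funext => k.
by have := congr1 (fun f : {ffun _ -> _} => f k) h; rewrite !ffunE.
Qed.

Lemma dig_bij n : bijective (@dig n).
Proof.
by apply: (inj_card_bij (@dig_inj n)); rewrite card_ffun !card_ord.
Qed.

Lemma undig_ex n (s : {ffun 'I_n -> 'I_d}) : exists i, dig i == s.
Proof. by have [g _ K] := @dig_bij n; exists (g s); rewrite K. Qed.
Definition undig n s : 'I_(d ^ n) := xchoose (@undig_ex n s).
Lemma undigK n : cancel (@undig n) (@dig n).
Proof. by move=> s; apply/eqP; exact: (xchooseP (undig_ex s)). Qed.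
Lemma digK n : cancel (@dig n) (@undig n).
Proof. by move=> i; apply: dig_inj; rewrite undigK. Qed.

Lemma ptensE (R : realType) (f : nat -> 'M[R[i]]_d) n (i j : 'I_(d ^ n)) :
  ptens f n i j = \prod_(k < n) f k (dig i k) (dig j k).
Proof.
case: n i j => [|n] i j; first by rewrite big_ord0 /ptens !mxE !ord1.
under eq_bigr do rewrite !ffunE.
rewrite /ptens; elim: n f i j => [|n IH] f i j; first by rewrite big_ord1.
rewrite big_ord_recl !dig_rec0 [LHS]mxE IH; congr (_ * _).
by apply: eq_bigr => k _; rewrite !dig_recS.
Qed.

Lemma ntensE (R : realType) (rho : 'M[R[i]]_d) n : ntensmx rho n = ptens (fun=> rho) n.
Proof. by case: n => // n; rewrite /ntensmx /ptens; elim: n => //= n ->. Qed.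

End Digits.

Section TensorBij.
Variables (R : realType) (N a b : nat) (l : 'I_N -> 'I_a) (r : 'I_N -> 'I_b).
Hypothesis lr_bij : bijective (fun i => (l i, r i)).
Local Notation C := (R[i]).

(** Kronecker product along any bijection of ['I_N] with ['I_a * 'I_b], so that no casts between
    [d ^ (m + n)] and [d ^ m * d ^ n] arise. *)
Definition tensb (A : 'M[C]_a) (B : 'M[C]_b) : 'M[C]_N :=
  \matrix_(i, j) (A (l i) (l j) * B (r i) (r j)).

Lemma sum_tensb (F : 'I_a -> 'I_b -> C) : \sum_i F (l i) (r i) = \sum_p \sum_q F p q.
Proof.
rewrite (pair_bigA _ F) /=.
have [g gK Kg] := lr_bij.
by rewrite [RHS](reindex (fun i => (l i, r i)))//=; exists g => x _; [exact: gK|exact: Kg].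
Qed.

Lemma tensbM A B A' B' : tensb A B *m tensb A' B' = tensb (A *m A') (B *m B').
Proof.
apply/matrixP => i j; rewrite !mxE.
under eq_bigr do rewrite !mxE.
rewrite (sum_tensb (fun p q => A (l i) p * B (r i) q * (A' p (l j) * B' q (r j)))).
rewrite mulr_suml; apply: eq_bigr => p _; rewrite mulr_sumr; apply: eq_bigr => q _; ring.
Qed.

Lemma tr_tensb A B : \tr (tensb A B) = \tr A * \tr B.
Proof.
rewrite /mxtrace; under eq_bigr do rewrite mxE.
by rewrite (sum_tensb (fun p q => A p p * B q q)) mulr_suml; apply: eq_bigr => p _; rewrite mulr_sumr.
Qed.

Lemma adjmx_tensb A B : adjmx (tensb A B) = tensb (adjmx A) (adjmx B).
Proof. by apply/matrixP => i j; rewrite adjmxE !mxE rmorphM. Qed.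

Lemma tensb1 : tensb 1%:M 1%:M = 1%:M.
Proof.
apply/matrixP => i j; rewrite !mxE -natrM mulnb; congr ((nat_of_bool _)%:R).
have [g gK _] := lr_bij; apply/idP/idP => [/andP[/eqP h1 /eqP h2]|/eqP -> ]; last by rewrite !eqxx.
by apply/eqP; apply: (can_inj gK); rewrite h1 h2.
Qed.

Lemma tensbBl A A' B : tensb (A - A') B = tensb A B - tensb A' B.
Proof. by apply/matrixP => i j; rewrite !mxE mulrBl. Qed.
Lemma tensbBr A B B' : tensb A (B - B') = tensb A B - tensb A B'.
Proof. by apply/matrixP => i j; rewrite !mxE mulrBr. Qed.
Lemma tensb_suml I (s : seq I) (P : pred I) (F : I -> 'M[C]_a) B :
  tensb (\sum_(i <- s | P i) F i) B = \sum_(i <- s | P i) tensb (F i) B.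
Proof.
apply/matrixP => i j; rewrite !(mxE, summxE) mulr_suml.
by apply: eq_bigr => k _; rewrite mxE.
Qed.
Lemma tensbZl c A B : tensb (c *: A) B = c *: tensb A B.
Proof. by apply/matrixP => i j; rewrite !mxE mulrA. Qed.
Lemma tensbZr c A B : tensb A (c *: B) = c *: tensb A B.
Proof. by apply/matrixP => i j; rewrite !mxE mulrCA. Qed.

Lemma psd_tensb A B : psd A -> psd B -> psd (tensb A B).
Proof.
move=> /psd_factor[G ->] /psd_factor[H ->].
by rewrite -tensbM -adjmx_tensb; exact: psd_gram.
Qed.

Lemma tr_mul_herm m (A B : 'M[C]_m) : herm A -> herm B -> \tr (A *m B) = ((retr (A *m B))%:C)%C.
Proof.
move=> hA hB; rewrite /retr.
have : conjc (\tr (A *m B)) = \tr (A *m B).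
  rewrite -{2}hA -{2}hB -adjmxM mxtrace_mulC /mxtrace rmorph_sum /=; apply: eq_bigr => i _.
  by rewrite adjmxE.
by case: (\tr _) => x y /= [] h; rewrite (_ : y = 0)//; lra.
Qed.

(** Real parts are not multiplicative in general; here they are, because the trace of a product of
    two hermitian matrices is real. *)
Lemma retr_tensbM A B A' B' : herm A -> herm A' -> herm B -> herm B' ->
  retr (tensb A B *m tensb A' B') = retr (A *m A') * retr (B *m B').
Proof.
move=> hA hA' hB hB'; rewrite tensbM {1}/retr tr_tensb !tr_mul_herm//.
by rewrite -rmorphM.
Qed.

End TensorBij.

Section Blocks.
Variables (R : realType) (d : nat).
Local Notation C := (R[i]).
Implicit Type f g : nat -> 'M[C]_d.

Definition lidx m n (i : 'I_(d ^ (m + n))) : 'I_(d ^ m) := undig [ffun k => dig i (lshift n k)].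
Definition ridx m n (i : 'I_(d ^ (m + n))) : 'I_(d ^ n) := undig [ffun k => dig i (rshift m k)].

Lemma lridx_bij m n : bijective (fun i : 'I_(d ^ (m + n)) => (lidx i, ridx i)).
Proof.
apply: inj_card_bij; last by rewrite card_prod !card_ord expnD.
move=> i j [/(congr1 (@dig d m))]; rewrite !undigK => /ffunP hl.
move=> /(congr1 (@dig d n)); rewrite !undigK => /ffunP hr.
apply: dig_inj; apply/ffunP => k; rewrite -(splitK k).
by case: (fintype.split k) => p /=; [have := hl p|have := hr p]; rewrite !ffunE.
Qed.

Definition btens m n : 'M[C]_(d ^ m) -> 'M[C]_(d ^ n) -> 'M[C]_(d ^ (m + n)) :=
  tensb (@lidx m n) (@ridx m n).

Lemma ptens_split f m n : ptens f (m + n) = btens (ptens f m) (ptens (fun i => f (m + i)%N) n).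
Proof.
apply/matrixP => i j; rewrite mxE !ptensE big_split_ord /=.
by congr (_ * _); apply: eq_bigr => k _; rewrite !undigK !ffunE.
Qed.

Lemma ptensS f n : ptens f n.+1 = btens (m := 1) (f 0%N : 'M[C]_(d ^ 1)) (ptens (fun i => f i.+1) n).
Proof. exact: (ptens_split f 1 n). Qed.

Lemma eq_ptens f g n : (forall i, (i < n)%N -> f i = g i) -> ptens f n = ptens g n.
Proof. by move=> h; apply/matrixP => i j; rewrite !ptensE; apply: eq_bigr => k _; rewrite h. Qed.

Lemma psd_btens m n A B : psd A -> psd B -> psd (@btens m n A B).
Proof. by apply: psd_tensb; exact: lridx_bij. Qed.

Lemma psd_ptens f n : (forall i, psd (f i)) -> psd (ptens f n).
Proof.
elim: n f => [|n IH] f hf; first exact: psd1.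
by rewrite ptensS; exact: (@psd_btens 1 n _ _ (hf 0%N) (IH (fun i => f i.+1) (fun i => hf i.+1))).
Qed.

Lemma density_ptens f n : (forall i, density (f i)) -> density (ptens f n).
Proof.
move=> hf; split; first by apply: psd_ptens => i; exact: (hf i).1.
elim: n f hf => [|n IH] f hf; first by rewrite mxtrace1.
by rewrite ptensS /btens tr_tensb; [rewrite IH// mulr1 (hf 0%N).2|exact: lridx_bij].
Qed.

Lemma ptens_ler f g n : (forall i, psd (f i)) -> (forall i, psd (g i - f i)) ->
  psd (ptens g n - ptens f n).
Proof.
elim: n f g => [|n IH] f g hf hg; first by rewrite subrr; exact: psd0.
have pg i : psd (g i) by rewrite -(subrK (f i) (g i)); exact: psdD.
rewrite !ptensS.
have -> : btens (m:=1) (g 0%N) (ptens (fun i => g i.+1) n) - btens (m:=1) (f 0%N) (ptens (fun i => f i.+1) n) =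
  btens (m:=1) (g 0%N - f 0%N) (ptens (fun i => g i.+1) n) + btens (m:=1) (f 0%N) (ptens (fun i => g i.+1) n - ptens (fun i => f i.+1) n).
  by rewrite /btens tensbBl tensbBr addrA subrK.
apply: psdD.
  exact: (@psd_btens 1 n _ _ (hg 0%N) (psd_ptens n (fun i => pg i.+1))).
exact: (@psd_btens 1 n _ _ (hf 0%N) (IH (fun i => f i.+1) (fun i => g i.+1) (fun i => hf i.+1) (fun i => hg i.+1))).
Qed.

Lemma ptensM f g n : ptens f n *m ptens g n = ptens (fun i => f i *m g i) n.
Proof.
elim: n f g => [|n IH] f g; first by rewrite /ptens mulmx1.
by rewrite !ptensS /btens tensbM ?IH//; exact: lridx_bij.
Qed.

Lemma ptensZ (c : nat -> C) f n : ptens (fun i => c i *: f i) n = (\prod_(k < n) c k) *: ptens f n.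
Proof.
by apply/matrixP => i j; rewrite mxE !ptensE -big_split; apply: eq_bigr => k _; rewrite mxE.
Qed.

Lemma ptens_const1 n : ptens (fun=> 1%:M : 'M[C]_d) n = 1%:M.
Proof.
elim: n => [//|n IH]; rewrite ptensS IH /btens tensb1//; exact: lridx_bij.
Qed.

Lemma retr_btens m n A B A' B' : herm A -> herm A' -> herm B -> herm B' ->
  retr (@btens m n A B *m btens A' B') = retr (A *m A') * retr (B *m B').
Proof. by apply: retr_tensbM; exact: lridx_bij. Qed.

(** Joint type of a row and a column index: how many positions carry each pair of digits. An entry
    of a tensor power depends on nothing else. *)
Definition ptype n (i j : 'I_(d ^ n)) : {ffun 'I_d * 'I_d -> 'I_n.+1} :=
  [ffun pq => inord #|[pred k | (dig i k, dig j k) == pq]|].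

Lemma ptens_ptype (Y : 'M[C]_d) n (i j : 'I_(d ^ n)) :
  ptens (fun=> Y) n i j = \prod_pq Y pq.1 pq.2 ^+ ptype i j pq.
Proof.
rewrite ptensE (partition_big (fun k => (dig i k, dig j k)) xpredT)//=.
apply: eq_bigr => pq _; rewrite (eq_bigr (fun=> Y pq.1 pq.2)); last by move=> k /eqP <-.
rewrite prodr_const ffunE inordK//.
by rewrite ltnS (leq_trans (max_card _))// card_ord.
Qed.

(** Permutation invariance in the form used for spectra. This span is closed under products, so the
    entries of every power of such a matrix are functions of the joint type too. *)
Definition iidspan n (X : 'M[C]_(d ^ n)) :=
  exists l : seq (C * 'M[C]_d), X = \sum_(p <- l) p.1 *: ptens (fun=> p.2) n.

Lemma iidspanM n (X Y : 'M[C]_(d ^ n)) : iidspan X -> iidspan Y -> iidspan (X *m Y).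
Proof.
move=> [l ->] [l' ->].
exists [seq (p.1 * q.1, p.2 *m q.2) | p <- l, q <- l'].
rewrite big_allpairs_dep /= mulmx_suml; apply: eq_bigr => p _.
rewrite mulmx_sumr; apply: eq_bigr => q _.
by rewrite -scalemxAl -scalemxAr scalerA ptensM.
Qed.

Lemma iidspanX n (X : 'M[C]_(d ^ n)) k : iidspan X -> iidspan (X ^+ k).
Proof.
move=> hX; elim: k => [|k IH]; last by rewrite exprS; exact: iidspanM.
by exists [:: (1, 1%:M)]; rewrite big_seq1 /= scale1r ptens_const1 expr0.
Qed.

Lemma iidspan_type n (X : 'M[C]_(d ^ n)) : iidspan X ->
  exists F : {ffun 'I_d * 'I_d -> 'I_n.+1} -> C, forall i j, X i j = F (ptype i j).
Proof.
move=> [l ->]; exists (fun t : {ffun 'I_d * 'I_d -> 'I_n.+1} => \sum_(p <- l) p.1 * \prod_pq p.2 pq.1 pq.2 ^+ t pq) => i j.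
by rewrite summxE; apply: eq_bigr => p _; rewrite mxE ptens_ptype.
Qed.

Lemma spec_expr n (X : 'M[C]_n) U b k : spec_decomp X (U, b) ->
  X ^+ k = U *m rdiag (map_mx (fun x => x ^+ k) b) *m adjmx U.
Proof.
move=> [/= uU XE]; rewrite -/(rdiag b) in XE; elim: k => [|k IH].
  have -> : rdiag (map_mx (fun x => x ^+ 0) b) = 1%:M.
    by apply/matrixP => i j; rewrite !mxE expr0; case: eqP.
  by rewrite mulmx1 uU expr0.
rewrite exprS IH {1}XE -[LHS]/(_ *m _) !mulmxA -(mulmxA _ _ U) (unitary_adj uU) mulmx1.
rewrite -(mulmxA U) rdiagM; congr (_ *m rdiag _ *m _).
by apply/rowP => i; rewrite !mxE exprS.
Qed.

Definition ntypes n := (n.+1 ^ (d * d))%N.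

Lemma card_types n : #|{ffun 'I_d * 'I_d -> 'I_n.+1}| = ntypes n.
Proof. by rewrite card_ffun card_prod !card_ord. Qed.

(* The powers of X live in a space of dimension ntypes n, hence X is annihilated by a polynomial of that degree. *)
Lemma iidspan_eigenvalues n (X : 'M[C]_(d ^ n)) U (b : 'rV[R]_(d ^ n)) :
  iidspan X -> spec_decomp X (U, b) -> (size (undup [seq b 0%R j | j <- enum 'I_(d ^ n)]) <= ntypes n)%N.
Proof.
move=> hX sd; set s := undup _; set N := ntypes n.
have /choice[F hF] : forall k : 'I_N.+1, exists F : {ffun 'I_d * 'I_d -> 'I_n.+1} -> C, forall i j, (X ^+ k) i j = F (ptype i j).
  by move=> k; apply/iidspan_type/iidspanX.
pose A : 'M[C]_(N.+1, #|{ffun 'I_d * 'I_d -> 'I_n.+1}|) := \matrix_(k, t) F k (enum_val t).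
have /rowV0Pn[v vA v0] : kermx A != 0.
  rewrite -mxrank_eq0 mxrank_ker subn_eq0 -ltnNge.
  by rewrite (leq_ltn_trans (rank_leq_col A))// card_types.
have {}vA : v *m A = 0 by apply/sub_kermxP.
pose p : {poly C} := \sum_(k < N.+1) v 0 k *: 'X^k.
have pE : p = \poly_(k < N.+1) v 0 (inord k).
  by rewrite poly_def; apply: eq_bigr => k _; rewrite inord_val.
have p0 : p != 0.
  apply: contra v0 => /eqP p0; apply/eqP/rowP => k.
  by have := congr1 (fun q : {poly C} => q`_k) p0; rewrite pE coef_poly ltn_ord inord_val coef0 mxE.
have Xp : \sum_(k < N.+1) v 0 k *: X ^+ k = 0.
  apply/matrixP => i j; rewrite summxE [RHS]mxE.
  have := congr1 (fun M : 'rV_ _ => M 0 (enum_rank (ptype i j))) vA.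
  rewrite !mxE => h; rewrite -[RHS]h; apply: eq_bigr => k _.
  by rewrite [LHS]mxE hF [in RHS]mxE enum_rankK.
have [/= uU _] := sd.
have rt j : root p ((b 0 j)%:C)%C.
  have := congr1 (fun M => adjmx U *m M *m U) Xp.
  rewrite mulmx0 mul0mx mulmx_sumr mulmx_suml => /matrixP/(_ j j).
  rewrite summxE [RHS]mxE => h; rewrite /root /p horner_sum; apply/eqP; rewrite -[RHS]h.
  apply: eq_bigr => k _; rewrite hornerZ hornerXn (spec_expr k sd) -scalemxAr -scalemxAl.
  rewrite [RHS]mxE !mulmxA unitary_adj// mul1mx -mulmxA unitary_adj// mulmx1.
  by rewrite !mxE eqxx mulr1n rmorphXn.
have := @max_poly_roots _ p [seq (x%:C)%C | x <- s] p0; rewrite size_map => h.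
have : (size s < size p)%N.
  apply: h; last by rewrite map_inj_uniq ?undup_uniq//; exact: complexI.
  apply/allP => z /mapP[x]; rewrite mem_undup => /mapP[j _ ->] ->; exact: rt.
by move=> /leq_trans; move=> /(_ N.+1); rewrite ltnS; apply; rewrite pE size_poly.
Qed.

Lemma measured_relent_iid n (rho sigma : 'M[C]_(d ^ n)) (V : R) :
  density rho -> psd sigma -> retr sigma <= 1 -> iidspan sigma ->
  (V%:E + (ln (ntypes n)%:R)%:E < relent rho sigma)%E ->
  exists (M : 'I_(d ^ n) * 'I_(d ^ n) -> 'M[C]_(d ^ n)) (t : 'I_(d ^ n) * 'I_(d ^ n) -> R),
    [/\ forall x, psd (M x), \sum_x M x = 1%:M, forall x, 0 < t x &
     V < \sum_x ln (t x) * retr (rho *m M x) + 1 - \sum_x t x * retr (sigma *m M x)].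
Proof.
move=> dr ps ts hs HV.
have [[W b] ss] := herm_spectral (psd_herm ps).
have b0 := spec_psd ss ps.
pose s := undup [seq b 0%R j | j <- enum 'I_(d ^ n)].
have sN : (size s <= ntypes n)%N by apply: iidspan_eigenvalues hs ss.
have bs j : b 0 j \in s by rewrite mem_undup map_f// mem_enum.
have sD : (size s <= d ^ n)%N.
  by rewrite (leq_trans (size_undup _))// size_map size_enum_ord.
have hphi j : (index (b 0%R j) s < d ^ n)%N by rewrite (leq_trans _ sD)// index_mem.
(* Position of the eigenvalue in the list of distinct ones; past its end the default 0 of [nth] is
   still nonnegative. *)
pose phi j := Ordinal (hphi j).
apply: (@measured_relent R _ rho sigma V W b phi (fun k => nth 0 s k)) => //.
- by move=> j; rewrite /= nth_index.
- move=> k; have [ks|ks] := ltnP k (size s); last by rewrite nth_default.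
  by have := mem_nth 0 ks; rewrite mem_undup => /mapP[j _ ->].
apply: le_lt_trans HV; rewrite leeD2l// lee_fin.
set S := [set phi j | j : 'I_(d ^ n)]%SET.
have SN : (#|S| <= ntypes n)%N.
  apply: leq_trans sN; rewrite -(size_iota 0 (size s)).
  have -> : #|S| = size (enum S) by rewrite cardE.
  rewrite -(size_map (@nat_of_ord _)).
  apply: uniq_leq_size; first by rewrite map_inj_uniq ?enum_uniq//; exact: val_inj.
  by move=> k /mapP[x]; rewrite mem_enum => /imsetP[j _ ->] -> /=; rewrite mem_iota /= add0n index_mem.
have [S0|S0] := posnP #|S|; last by rewrite ler_ln ?posrE ?ltr0n ?ler_nat// (leq_trans S0).
by rewrite S0 ln0// ln_ge0// ler1n /ntypes expn_gt0.
Qed.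

End Blocks.

(** * Block tests *)

Section Achievability.
Variables (R : realType) (d : nat).
Local Notation C := (R[i]).
Implicit Type f : nat -> 'M[C]_d.

(** From e^y <= 1 / (1 - y) and (1 - y)(1 + y + 2 y^2) = 1 + y^2 (1 - 2 y) >= 1. It is the
    second-order bound of the Chernoff estimate. *)
Lemma expR_le_quadratic (y : R) : `|y| <= 2^-1 -> expR y <= 1 + y + 2 * y ^+ 2.
Proof.
rewrite ler_norml => /andP[y1 y2].
have h : 1 - y <= expR (- y) by rewrite expR_ge1Dx.
have y3 : 0 < 1 - y by lra.
rewrite -[expR y]invrK -expRN.
apply: (@le_trans _ _ (1 - y)^-1); first by rewrite lef_pV2 ?posrE// expR_gt0.
rewrite -[_^-1]mul1r ler_pdivrMr//.
have : 0 <= y ^+ 2 * (1 - 2 * y) by rewrite mulr_ge0 ?sqr_ge0//; lra.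
rewrite expr2; nra.
Qed.

Section Acc.
Variables (m r : nat) (X : finType) (M : X -> 'M[C]_(d ^ m)) (l : X -> R).
Hypothesis pM : forall x, psd (M x).
Hypothesis sM : \sum_x M x = 1%:M.

(* The test measuring q successive blocks with M and accepting when the accumulated score reaches c. *)
Fixpoint acctest q (c : R) : 'M[C]_(d ^ iter q (addn m) r) :=
  match q return 'M[C]_(d ^ iter q (addn m) r) with
  | 0 => if c <= 0 then 1%:M else 0
  | q'.+1 => \sum_x btens (M x) (acctest q' (c - l x))
  end.

Lemma psd_acctest q c : psd (acctest q c).
Proof.
elim: q c => [|q IH] c /=; first by case: ifP => _; [exact: psd1|exact: psd0].
by apply: psd_sum => x _; apply: psd_btens.
Qed.

Lemma acctest_compl q c : 1%:M - acctest q.+1 c = \sum_x btens (M x) (1%:M - acctest q (c - l x)).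
Proof.
rewrite /= [RHS](eq_bigr (fun x => btens (M x) 1%:M - btens (M x) (acctest q (c - l x)))); last first.
  by move=> x _; rewrite /btens tensbBr.
rewrite sumrB; congr (_ - _).
by rewrite /btens -tensb_suml sM tensb1//; exact: lridx_bij.
Qed.

Lemma psd_acctest_compl q c : psd (1%:M - acctest q c).
Proof.
elim: q c => [|q IH] c; last by rewrite acctest_compl; apply: psd_sum => x _; apply: psd_btens.
by rewrite /=; case: ifP => _; rewrite ?subrr ?subr0; [exact: psd0|exact: psd1].
Qed.

Lemma acctest_step f q (G : X -> 'M[C]_(d ^ iter q (addn m) r)) :
  (forall i, density (f i)) -> (forall x, psd (G x)) ->
  retr (ptens f (iter q.+1 (addn m) r) *m \sum_x btens (M x) (G x)) =
  \sum_x retr (ptens f m *m M x) * retr (ptens (fun i => f (m + i)%N) (iter q (addn m) r) *m G x).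
Proof.
move=> df pG; rewrite [iter q.+1 _ _]/= ptens_split mulmx_sumr retr_sum; apply: eq_bigr => x _.
by rewrite retr_btens//; apply: psd_herm => //; apply: (density_ptens _ _).1 => // i; exact: df.
Qed.

(** Markov's inequality: the mean of e^score never grows from block to block. The hypothesis is made
    at every offset, so the factors of f may vary. *)
Lemma acctest_typeII f q c : (forall i, density (f i)) ->
  (forall k, \sum_x expR (l x) * retr (ptens (fun i => f (k + i)%N) m *m M x) <= 1) ->
  retr (ptens f (iter q (addn m) r) *m acctest q c) <= expR (- c).
Proof.
elim: q f c => [|q IH] f c df hf /=.
  case: ifP => c0; last by rewrite mulmx0 retr0 expR_ge0.
  by rewrite mulmx1 density_retr; [rewrite -expR0 ler_expR oppr_ge0|exact: density_ptens].
rewrite acctest_step//; last by move=> x; exact: psd_acctest.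
apply: (@le_trans _ _ (\sum_x retr (ptens f m *m M x) * expR (- (c - l x)))).
  apply: ler_sum => x _; apply: ler_wpM2l.
    by apply: psd_retr_mul => //; exact: (density_ptens _ df).1.
  apply: IH; [by move=> i; exact: df|] => k; have := hf (m + k)%N; apply: le_trans; apply: ler_sum => x' _.
  by rewrite (@eq_ptens _ _ _ (fun i => f (m + k + i)%N))// => i _; rewrite addnA.
rewrite -[leRHS]mulr1; apply: le_trans (_ : expR (- c) * _ <= _); last first.
  by apply: ler_wpM2l; [exact: expR_ge0|exact: (hf 0%N)].
rewrite mulr_sumr; apply: ler_sum => x _.
by rewrite opprB addrC expRD mulrC mulrA.
Qed.

(** Chernoff's inequality at parameter th: rejection means a total score below c, and each block
    multiplies the mean of e^(- th score) by at most kap. *)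
Lemma acctest_typeI f q c th kap : (forall i, density (f i)) -> 0 <= th -> 0 <= kap ->
  (forall k, \sum_x expR (- (th * l x)) * retr (ptens (fun i => f (k + i)%N) m *m M x) <= kap) ->
  retr (ptens f (iter q (addn m) r) *m (1%:M - acctest q c)) <= expR (th * c) * kap ^+ q.
Proof.
move=> + th0 kap0; elim: q f c => [|q IH] f c df hf.
  rewrite /= expr0 mulr1; case: ifP => c0; first by rewrite subrr mulmx0 retr0 expR_ge0.
  rewrite subr0 mulmx1 density_retr; last exact: density_ptens.
  rewrite -expR0 ler_expR mulr_ge0//; move/negbT: c0; rewrite -ltNge; exact: ltW.
rewrite acctest_compl acctest_step//; last by move=> x; exact: psd_acctest_compl.
apply: (@le_trans _ _ (\sum_x retr (ptens f m *m M x) * (expR (th * (c - l x)) * kap ^+ q))).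
  apply: ler_sum => x _; apply: ler_wpM2l.
    by apply: psd_retr_mul => //; exact: (density_ptens _ df).1.
  apply: IH; [by move=> i; exact: df|] => k; have := hf (m + k)%N; apply: le_trans; apply: ler_sum => x' _.
  by rewrite (@eq_ptens _ _ _ (fun i => f (m + k + i)%N))// => i _; rewrite addnA.
rewrite exprS mulrA; apply: le_trans (_ : expR (th * c) * _ * kap ^+ q <= _); last first.
  apply: ler_wpM2r; first by rewrite exprn_ge0.
  by apply: ler_wpM2l; [exact: expR_ge0|exact: (hf 0%N)].
rewrite mulr_sumr mulr_suml; apply: ler_sum => x _.
rewrite mulrBr expRD (eq_ptens (g := f))// le_eqVlt; apply/orP; left; apply/eqP; ring.
Qed.

End Acc.

(** The threshold q (V - del) lies below the mean score, which is at least q V, so the first error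
    decays exponentially in q, uniformly over FA and whatever the number r of unmeasured copies.
    Closure under shifts supplies the same moment bounds at every block. *)
Lemma block_tests m (X : finType) (M : X -> 'M[C]_(d ^ m)) (t : X -> R) (V : R)
    (FA FB : set (nat -> 'M[C]_d)) :
  (forall x, psd (M x)) -> \sum_x M x = 1%:M -> (forall x, 0 < t x) ->
  (forall f k, FA f -> FA (fun i => f (k + i)%N)) -> (forall f i, FA f -> density (f i)) ->
  (forall f k, FB f -> FB (fun i => f (k + i)%N)) -> (forall f i, FB f -> density (f i)) ->
  (forall f, FA f -> V <= \sum_x ln (t x) * retr (ptens f m *m M x)) ->
  (forall f, FB f -> \sum_x t x * retr (ptens f m *m M x) <= 1) ->
  forall del eps, 0 < del -> 0 < eps -> exists q0, forall q r, (q0 <= q)%N ->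
  forall n, n = (q * m + r)%N -> exists E : 'M[C]_(d ^ n),
    [/\ psd E, psd (1%:M - E), forall f, FA f -> retr (ptens f n *m (1%:M - E)) <= eps &
     forall f, FB f -> retr (ptens f n *m E) <= expR (- (q%:R * (V - del)))].
Proof.
move=> pM sM t0 sA dA sB dB hA hB del eps del0 eps0.
pose l x := ln (t x).
pose L := 1 + \sum_x `|l x|.
have L1 : 1 <= L by rewrite lerDl sumr_ge0.
have lL x : `|l x| <= L.
  by rewrite /L (bigD1 x)//= addrCA lerDl addr_ge0// sumr_ge0.
(* The first bound brings th * l x into the range |y| <= 1/2 of [expR_le_quadratic]; the second
   makes the quadratic term at most half of the gain th * del. *)
pose th := Num.min ((2 * L)^-1) (del / (4 * L ^+ 2)).
have L0 : 0 < L by lra.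
have th0 : 0 < th by rewrite lt_min invr_gt0 divr_gt0 ?mulr_gt0// exprn_gt0.
have th1 : th * L <= 2^-1.
  have : th <= (2 * L)^-1 by rewrite ge_min lexx.
  move=> h; apply: (le_trans (ler_wpM2r (ltW L0) h)); rewrite invfM -mulrA mulVf ?mulr1// gt_eqF//.
have th2 : th * (2 * L ^+ 2) <= del / 2.
  have : th <= del / (4 * L ^+ 2) by rewrite ge_min lexx orbT.
  have LL : 0 < 2 * L ^+ 2 by rewrite mulr_gt0// exprn_gt0.
  move=> h; apply: (le_trans (ler_wpM2r (ltW LL) h)).
  have -> : del / (4 * L ^+ 2) * (2 * L ^+ 2) = del / 2 by field; rewrite gt_eqF.
  by [].
pose kap := expR (- (th * V) + 2 * th ^+ 2 * L ^+ 2).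
have hkap f : FA f -> \sum_x expR (- (th * l x)) * retr (ptens f m *m M x) <= kap.
  move=> Ff.
  have p0 x : 0 <= retr (ptens f m *m M x).
    by apply: psd_retr_mul => //; apply: (density_ptens _ _).1 => i; exact: dA.
  have p1 : \sum_x retr (ptens f m *m M x) = 1.
    by rewrite -retr_sum -mulmx_sumr sM mulmx1 density_retr//; apply: density_ptens => i; exact: dA.
  apply: (@le_trans _ _ (\sum_x (1 - th * l x + 2 * th ^+ 2 * L ^+ 2) * retr (ptens f m *m M x))).
    apply: ler_sum => x _; apply: ler_wpM2r => //.
    have nl : `|- (th * l x)| <= 2^-1.
      by rewrite normrN normrM gtr0_norm//; apply: le_trans th1; rewrite ler_pM2l.
    apply: (le_trans (expR_le_quadratic nl)); rewrite lerD2l -mulrA ler_pM2l// sqrrN exprMn.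
    by rewrite ler_pM2l ?exprn_gt0// -[l x ^+ 2]real_normK ?num_real// ler_sqr ?nnegrE// ltW.
  rewrite /kap; apply: le_trans (expR_ge1Dx _).
  rewrite (eq_bigr (fun x => retr (ptens f m *m M x) - th * (l x * retr (ptens f m *m M x)) + 2 * th ^+ 2 * L ^+ 2 * retr (ptens f m *m M x))); last first.
    by move=> x _; ring.
  rewrite big_split /= sumrB -!mulr_sumr p1 mulr1.
  have : th * V <= th * \sum_x l x * retr (ptens f m *m M x) by rewrite ler_pM2l//; exact: hA.
  by lra.
pose q0 := (Num.bound (`|ln eps| / (th * (del / 2)))).
exists q0 => q r q0q n nE.
have {nE} -> : n = iter q (addn m) r.
  by rewrite nE; elim: q {q0q nE} => [|q IH] //=; rewrite -IH mulSn addnA.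
exists (acctest r M l q (q%:R * (V - del))); split; [exact: psd_acctest|exact: psd_acctest_compl| |].
- move=> f Ff.
  apply: (le_trans (acctest_typeI r pM sM q _ (fun i => dA _ _ Ff) (ltW th0) (expR_ge0 _) (fun k => hkap _ (sA _ k Ff)))).
  rewrite /kap -expRM_natl -expRD -[eps]lnK ?posrE// ler_expR.
  have -> : th * (q%:R * (V - del)) + q%:R * (- (th * V) + 2 * th ^+ 2 * L ^+ 2) = - (q%:R * (th * del - th * (th * (2 * L ^+ 2)))).
    by ring.
  have h1 : th * (del / 2) <= th * del - th * (th * (2 * L ^+ 2)).
    by rewrite -mulrBr ler_pM2l//; lra.
  have h2 : `|ln eps| <= q%:R * (th * (del / 2)).
    rewrite -ler_pdivrMr ?mulr_gt0 ?divr_gt0//.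
    apply: (@le_trans _ _ q0%:R); last by rewrite ler_nat.
    by apply/ltW/archi_boundP; rewrite divr_ge0// mulr_ge0 ?ltW// divr_gt0.
  rewrite lerNl; apply: le_trans (ler_norm _) _; rewrite normrN; apply: (le_trans h2).
  by rewrite ler_wpM2l.
- move=> f Ff; apply: acctest_typeII => //; first by move=> i; exact: dB.
  move=> k; have := hB _ (sB _ k Ff); apply: le_trans; apply: ler_sum => x _.
  by rewrite /l lnK ?posrE.
Qed.

End Achievability.

(** * Minimax *)

Section Minimax.
Variable R : realType.

(** Points of an arbitrary type are seen only through finitely many real coordinates e, which covers
    matrices, product states and monomials in a state at once. An affine dependence removes one
    point at a time; short combinations are padded with weight 0. *)
Lemma caratheodory (T : Type) (J : finType) (e : T -> J -> R) k (w : 'I_k -> R) (x : 'I_k -> T) :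
  (forall i, 0 <= w i) -> \sum_i w i = 1 ->
  exists (w' : 'I_(#|J|.+1) -> R) (x' : 'I_(#|J|.+1) -> T),
   [/\ forall i, 0 <= w' i, \sum_i w' i = 1, forall i, exists j, x' i = x j &
       forall j, \sum_i w' i * e (x' i) j = \sum_i w i * e (x i) j].
Proof.
elim: k w x => [|k IH] w x w0 w1; first by move: w1; rewrite big_ord0 => /esym/eqP; rewrite oner_eq0.
have [kJ|Jk] := leqP k.+1 #|J|.+1.
  pose w' (i : 'I_(#|J|.+1)) := if insub (val i) is Some j then w j else 0.
  pose x' (i : 'I_(#|J|.+1)) := if insub (val i) is Some j then x j else x ord0.
  have tr F : \sum_i w' i * F (x' i) = \sum_i w i * F (x i).
    rewrite (bigID (fun i : 'I_(#|J|.+1) => (i < k.+1)%N)) /= addrC big1 ?add0r; last first.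
      by move=> i /negbTE ik; rewrite /w' insubF ?mul0r.
    rewrite (reindex_onto (widen_ord kJ) (fun i => inord (val i)))/=; last first.
      by move=> i ik; apply: val_inj => /=; rewrite inordK.
    rewrite [RHS](eq_bigl (fun i : 'I_k.+1 => (i < k.+1)%N && (inord i == i))); last first.
      by move=> i /=; rewrite ltn_ord inord_val eqxx.
    by apply: eq_bigr => i _; rewrite /w' /x' /= insubT //= => h; congr (w _ * F (x _)); apply: val_inj.
  exists w', x'; split.
  - by move=> i; rewrite /w'; case: insub.
  - by rewrite -w1; have := tr (fun=> 1); under eq_bigr do rewrite mulr1; move=> ->; apply: eq_bigr => i _; rewrite mulr1.
  - by move=> i; rewrite /x'; case: insub => [j|]; [exists j|exists ord0].
  - by move=> j; exact: (tr (fun y => e y j)).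
pose A : 'M[R]_(k.+1, #|J|.+1) := \matrix_(i, j) if unlift ord0 j is Some p then e (x i) (enum_val p) else 1.
have /rowV0Pn[c cA c0] : kermx A != 0.
  by rewrite -mxrank_eq0 mxrank_ker subn_eq0 -ltnNge (leq_ltn_trans (rank_leq_col A)).
have {}cA : c *m A = 0 by apply/sub_kermxP.
have c1 : \sum_i c 0 i = 0.
  have := congr1 (fun M : 'rV_ _ => M 0 ord0) cA; rewrite !mxE => h; rewrite -[RHS]h.
  by apply: eq_bigr => i _; rewrite mxE unlift_none mulr1.
have ce j : \sum_i c 0 i * e (x i) j = 0.
  have := congr1 (fun M : 'rV_ _ => M 0 (lift ord0 (enum_rank j))) cA; rewrite !mxE => h; rewrite -[RHS]h.
  by apply: eq_bigr => i _; rewrite mxE liftK enum_rankK.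
have [i1 ci1] : exists i, 0 < c 0 i.
  apply: contrapT => h.
  have cn i : c 0 i <= 0 by rewrite leNgt; apply/negP => ci; apply: h; exists i.
  have : \sum_i (- c 0 i) == 0 by rewrite sumrN c1 oppr0.
  rewrite psumr_eq0; last by move=> i _; rewrite oppr_ge0.
  move=> /allP H; move/negP: c0; apply; apply/eqP/rowP => i; rewrite mxE; apply/eqP.
  by rewrite -oppr_eq0; apply: H; rewrite mem_index_enum.
pose i0 := [arg min_(i < i1 | 0 < c 0 i) w i / c 0 i]%O.
have [ci0 tmin] : 0 < c 0 i0 /\ forall i, 0 < c 0 i -> w i0 / c 0 i0 <= w i / c 0 i.
  by rewrite /i0; case: Order.TotalTheory.arg_minP => // i ci H; split.
set t := w i0 / c 0 i0 in tmin.
have t0 : 0 <= t by rewrite divr_ge0// ltW.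
pose u i := w i - t * c 0 i.
have u0 i : 0 <= u i.
  rewrite /u subr_ge0; have [ci|ci] := ltP 0 (c 0 i); first by rewrite -ler_pdivlMr// tmin.
  by apply: le_trans (w0 i); rewrite mulr_ge0_le0.
have ui0 : u i0 = 0 by rewrite /u /t divfK ?subrr// gt_eqF.
have usum F : \sum_(i < k) u (lift i0 i) * F (x (lift i0 i)) = \sum_i u i * F (x i).
  by rewrite [RHS](bigD1_ord i0)//= ui0 mul0r add0r.
have u1 : \sum_(i < k) u (lift i0 i) = 1.
  have := usum (fun=> 1); under eq_bigr do rewrite mulr1; move=> ->; under eq_bigr do rewrite mulr1.
  by rewrite sumrB w1 -mulr_sumr c1 mulr0 subr0.
have [w' [x' [h1 h2 h3 h4]]] := IH (fun i => u (lift i0 i)) (fun i => x (lift i0 i)) (fun i => u0 _) u1.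
exists w', x'; split => //; first by move=> i; have [j ->] := h3 i; exists (lift i0 j).
move=> j; rewrite h4 (usum (fun y => e y j)).
under eq_bigr do rewrite mulrBl -mulrA.
by rewrite sumrB -mulr_sumr ce mulr0 subr0.
Qed.

Lemma continuous_sumr (T : topologicalType) I (r : seq I) (F : I -> T -> R) :
  (forall i, continuous (F i)) -> continuous (fun x => \sum_(i <- r) F i x).
Proof.
move=> cF x; elim: r => [|i r IH].
  rewrite (_ : (fun x => _) = cst 0); first exact: cvg_cst.
  by apply/funext => y; rewrite big_nil.
rewrite (_ : (fun x => _) = (fun x => F i x + \sum_(i <- r) F i x)); first by apply: cvgD => //; exact: cF.
by apply/funext => y; rewrite big_cons.
Qed.

(** Minimising phi, the sum of max(0, g_i)^2, replaces a separation theorem. The weights are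
    proportional to max(0, g_i) at a minimiser, and first-order optimality along segments of K
    bounds the weighted sum below by a positive multiple of the minimum of phi, itself positive. *)
Lemma minimax_finite (T : topologicalType) (K : set T) n (g : 'I_n -> T -> R) :
  compact K -> K !=set0 -> (forall i, continuous (g i)) ->
  (forall x y s, K x -> K y -> 0 <= s <= 1 -> exists2 z, K z &
     forall i, g i z = (1 - s) * g i x + s * g i y) ->
  (forall x, K x -> exists i, 0 < g i x) ->
  exists lam : 'I_n -> R, [/\ forall i, 0 <= lam i, \sum_i lam i = 1 &
    forall x, K x -> 0 < \sum_i lam i * g i x].
Proof.
move=> cK K0 cg cv pos.
pose p (a : R) := Num.max 0 a.
pose phi x := \sum_i p (g i x) ^+ 2.
have cphi : continuous phi.
  apply: continuous_sumr => i x.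
  have h : {for x, continuous (fun y => p (g i y))}.
    by apply: (@continuous_max _ _ (cst 0) (g i)) => //; [exact: cvg_cst|exact: cg].
  rewrite (_ : (fun x => _) = (fun x => p (g i x) * p (g i x))); last by apply/funext => y; rewrite expr2.
  exact: cvgM.
have [xs xK xmin] := compact_EVT_min K0 cK (continuous_subspaceT cphi).
rewrite inE in xK.
pose a i := g i xs.
have pp i : 0 <= p (a i) by rewrite le_max lexx.
have phi0 : 0 < phi xs.
  have [i gi] := pos xs xK; rewrite /phi (bigD1 i)//=; apply: ltr_pwDl.
    by rewrite exprn_gt0// lt_max gi orbT.
  by apply: sumr_ge0 => j _; exact: sqr_ge0.
have fo y : K y -> 0 <= \sum_i p (a i) * (g i y - a i).
  move=> yK; set S := \sum_i _; rewrite leNgt; apply/negP => S0.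
  pose B := \sum_i (g i y - a i) ^+ 2.
  have B0 : 0 <= B by apply: sumr_ge0 => i _; exact: sqr_ge0.
  (* Moving by s along the segment changes phi by at most s (2 S + s B), which is negative for this
     s when S < 0. *)
  pose s := Num.min 1 (- S / (B + 1)).
  have s0 : 0 < s by rewrite lt_min ltr01 divr_gt0 ?oppr_gt0// ltr_wpDl.
  have s1 : s <= 1 by rewrite ge_min lexx.
  have sB : s * B < - (2 * S).
    have : s * (B + 1) <= - S by rewrite -ler_pdivlMr ?ltr_wpDl// ge_min lexx orbT.
    by rewrite mulrDr mulr1; lra.
  have [|z zK gz] := cv xs y s xK yK; first by rewrite ltW.
  have : phi z <= phi xs + s * (2 * S + s * B).
    rewrite /phi /S /B mulrDr !mulr_sumr -!big_split /=; apply: ler_sum => i _.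
    rewrite gz -/(a i).
    have : p ((1 - s) * a i + s * g i y) ^+ 2 <= (p (a i) + s * (g i y - a i)) ^+ 2.
      rewrite /p; case: (leP 0 (a i)) => ha; case: (leP 0 ((1 - s) * a i + s * g i y)) => hb.
      - by rewrite le_eqVlt; apply/orP; left; apply/eqP; ring.
      - by rewrite expr0n sqr_ge0.
      - rewrite add0r ler_sqr ?nnegrE//; first by rewrite mulrBl mul1r mulrBr; nra.
        apply: le_trans hb _; rewrite mulrBl mul1r mulrBr; nra.
      - by rewrite expr0n sqr_ge0.
    by rewrite sqrrD exprMn; lra.
  have : phi xs <= phi z by apply: xmin; rewrite inE.
  nra.
pose L := \sum_i p (a i).
have L0 : 0 < L.
  have [i gi] := pos xs xK; rewrite /L (bigD1 i)//=; apply: ltr_pwDl; first by rewrite lt_max gi orbT.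
  by apply: sumr_ge0 => j _.
exists (fun i => p (a i) / L); split.
- by move=> i; rewrite divr_ge0// ltW.
- by rewrite -mulr_suml divff// gt_eqF.
- move=> y yK; under eq_bigr do rewrite mulrAC.
  rewrite -mulr_suml divr_gt0//; apply: (lt_le_trans phi0).
  have := fo y yK; under eq_bigr do rewrite mulrBr.
  rewrite sumrB subr_ge0; apply: le_trans; apply: ler_sum => i _.
  by rewrite /p -/(a i); case: (leP 0 (a i)) => h; [rewrite expr2|rewrite expr0n mul0r].
Qed.

Lemma continuous_affine (T : topologicalType) (J : finType) (a : J -> R) (b : R) (E : J -> T -> R) :
  (forall j, continuous (E j)) -> continuous (fun x => \sum_j a j * E j x + b).
Proof.
move=> cE x; apply: cvgD; last exact: cvg_cst.
apply: (@continuous_sumr T J _ (fun j y => a j * E j y)) => j y.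
by apply: cvgM; [exact: cvg_cst|exact: cE].
Qed.

(** Around each point of K some payoff stays positive on a neighbourhood; a finite subcover leaves
    finitely many payoffs. *)
Lemma minimax_compact (T : topologicalType) (K : set T) (I : Type) (G : I -> T -> R) :
  compact K -> K !=set0 -> (forall i, continuous (G i)) ->
  (forall x y s, K x -> K y -> 0 <= s <= 1 -> exists2 z, K z &
     forall i, G i z = (1 - s) * G i x + s * G i y) ->
  (forall x, K x -> exists i, 0 < G i x) ->
  exists n (lam : 'I_n -> R) (idx : 'I_n -> I), [/\ forall i, 0 <= lam i, \sum_i lam i = 1 &
    forall x, K x -> 0 < \sum_i lam i * G (idx i) x].
Proof.
move=> cK [x0 Kx0] cG cv pos.
have [i0 _] := pos x0 Kx0.
have /choice[idx hidx] : forall q : T, exists i, K q -> 0 < G i q.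
  by move=> q; have [/pos[i hi]|nK] := pselect (K q); [exists i|exists i0].
pose T2 : ptopologicalType := HB.pack T (isPointed.Build T x0).
have cover : cover_compact K.
  have h : @cover_compact T2 K by rewrite -compact_cover; exact: cK.
  exact: h.
have [||D _ hD] := cover T K (fun q => [set q' | 0 < G (idx q) q']).
- move=> q _; apply: (@open_comp _ _ (G (idx q)) [set y | 0 < y]); last exact: open_gt.
  by move=> q' _; exact: cG.
- by move=> q Kq; exists q => //; exact: hidx.
pose s : seq T := finmap.enum_fset D.
pose ids (p : 'I_(size s)) := idx (nth x0 s p).
have [||||lam [l0 l1 hl]] := @minimax_finite T K (size s) (fun p => G (ids p)) cK.
- by exists x0.
- by move=> p; exact: cG.
- by move=> x y t Kx Ky t01; have [z Kz hz] := cv x y t Kx Ky t01; exists z.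
- move=> q Kq; have [q' q'D hq] := hD q Kq.
  have hs : q' \in s by exact: q'D.
  have hi : (index q' s < size s)%N by rewrite index_mem.
  by exists (Ordinal hi); rewrite /ids /= nth_index.
by exists (size s), lam, ids.
Qed.

Section Hull.
Variables (T : topologicalType) (S : set T) (n : nat).

(** Convex combinations as pairs of weights and points: compact along with S, although T carries no
    linear structure. *)
Definition hull_dom : set ({ptws 'I_n -> R} * {ptws 'I_n -> T}) :=
  [set p | [/\ forall i, 0 <= p.1 i, \sum_i p.1 i = 1 & forall i, S (p.2 i)]].

Lemma hull_w_cont i : continuous (fun p : {ptws 'I_n -> R} * {ptws 'I_n -> T} => p.1 i).
Proof.
move=> p; apply: (@continuous_comp _ _ _ fst (fun u : {ptws 'I_n -> R} => u i)); first exact: cvg_fst.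
exact: (@proj_continuous _ (fun _ : 'I_n => R)).
Qed.

Lemma hull_x_cont i : continuous (fun p : {ptws 'I_n -> R} * {ptws 'I_n -> T} => p.2 i).
Proof.
move=> p; apply: (@continuous_comp _ _ _ snd (fun u : {ptws 'I_n -> T} => u i)); first exact: cvg_snd.
exact: (@proj_continuous _ (fun _ : 'I_n => T)).
Qed.

Lemma hull_eval_cont (e : T -> R) : continuous e ->
  continuous (fun p : {ptws 'I_n -> R} * {ptws 'I_n -> T} => \sum_i p.1 i * e (p.2 i)).
Proof.
move=> ce; apply: continuous_sumr => i p.
have h2 := @continuous_comp _ _ _ _ e p (@hull_x_cont i p) (ce _).
exact: cvgM (@hull_w_cont i p) h2.
Qed.

Lemma hull_dom_compact : compact S -> compact hull_dom.
Proof.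
move=> cS.
pose box : set {ptws 'I_n -> R} := [set f | forall i, `[0, 1]%classic (f i)].
have cbox : compact box by apply: (@tychonoff _ (fun=> R) (fun=> `[0, 1]%classic)) => i; exact: segment_compact.
have cSS : compact [set f : {ptws 'I_n -> T} | forall i, S (f i)].
  by apply: (@tychonoff _ (fun=> T) (fun=> S)).
have := compact_setX cbox cSS => cX.
pose Z : set ({ptws 'I_n -> R} * {ptws 'I_n -> T}) := (fun p => \sum_i p.1 i) @^-1` [set 1].
have cZ : closed Z.
  apply: closed_comp; last by apply: accessible_closed_set1; exact: hausdorff_accessible (@Rhausdorff R).
  by move=> p _; apply: (@continuous_sumr _ _ _ (fun i (q : {ptws 'I_n -> R} * {ptws 'I_n -> T}) => q.1 i)) => i; exact: hull_w_cont.
suff -> : hull_dom = (box `*` [set f : {ptws 'I_n -> T} | forall i, S (f i)]) `&` Z by apply: compact_closedI.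
apply/seteqP; split=> [[w x] /= [h1 h2 h3]|[w x] /= [[h1 h3] h2]].
  split=> //; split=> // i; rewrite /= in_itv /= h1 /= -h2.
  by rewrite (bigD1 i)//= lerDl sumr_ge0.
by split => // i; have := h1 i; rewrite /= in_itv /= => /andP[].
Qed.

End Hull.
End Minimax.

Section MinimaxHull.
Variable R : realType.

(** Payoffs are affine in the coordinates e, so by Caratheodory combinations of |J| + 1 points
    suffice, and these form a compact set on which payoffs can be interpolated. The conclusion is
    read off at point masses. *)
Lemma minimax_hull (T : topologicalType) (S : set T) (J : finType) (e : T -> J -> R)
    (I : Type) (a : I -> J -> R) (b : I -> R) :
  compact S -> S !=set0 -> (forall j, continuous (fun x => e x j)) ->
  (forall k (w : 'I_k -> R) (x : 'I_k -> T), (forall i, 0 <= w i) -> \sum_i w i = 1 -> (forall i, S (x i)) ->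
     exists i : I, 0 < \sum_j a i j * (\sum_p w p * e (x p) j) + b i) ->
  exists n (lam : 'I_n -> R) (idx : 'I_n -> I), [/\ forall p, 0 <= lam p, \sum_p lam p = 1 &
    forall x, S x -> 0 < \sum_p lam p * (\sum_j a (idx p) j * e x j + b (idx p))].
Proof.
move=> cS [x0 Sx0] ce H.
pose N := #|J|.+1.
pose T' : topologicalType := ({ptws 'I_N -> R} * {ptws 'I_N -> T})%type.
pose K : set T' := hull_dom S (n := N).
have cK : compact K by exact: hull_dom_compact.
pose E (q : T') j := \sum_p q.1 p * e (q.2 p) j.
pose G i (q : T') := \sum_j a i j * E q j + b i.
have cE j : continuous (fun q => E q j).
  exact: (@hull_eval_cont R T N (fun x => e x j)).
have cG i : continuous (G i) by exact: (@continuous_affine R T' J (a i) (b i) (fun j q => E q j) cE).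
have [||||n [lam [idx [l0 l1 hl]]]] := @minimax_compact R T' K I G cK.
- exists (fun p => (p == ord0)%:R, fun=> x0); split=> //=.
  by rewrite (bigD1 ord0)//= big1 ?addr0// => p /negbTE ->.
- exact: cG.
- move=> [w x] [w' x'] t [/= h1 h2 h3] [/= h1' h2' h3'] /andP[t0 t1].
  (* A point of the segment is the concatenation of both combinations, 2N weighted points, which
     [caratheodory] cuts back to N. *)
  pose W (p : 'I_(N + N)) := match fintype.split p with inl p => (1 - t) * w p | inr p => t * w' p end.
  pose Y (p : 'I_(N + N)) := match fintype.split p with inl p => x p | inr p => x' p end.
  have WY F : \sum_p W p * F (Y p) = (1 - t) * (\sum_p w p * F (x p)) + t * (\sum_p w' p * F (x' p)).
    rewrite big_split_ord /= !mulr_sumr; congr (_ + _); apply: eq_bigr => p _.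
      by rewrite /W /Y (unsplitK (inl p)) mulrA.
    by rewrite /W /Y (unsplitK (inr p)) mulrA.
  have [||w2 [x2 [k1 k2 k3 k4]]] := @caratheodory R T J e _ W Y.
  + by move=> p; rewrite /W; case: fintype.split => q; rewrite mulr_ge0// subr_ge0.
  + have := WY (fun=> 1); rewrite -!mulr_suml h2 h2' !mulr1 => ->.
    by rewrite subrK.
  exists (w2, x2).
    by split => //= p; have [q ->] := k3 p; rewrite /Y; case: fintype.split.
  move=> p; rewrite /G.
  have EE j : E (w2, x2) j = (1 - t) * E (w, x) j + t * E (w', x') j.
    by rewrite /E /= k4 (WY (fun y => e y j)).
  under eq_bigr do rewrite EE mulrDr mulrCA [_ * (t * _)]mulrCA.
  rewrite big_split /= -!mulr_sumr.
  move: (\sum_i _) (\sum_i _) (b _) => u v z; ring.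
- by move=> q [h1 h2 h3]; have [i hi] := H N q.1 q.2 h1 h2 h3; exists i.
exists n, lam, idx; split=> // x Sx.
have Kx : K (fun p => (p == ord0)%:R, fun=> x).
  split=> //=; by rewrite (bigD1 ord0)//= big1 ?addr0// => p /negbTE ->.
have := hl _ Kx; congr (_ < _); apply: eq_bigr => p _; congr (_ * (_ + _)); apply: eq_bigr => j _.
by rewrite /E /= (bigD1 ord0)//= big1 ?addr0 ?mul1r// => q /negbTE ->; rewrite mul0r.
Qed.

End MinimaxHull.

(** * Universal block measurements against compact families *)

Section BlockMinimax.
Variables (R : realType) (d : nat).
Local Notation C := (R[i]).

Definition prodset (F : set (nat -> 'M[C]_d)) n : set 'M[C]_(d ^ n) := [set ptens f n | f in F].
Arguments prodset : clear implicits.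

(** Compactness of a family of sequences, expressed by a parametrisation with continuous entries: by
    a single matrix for i.i.d. families, by an infinite product and Tychonoff's theorem for
    arbitrarily varying ones. *)
Definition cparam (F : set (nat -> 'M[C]_d)) := exists (T : topologicalType) (S : set T) (phi : T -> nat -> 'M[C]_d),
  [/\ compact S, forall x, S x -> F (phi x), forall f, F f -> exists2 x, S x & phi x = f,
      forall k i j, continuous (fun x => complex.Re (phi x k i j)) &
      forall k i j, continuous (fun x => complex.Im (phi x k i j))].

Lemma continuous_prodc (T : topologicalType) n (F : 'I_n -> T -> C) :
  (forall k, continuous (fun x => complex.Re (F k x))) -> (forall k, continuous (fun x => complex.Im (F k x))) ->
  continuous (fun x => complex.Re (\prod_k F k x)) /\ continuous (fun x => complex.Im (\prod_k F k x)).
Proof.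
elim: n F => [|n IH] F cr ci.
  split=> x.
    by rewrite (_ : (fun x => _) = cst (complex.Re (1 : C))); [exact: cvg_cst|apply/funext => y; rewrite big_ord0].
  by rewrite (_ : (fun x => _) = cst (complex.Im (1 : C))); [exact: cvg_cst|apply/funext => y; rewrite big_ord0].
have [Hr Hi] := IH (fun k => F (lift ord0 k)) (fun k => cr _) (fun k => ci _).
split=> x.
  rewrite (_ : (fun x => _) = (fun x => complex.Re (F ord0 x) * complex.Re (\prod_k F (lift ord0 k) x) - complex.Im (F ord0 x) * complex.Im (\prod_k F (lift ord0 k) x))).
    by apply: cvgB; apply: cvgM; [exact: cr|exact: Hr|exact: ci|exact: Hi].
  by apply/funext => y; rewrite big_ord_recl cReM.
rewrite (_ : (fun x => _) = (fun x => complex.Re (F ord0 x) * complex.Im (\prod_k F (lift ord0 k) x) + complex.Im (F ord0 x) * complex.Re (\prod_k F (lift ord0 k) x))).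
  by apply: cvgD; apply: cvgM; [exact: cr|exact: Hi|exact: ci|exact: Hr].
by apply/funext => y; rewrite big_ord_recl cImM.
Qed.

Lemma retr_mulE m (A B : 'M[C]_m) : retr (A *m B) =
  \sum_i \sum_j (complex.Re (A i j) * complex.Re (B j i) - complex.Im (A i j) * complex.Im (B j i)).
Proof.
rewrite /retr /mxtrace Re_sum; apply: eq_bigr => i _; rewrite mxE Re_sum.
by apply: eq_bigr => j _; rewrite cReM.
Qed.

Definition povm m (X : finType) (M : X -> 'M[C]_m) := (forall x, psd (M x)) /\ \sum_x M x = 1%:M.

Lemma povm_retr m (X : finType) (M : X -> 'M[C]_m) rho : povm M -> density rho ->
  (forall x, 0 <= retr (rho *m M x)) /\ \sum_x retr (rho *m M x) = 1.
Proof.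
move=> [pM sM] dr; split; first by move=> x; apply: psd_retr_mul => //; exact: dr.1.
by rewrite -retr_sum -mulmx_sumr sM mulmx1 density_retr.
Qed.

(** A game between pairs of hull elements and strategies (M, t), with payoff affine in the pair. The
    winning mixed strategy is itself a POVM whose outcome includes the mixing index. Dividing t by
    its largest mean s under FB separates the two families, without loss because ln s <= s - 1. *)
Lemma block_minimax (FA FB : set (nat -> 'M[C]_d)) m (X : finType) (V : R) :
  cparam FA -> cparam FB -> FA !=set0 -> FB !=set0 ->
  (forall f i, FA f -> density (f i)) -> (forall f i, FB f -> density (f i)) ->
  (forall rho sigma, co (prodset FA m) rho -> co (prodset FB m) sigma ->
     exists (M : X -> 'M[C]_(d ^ m)) (t : X -> R), [/\ povm M, forall x, 0 < t x &
       V < \sum_x ln (t x) * retr (rho *m M x) + 1 - \sum_x t x * retr (sigma *m M x)]) ->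
  exists (X' : finType) (M : X' -> 'M[C]_(d ^ m)) (t : X' -> R), [/\ povm M, forall x, 0 < t x,
    forall f, FA f -> V <= \sum_x ln (t x) * retr (ptens f m *m M x) &
    forall f, FB f -> \sum_x t x * retr (ptens f m *m M x) <= 1].
Proof.
move=> [TA [SA [pA [cA hA1 hA2 rA iA]]]] [TB [SB [pB [cB hB1 hB2 rB iB]]]] [fA FAf] [fB FBf] dA dB H.
pose D := (d ^ m)%N.
pose T : topologicalType := (TA * TB)%type.
pose S : set T := SA `*` SB.
pose J : finType := (bool * (bool * ('I_D * 'I_D)))%type.
pose tp (s : bool) (x : T) := ptens (if s then pA x.1 else pB x.2) m.
pose e (x : T) (j : J) : R := let z := tp j.1 x j.2.2.1 j.2.2.2 in if j.2.1 then complex.Re z else complex.Im z.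
pose I := {p : (X -> 'M[C]_D) * (X -> R) | povm p.1 /\ forall x, 0 < p.2 x}.
pose L (p : I) := \sum_x ((ln ((sval p).2 x))%:C)%C *: (sval p).1 x.
pose Q (p : I) := - \sum_x (((sval p).2 x)%:C)%C *: (sval p).1 x.
(* Coefficients of Re Tr(rho L) and Re Tr(sigma Q) in real coordinates; the sign comes from Re(z w)
   = Re z Re w - Im z Im w. *)
pose a (p : I) (j : J) : R := let z := (if j.1 then L p else Q p) j.2.2.2 j.2.2.1 in
   if j.2.1 then complex.Re z else - complex.Im z.
have aE p (rho sigma : 'M[C]_D) (u : J -> R) :
   (forall j, u j = let z := (if j.1 then rho else sigma) j.2.2.1 j.2.2.2 in if j.2.1 then complex.Re z else complex.Im z) ->
   \sum_j a p j * u j = \sum_x ln ((sval p).2 x) * retr (rho *m (sval p).1 x) - \sum_x (sval p).2 x * retr (sigma *m (sval p).1 x).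
  move=> uE.
  have -> : \sum_x ln ((sval p).2 x) * retr (rho *m (sval p).1 x) = retr (rho *m L p).
    by rewrite /L mulmx_sumr retr_sum; apply: eq_bigr => x _; rewrite -scalemxAr retrZ.
  have -> : - \sum_x (sval p).2 x * retr (sigma *m (sval p).1 x) = retr (sigma *m Q p).
    by rewrite /Q mulmxN retrN mulmx_sumr retr_sum; congr (- _); apply: eq_bigr => x _; rewrite -scalemxAr retrZ.
  transitivity (\sum_(s : bool) \sum_(cj : bool * ('I_D * 'I_D)) a p (s, cj) * u (s, cj)).
    by rewrite pair_bigA; apply: eq_bigr => -[].
  rewrite big_bool.
  have part s : \sum_j a p (s, j) * u (s, j) = retr ((if s then rho else sigma) *m (if s then L p else Q p)).
    transitivity (\sum_(c : bool) \sum_(ij : 'I_D * 'I_D) a p (s, (c, ij)) * u (s, (c, ij))).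
      by rewrite pair_bigA; apply: eq_bigr => -[].
    rewrite big_bool -big_split /= retr_mulE pair_bigA /=.
    by apply: eq_bigr => -[i j] _; rewrite !uE /a /=; ring.
  by rewrite !part.
have [||||n [lam [idx [l0 l1 hl]]]] := @minimax_hull R T S J e I a (fun=> 1 - V).
- exact: compact_setX.
- by have [x Sx _] := hA2 _ FAf; have [y Sy _] := hB2 _ FBf; exists (x, y).
- move=> [s [c [i j]]]; rewrite /e /=.
  have cre : continuous (fun x : T => complex.Re (tp s x i j)) /\ continuous (fun x : T => complex.Im (tp s x i j)).
    have -> : (fun x : T => complex.Re (tp s x i j)) = (fun x => complex.Re (\prod_(k < m) ((if s then pA x.1 else pB x.2) k (dig i k) (dig j k)))).
      by apply/funext => x; rewrite /tp ptensE.
    have -> : (fun x : T => complex.Im (tp s x i j)) = (fun x => complex.Im (\prod_(k < m) ((if s then pA x.1 else pB x.2) k (dig i k) (dig j k)))).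
      by apply/funext => x; rewrite /tp ptensE.
    apply: (@continuous_prodc T m (fun k x => (if s then pA x.1 else pB x.2) k (dig i k) (dig j k))) => k; case: (s) => x.
    + apply: (@continuous_comp _ _ _ fst (fun x => complex.Re (pA x k (dig i k) (dig j k)))); [exact: cvg_fst|exact: rA].
    + apply: (@continuous_comp _ _ _ snd (fun x => complex.Re (pB x k (dig i k) (dig j k)))); [exact: cvg_snd|exact: rB].
    + apply: (@continuous_comp _ _ _ fst (fun x => complex.Im (pA x k (dig i k) (dig j k)))); [exact: cvg_fst|exact: iA].
    + apply: (@continuous_comp _ _ _ snd (fun x => complex.Im (pB x k (dig i k) (dig j k)))); [exact: cvg_snd|exact: iB].
  by case: c; [exact: cre.1|exact: cre.2].
- move=> k w x w0 w1 Sx.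
  (* A combination of pairs has both its marginals in the respective hulls, with common weights. *)
  pose rho := \sum_p ((w p)%:C)%C *: tp true (x p).
  pose sigma := \sum_p ((w p)%:C)%C *: tp false (x p).
  have [||M [t [pM t0 hV]]] := H rho sigma.
  + exists k, w, (fun p => tp true (x p)); split=> // p; exists (pA (x p).1) => //.
    by apply: hA1; exact: (Sx p).1.
  + exists k, w, (fun p => tp false (x p)); split=> // p; exists (pB (x p).2) => //.
    by apply: hB1; exact: (Sx p).2.
  exists (exist _ (M, t) (conj pM t0)); rewrite (aE _ rho sigma); last first.
    move=> [s [c [i j]]] /=; rewrite /rho /sigma /e /=.
    by case: s; case: c; rewrite summxE ?Re_sum ?Im_sum; apply: eq_bigr => p _; rewrite mxE ?ReZ ?ImZ.
  by move: hV => /=; lra.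
have {}hl f g : FA f -> FB g ->
   V < \sum_p lam p * (\sum_x ln ((sval (idx p)).2 x) * retr (ptens f m *m (sval (idx p)).1 x)) + 1
       - \sum_p lam p * (\sum_x (sval (idx p)).2 x * retr (ptens g m *m (sval (idx p)).1 x)).
  move=> Ff Fg; have [x Sx xf] := hA2 _ Ff; have [y Sy yg] := hB2 _ Fg.
  have := hl (x, y) (conj Sx Sy).
  rewrite (eq_bigr (fun p => lam p * (\sum_x ln ((sval (idx p)).2 x) * retr (ptens f m *m (sval (idx p)).1 x)) - lam p * (\sum_x (sval (idx p)).2 x * retr (ptens g m *m (sval (idx p)).1 x)) + lam p * (1 - V))); last first.
    move=> p _; rewrite (aE _ (ptens f m) (ptens g m)); last first.
      by move=> [s [c [i j]]] /=; rewrite /e /tp /= xf yg; case: s.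
    by ring.
  rewrite big_split /= sumrB -mulr_suml l1; lra.
pose X' : finType := ('I_n * X)%type.
pose M (x : X') := ((lam x.1)%:C)%C *: (sval (idx x.1)).1 x.2.
pose t (x : X') := (sval (idx x.1)).2 x.2.
have pM : povm M.
  split; first by move=> x; apply: psdZ => //; have [[h _] _] := svalP (idx x.1); exact: h.
  rewrite -(pair_bigA _ (fun p x => M (p, x))) /= /M /=.
  transitivity (\sum_p ((lam p)%:C)%C *: (1%:M : 'M[C]_D)).
    apply: eq_bigr => p _; rewrite -scaler_sumr; congr (_ *: _).
    by have [[_ h] _] := svalP (idx p).
  by rewrite -scaler_suml -rmorph_sum l1 rmorph1 scale1r.
have t0 x : 0 < t x by have [_ h] := svalP (idx x.1); exact: h.
have sumX (u : X' -> R) (rho : 'M[C]_D) : \sum_x u x * retr (rho *m M x) = \sum_p lam p * (\sum_x u (p, x) * retr (rho *m (sval (idx p)).1 x)).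
  transitivity (\sum_p \sum_x u (p, x) * retr (rho *m M (p, x))).
    by rewrite pair_bigA; apply: eq_bigr => -[].
  apply: eq_bigr => p _.
  rewrite mulr_sumr; apply: eq_bigr => x _; rewrite /M /= -scalemxAr retrZ; ring.
have {}hl f g : FA f -> FB g -> V < \sum_x ln (t x) * retr (ptens f m *m M x) + 1 - \sum_x t x * retr (ptens g m *m M x).
  by move=> Ff Fg; rewrite !sumX; exact: hl.
pose tau g := \sum_x t x * retr (ptens g m *m M x).
have tau0 g : FB g -> 0 < tau g.
  move=> Fg; have [|h0 h1] := @povm_retr _ _ M (ptens g m) pM; first by apply: density_ptens => i; exact: dB.
  have [x hx] : exists x, 0 < retr (ptens g m *m M x).
    apply: contrapT => hn; have : \sum_x retr (ptens g m *m M x) = 0.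
      apply: big1 => x _; apply/eqP; rewrite eq_le h0 andbT leNgt; apply/negP => hx; apply: hn; by exists x.
    by rewrite h1 => /eqP; rewrite oner_eq0.
  have tx0 y : 0 <= t y * retr (ptens g m *m M y) by exact: mulr_ge0 (ltW (t0 y)) (h0 y).
  rewrite /tau (bigD1 x isT) /=; apply: ltr_pwDl; first exact: mulr_gt0 (t0 x) hx.
  by apply: sumr_ge0 => y _; exact: tx0.
have ub f : FA f -> ubound [set tau g | g in FB] (\sum_x ln (t x) * retr (ptens f m *m M x) + 1 - V).
  by move=> Ff _ [g Fg <-]; have := hl f g Ff Fg; rewrite /tau; lra.
have hs : has_sup [set tau g | g in FB].
  by split; [exists (tau fB); exists fB|exists (\sum_x ln (t x) * retr (ptens fA m *m M x) + 1 - V); exact: ub].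
pose s := sup [set tau g | g in FB].
have sg g : FB g -> tau g <= s by move=> Fg; apply: sup_upper_bound => //; exists g.
have s0 : 0 < s by apply: lt_le_trans (tau0 _ FBf) (sg _ FBf).
exists X', M, (fun x => t x / s); split=> //.
- by move=> x; rewrite divr_gt0.
- move=> f Ff; have [|h0 h1] := @povm_retr _ _ M (ptens f m) pM; first by apply: density_ptens => i; exact: dA.
  rewrite (eq_bigr (fun x => ln (t x) * retr (ptens f m *m M x) - ln s * retr (ptens f m *m M x))); last first.
    by move=> x _; rewrite ln_div ?posrE// mulrBl.
  rewrite sumrB -mulr_sumr h1 mulr1.
  have : s <= \sum_x ln (t x) * retr (ptens f m *m M x) + 1 - V by apply: ge_sup; [exact: hs.1|exact: ub].
  have := @ln_le_subr1 _ s s0; lra.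
- move=> g Fg; rewrite (eq_bigr (fun x => t x * retr (ptens g m *m M x) / s)); last by move=> x _; rewrite mulrAC.
  by rewrite -mulr_suml ler_pdivrMr// mul1r; exact: sg.
Qed.

End BlockMinimax.

Arguments prodset {R d} F n.

(** * Compactness of sets of states *)

Section CompactStates.
Variables (R : realType) (d : nat).
Local Notation C := (R[i]).
Local Notation Z := ('M[R]_d * 'M[R]_d)%type.

Definition cmx_of (z : Z) : 'M[C]_d := \matrix_(i, j) (z.1 i j +i* z.2 i j)%C.

Lemma mxcoordK (A : 'M[C]_d) : cmx_of (mxcoord A) = A.
Proof. by apply/matrixP => i j; rewrite !mxE /=; case: (A i j). Qed.

Lemma cmx_ofK (z : Z) : mxcoord (cmx_of z) = z.
Proof. by case: z => a b; rewrite /mxcoord; congr (_, _); apply/matrixP => i j; rewrite !mxE. Qed.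

(** A = G^* G and 2 |z w| <= |z|^2 + |w|^2. Boundedness of sets of states and integrability of
    tensor powers rest on this. *)
Lemma psd_entry_le m (A : 'M[C]_m) i j : psd A ->
  `|complex.Re (A i j)| <= retr A /\ `|complex.Im (A i j)| <= retr A.
Proof.
move=> /psd_factor[G ->].
have tr i0 : \sum_k sqn (G k i0) <= retr (adjmx G *m G).
  have E k : complex.Re ((adjmx G *m G) k k) = \sum_l sqn (G l k).
    by rewrite mxE Re_sum; apply: eq_bigr => l _; rewrite adjmxE -sqnE.
  rewrite /retr /mxtrace Re_sum (eq_bigr _ (fun k _ => E k)) [leRHS](bigD1 i0)//= lerDl.
  by apply: sumr_ge0 => k _; apply: sumr_ge0 => l _; exact: sqn_ge0.
have key (F : C -> R) : (forall x y, F (x + y) = F x + F y) -> F 0 = 0 ->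
    (forall z w, `|F (conjc z * w)| <= 2^-1 * (sqn z + sqn w)) ->
    `|F ((adjmx G *m G) i j)| <= retr (adjmx G *m G).
  move=> FD F0 Fb; rewrite mxE (big_morph F FD F0).
  apply: (@le_trans _ _ (\sum_k 2^-1 * (sqn (G k i) + sqn (G k j)))).
    by apply: (le_trans (ler_norm_sum _ _ _)); apply: ler_sum => k _; rewrite adjmxE.
  rewrite -mulr_sumr big_split /=; have := tr i; have := tr j; lra.
split; apply: key => //; [exact: cReD| |exact: cImD|].
- case=> [a b] [c e]; rewrite /sqn /= ler_norml.
  have := sqr_ge0 (a + c); have := sqr_ge0 (a - c); have := sqr_ge0 (b + e); have := sqr_ge0 (b - e).
  by rewrite !expr2 => *; apply/andP; split; lra.
- case=> [a b] [c e]; rewrite /sqn /= ler_norml.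
  have := sqr_ge0 (a + e); have := sqr_ge0 (a - e); have := sqr_ge0 (b + c); have := sqr_ge0 (b - c).
  by rewrite !expr2 => *; apply/andP; split; lra.
Qed.

Lemma continuous_mx (T : topologicalType) m n (f : T -> 'M[R]_(m, n)) :
  (forall i j, continuous (fun x => f x i j)) -> continuous f.
Proof.
move=> cf x A [P nP PA].
have : \forall y \near x, forall ij : 'I_m * 'I_n, P ij.1 ij.2 (f y ij.1 ij.2).
  by apply: filter_forall => -[i j]; exact: (cf i j x _ (nP i j)).
by apply: filterS => y h; apply: PA => i j; exact: (h (i, j)).
Qed.

Lemma continuous_mxpair (T : topologicalType) (f : T -> Z) :
  (forall i j, continuous (fun x => (f x).1 i j)) -> (forall i j, continuous (fun x => (f x).2 i j)) ->
  continuous f.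
Proof.
move=> h1 h2.
have c1 : continuous (fun x => (f x).1) by exact: continuous_mx.
have c2 : continuous (fun x => (f x).2) by exact: continuous_mx.
have -> : f = (fun x => ((f x).1, (f x).2)) by apply/funext => x; case: (f x).
by move=> x; exact: (cvg_pair (c1 x) (c2 x)).
Qed.

Lemma continuous_ptws1 (T1 T2 : topologicalType) (I1 I2 : eqType) (i : I1) :
  continuous (fun p : {ptws I1 -> T1} * {ptws I2 -> T2} => p.1 i).
Proof.
move=> p; apply: (@continuous_comp _ _ _ fst (fun u : {ptws I1 -> T1} => u i)); first exact: cvg_fst.
exact: (@proj_continuous _ (fun _ : I1 => T1)).
Qed.

Lemma continuous_ptws2 (T1 T2 : topologicalType) (I1 I2 : eqType) (i : I2) :
  continuous (fun p : {ptws I1 -> T1} * {ptws I2 -> T2} => p.2 i).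
Proof.
move=> p; apply: (@continuous_comp _ _ _ snd (fun u : {ptws I2 -> T2} => u i)); first exact: cvg_snd.
exact: (@proj_continuous _ (fun _ : I2 => T2)).
Qed.

Lemma continuous_coord1 i j : continuous (fun z : Z => z.1 i j).
Proof.
move=> z; apply: (@continuous_comp _ _ _ fst (fun M : 'M[R]_d => M i j)); first exact: cvg_fst.
exact: coord_continuous.
Qed.

Lemma continuous_coord2 i j : continuous (fun z : Z => z.2 i j).
Proof.
move=> z; apply: (@continuous_comp _ _ _ snd (fun M : 'M[R]_d => M i j)); first exact: cvg_snd.
exact: coord_continuous.
Qed.

Lemma compact_states (S : set 'M[C]_d) : cmx_closed S -> S `<=` @density R d -> compact (@mxcoord R d @` S).
Proof.
move=> cS dS.
pose box : set {ptws ('I_d * 'I_d) -> R} := [set f | forall i, `[(-1), 1]%classic (f i)].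
have cbox : compact box by apply: (@tychonoff _ (fun=> R) (fun=> `[(-1), 1]%classic)) => i; exact: segment_compact.
pose h (f : {ptws ('I_d * 'I_d) -> R} * {ptws ('I_d * 'I_d) -> R}) : Z := (\matrix_(i, j) f.1 (i, j), \matrix_(i, j) f.2 (i, j)).
have ch : continuous h.
  apply: continuous_mxpair => i j.
    rewrite (_ : (fun x => _) = (fun x : {ptws ('I_d * 'I_d) -> R} * {ptws ('I_d * 'I_d) -> R} => x.1 (i, j))).
      exact: continuous_ptws1.
    by apply/funext => y; rewrite mxE.
  rewrite (_ : (fun x => _) = (fun x : {ptws ('I_d * 'I_d) -> R} * {ptws ('I_d * 'I_d) -> R} => x.2 (i, j))).
    exact: continuous_ptws2.
  by apply/funext => y; rewrite mxE.
have cI : compact (h @` (box `*` box)).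
  by apply: continuous_compact; [exact: continuous_subspaceT|exact: compact_setX].
apply: (subclosed_compact cS cI) => _ [A SA <-].
have dA := dS A SA.
exists (fun ij => complex.Re (A ij.1 ij.2), fun ij => complex.Im (A ij.1 ij.2)); last first.
  by rewrite /h /mxcoord /=; congr (_, _); apply/matrixP => i j; rewrite !mxE.
by split=> -[i j] /=; have [] := psd_entry_le i j dA.1; rewrite (density_retr dA) in_itv /= -!ler_norml.
Qed.

(** With infinite sequences, one family yields the n-copy sets for all n at once, and a shift
    expresses that later blocks obey the same hypothesis. *)
Definition Fiid (S : set 'M[C]_d) : set (nat -> 'M[C]_d) := [set f | exists2 A, S A & f = fun=> A].
Definition Fav (S : set 'M[C]_d) : set (nat -> 'M[C]_d) := [set f | forall i, S (f i)].

Lemma iidset_prodset S n : iidset S n = prodset (Fiid S) n.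
Proof.
apply/seteqP; split=> [_ [A SA <-]|_ [_ [A SA ->] <-]]; first by exists (fun=> A); [exists A|rewrite ntensE].
by exists A => //; rewrite ntensE.
Qed.

Lemma cparam_iid S : compact (@mxcoord R d @` S) -> cparam (Fiid S).
Proof.
move=> cS; exists Z, (@mxcoord R d @` S), (fun z => fun=> cmx_of z); split => //.
- by move=> _ [A SA <-]; exists A => //; rewrite mxcoordK.
- by move=> _ [A SA ->]; exists (mxcoord A); [exists A|rewrite mxcoordK].
- move=> _ i j; rewrite (_ : (fun x => _) = (fun z : Z => z.1 i j)); first exact: continuous_coord1.
  by apply/funext => z; rewrite mxE.
- move=> _ i j; rewrite (_ : (fun x => _) = (fun z : Z => z.2 i j)); first exact: continuous_coord2.
  by apply/funext => z; rewrite mxE.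
Qed.

Lemma cparam_av S : compact (@mxcoord R d @` S) -> cparam (Fav S).
Proof.
move=> cS; exists {ptws nat -> Z}, [set f | forall i, (@mxcoord R d @` S) (f i)], (fun z => fun i => cmx_of (z i)); split => //.
- by apply: (@tychonoff _ (fun=> Z) (fun=> @mxcoord R d @` S)).
- by move=> z hz i; have [A SA <-] := hz i; rewrite mxcoordK.
- move=> f hf; exists (fun i => mxcoord (f i)); first by move=> i; exists (f i).
  by apply/funext => i; rewrite mxcoordK.
- move=> k i j; rewrite (_ : (fun x => _) = (fun z : {ptws nat -> Z} => (z k).1 i j)); last by apply/funext => z; rewrite mxE.
  move=> z; apply: (@continuous_comp _ _ _ (fun z : {ptws nat -> Z} => z k) (fun z : Z => z.1 i j)).
    exact: (@proj_continuous _ (fun _ : nat => Z)).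
  exact: continuous_coord1.
- move=> k i j; rewrite (_ : (fun x => _) = (fun z : {ptws nat -> Z} => (z k).2 i j)); last by apply/funext => z; rewrite mxE.
  move=> z; apply: (@continuous_comp _ _ _ (fun z : {ptws nat -> Z} => z k) (fun z : Z => z.2 i j)).
    exact: (@proj_continuous _ (fun _ : nat => Z)).
  exact: continuous_coord2.
Qed.

Lemma sub_co m (S : set 'M[C]_m) : S `<=` co S.
Proof.
move=> A SA; exists 1%N, (fun=> 1), (fun=> A); split=> //; first by rewrite big_ord1.
by rewrite big_ord1 scale1r.
Qed.

Lemma density_convex m k (w : 'I_k -> R) (x : 'I_k -> 'M[C]_m) :
  (forall i, 0 <= w i) -> \sum_i w i = 1 -> (forall i, density (x i)) ->
  density (\sum_i ((w i)%:C)%C *: x i).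
Proof.
move=> w0 w1 dx; split; first by apply: psd_sum => i _; apply: psdZ => //; exact: (dx i).1.
rewrite raddf_sum /= (eq_bigr (fun i => ((w i)%:C)%C)); last by move=> i _; rewrite mxtraceZ (dx i).2 mulr1.
by rewrite -rmorph_sum w1.
Qed.

Lemma co_density m (S : set 'M[C]_m) : S `<=` @density R m -> co S `<=` @density R m.
Proof. by move=> dS _ [k [w [x [w0 w1 Sx ->]]]]; apply: density_convex => // i; exact: dS. Qed.

Lemma mxcoord_closed (S : set 'M[C]_d) : compact (@mxcoord R d @` S) -> cmx_closed S.
Proof. by apply: compact_closed; exact: norm_hausdorff. Qed.

(** By Caratheodory the hull is the continuous image of the combinations of |J| + 1 points, J
    indexing the real coordinates. *)
Lemma compact_co (S : set 'M[C]_d) : compact (@mxcoord R d @` S) -> compact (@mxcoord R d @` (co S)).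
Proof.
move=> cS.
pose J : finType := (bool * ('I_d * 'I_d))%type.
pose N := #|J|.+1.
pose K := hull_dom (R := R) (@mxcoord R d @` S) (n := N).
have cK : compact K by exact: hull_dom_compact.
pose h (p : {ptws 'I_N -> R} * {ptws 'I_N -> Z}) : Z :=
  (\matrix_(i, j) \sum_k p.1 k * (p.2 k).1 i j, \matrix_(i, j) \sum_k p.1 k * (p.2 k).2 i j).
have ch : continuous h.
  apply: continuous_mxpair => i j.
    rewrite (_ : (fun x => _) = (fun p : {ptws 'I_N -> R} * {ptws 'I_N -> Z} => \sum_k p.1 k * (p.2 k).1 i j)).
      exact: (@hull_eval_cont R Z N (fun z => z.1 i j) (@continuous_coord1 i j)).
    by apply/funext => y; rewrite mxE.
  rewrite (_ : (fun x => _) = (fun p : {ptws 'I_N -> R} * {ptws 'I_N -> Z} => \sum_k p.1 k * (p.2 k).2 i j)).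
    exact: (@hull_eval_cont R Z N (fun z => z.2 i j) (@continuous_coord2 i j)).
  by apply/funext => y; rewrite mxE.
suff -> : @mxcoord R d @` (co S) = h @` K.
  by apply: continuous_compact => //; exact: continuous_subspaceT.
have hE (w : 'I_N -> R) (x : 'I_N -> 'M[C]_d) :
    h (w, fun k => mxcoord (x k)) = mxcoord (\sum_k ((w k)%:C)%C *: x k).
  rewrite /h /mxcoord /=; congr (_, _); apply/matrixP => i j; rewrite !mxE summxE ?Re_sum ?Im_sum.
    by apply: eq_bigr => k _; rewrite !mxE ReZ.
  by apply: eq_bigr => k _; rewrite !mxE ImZ.
apply/seteqP; split=> [_ [_ [k [w [x [w0 w1 Sx ->]]]] <-]|_ [[w z] [/= w0 w1 Sz] <-]].
  pose e (A : 'M[C]_d) (j : J) := if j.1 then complex.Re (A j.2.1 j.2.2) else complex.Im (A j.2.1 j.2.2).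
  have [w' [x' [k1 k2 k3 k4]]] := @caratheodory R _ J e _ w x w0 w1.
  exists (w', fun k => mxcoord (x' k)).
    by split=> //= i; have [j ->] := k3 i; exists (x j).
  rewrite hE; congr mxcoord; apply/matrixP => i j; rewrite !summxE.
  have := k4 (true, (i, j)); have := k4 (false, (i, j)); rewrite /e /= => hi hr.
  apply/eqP; rewrite eq_complex !Re_sum !Im_sum.
  by apply/andP; split; apply/eqP; [move: hr|move: hi] => hh; (etransitivity; [|etransitivity; [exact: hh|]]); apply: eq_bigr => l _; rewrite mxE ?ReZ ?ImZ.
have zE : z = fun k => mxcoord (cmx_of (z k)) by apply/funext => k; rewrite cmx_ofK.
rewrite zE hE; exists (\sum_k ((w k)%:C)%C *: cmx_of (z k)) => //.
exists N, w, (fun k => cmx_of (z k)); split=> // i.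
by have [A SA <-] := Sz i; rewrite mxcoordK.
Qed.

End CompactStates.

(** * Mixtures *)

Section Mixture.
Variables (R : realType) (d : nat).
Local Notation C := (R[i]).
Local Notation Z := ('M[R]_d * 'M[R]_d)%type.
Local Notation B := (BorelMx R d).

Lemma measurable_mxopen (U : set Z) : open U -> measurable (@mxcoord R d @^-1` U : set B).
Proof. by move=> oU; apply: sub_sigma_algebra; exists U. Qed.

Lemma measurable_cmx_closed (S : set 'M[C]_d) : cmx_closed S -> measurable (S : set B).
Proof.
move=> cS; rewrite -[S]setCK; apply: measurableC.
suff -> : ~` S = @mxcoord R d @^-1` (~` (@mxcoord R d @` S)) by apply: measurable_mxopen; exact: closed_openC.
apply/seteqP; split=> [A nSA [A' SA' h]|A nSA SA]; last by apply: nSA; exists A.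
by apply: nSA; rewrite -(mxcoordK A) -h mxcoordK.
Qed.

Lemma measurable_mxcont (f : Z -> R) : continuous f -> measurable_fun [set: B] (fun s : B => f (mxcoord (s : 'M[C]_d))).
Proof.
move=> cf; apply: (measurability _ (measurable_realfun.RGenOInfty.measurableE R)) => //.
move=> /= _ [_ [a ->]] <-; rewrite setTI.
rewrite (_ : _ @^-1` _ = @mxcoord R d @^-1` (f @^-1` `]a, +oo[%classic)); last by [].
apply: measurable_mxopen; apply: open_comp; last exact: interval_open.
by move=> z _; exact: cf.
Qed.

Lemma measurable_Re_entry i j : measurable_fun [set: B] (fun s : B => complex.Re ((s : 'M[C]_d) i j)).
Proof.
have := measurable_mxcont (@continuous_coord1 R d i j).
by rewrite (_ : (fun s => _) = (fun s : B => complex.Re ((s : 'M[C]_d) i j)))//; apply/funext => s; rewrite mxE.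
Qed.
Lemma measurable_Im_entry i j : measurable_fun [set: B] (fun s : B => complex.Im ((s : 'M[C]_d) i j)).
Proof.
have := measurable_mxcont (@continuous_coord2 R d i j).
by rewrite (_ : (fun s => _) = (fun s : B => complex.Im ((s : 'M[C]_d) i j)))//; apply/funext => s; rewrite mxE.
Qed.

Lemma measurable_prodc n (F : 'I_n -> B -> C) :
  (forall k, measurable_fun [set: B] (fun x => complex.Re (F k x))) ->
  (forall k, measurable_fun [set: B] (fun x => complex.Im (F k x))) ->
  measurable_fun [set: B] (fun x => complex.Re (\prod_k F k x)) /\
  measurable_fun [set: B] (fun x => complex.Im (\prod_k F k x)).
Proof.
elim: n F => [|n IH] F cr ci.
  split.
    by rewrite (_ : (fun x => _) = cst (complex.Re (1 : C))); [exact: measurable_cst|apply/funext => y; rewrite big_ord0].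
  by rewrite (_ : (fun x => _) = cst (complex.Im (1 : C))); [exact: measurable_cst|apply/funext => y; rewrite big_ord0].
have [Hr Hi] := IH (fun k => F (lift ord0 k)) (fun k => cr _) (fun k => ci _).
split.
  rewrite (_ : (fun x => _) = (fun x => complex.Re (F ord0 x) * complex.Re (\prod_k F (lift ord0 k) x) - complex.Im (F ord0 x) * complex.Im (\prod_k F (lift ord0 k) x))).
    by apply: measurable_funB; apply: measurable_funM.
  by apply/funext => y; rewrite big_ord_recl cReM.
rewrite (_ : (fun x => _) = (fun x => complex.Re (F ord0 x) * complex.Im (\prod_k F (lift ord0 k) x) + complex.Im (F ord0 x) * complex.Re (\prod_k F (lift ord0 k) x))).
  by apply: measurable_funD; apply: measurable_funM.
by apply/funext => y; rewrite big_ord_recl cImM.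
Qed.

Lemma measurable_ntens n i j :
  measurable_fun [set: B] (fun s : B => complex.Re (ntensmx (s : 'M[C]_d) n i j)) /\
  measurable_fun [set: B] (fun s : B => complex.Im (ntensmx (s : 'M[C]_d) n i j)).
Proof.
have [h1 h2] := @measurable_prodc n (fun k (s : B) => (s : 'M[C]_d) (dig i k) (dig j k)) (fun k => measurable_Re_entry _ _) (fun k => measurable_Im_entry _ _).
split.
  by rewrite (_ : (fun s => _) = (fun s : B => complex.Re (\prod_(k < n) (s : 'M[C]_d) (dig i k) (dig j k))))//; apply/funext => s; rewrite ntensE ptensE.
by rewrite (_ : (fun s => _) = (fun s : B => complex.Im (\prod_(k < n) (s : 'M[C]_d) (dig i k) (dig j k))))//; apply/funext => s; rewrite ntensE ptensE.
Qed.

Section Fixed.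
Variables (S : set 'M[C]_d) (mS : measurable (S : set B)) (dS : S `<=` @density R d).
Variables (mu : probability B R) (muS : mu S = 1%E).

Lemma Rintegral_prob_cst r : Rintegral mu S (cst r) = r.
Proof.
transitivity (r * fine (mu S)); first exact: (Rintegral_cst mu mS r).
by rewrite muS mulr1.
Qed.

Lemma RintegralS_sum (I : eqType) (r : seq I) (f : I -> B -> R) :
  (forall i, mu.-integrable S (EFin \o f i)) ->
  mu.-integrable S (EFin \o (fun x => \sum_(i <- r) f i x)) /\
  Rintegral mu S (fun x => \sum_(i <- r) f i x) = \sum_(i <- r) Rintegral mu S (f i).
Proof.
move=> hf; elim: r => [|i r [IH1 IH2]].
  rewrite big_nil (_ : (fun x => _) = cst 0); last by apply/funext => x; rewrite big_nil.
  by rewrite Rintegral_cst// mul0r; split=> //; exact: integrable0.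
rewrite big_cons (_ : (fun x => _) = (fun x => f i x + \sum_(j <- r) f j x)); last by apply/funext => x; rewrite big_cons.
rewrite RintegralD// IH2; split=> //.
rewrite (_ : EFin \o _ = (EFin \o f i) \+ (EFin \o (fun x => \sum_(j <- r) f j x)%R))%E; last by apply/funext => x /=; rewrite EFinD.
exact: integrableD.
Qed.

Lemma density_ntens (A : 'M[C]_d) n : density A -> density (ntensmx A n).
Proof. by move=> dA; rewrite ntensE; apply: density_ptens. Qed.

Lemma integrable_ntens n i j :
  mu.-integrable S (EFin \o (fun s : B => complex.Re (ntensmx (s : 'M[C]_d) n i j))) /\
  mu.-integrable S (EFin \o (fun s : B => complex.Im (ntensmx (s : 'M[C]_d) n i j))).
Proof.
have [h1 h2] := measurable_ntens i j.
have fin : (mu S < +oo)%E by rewrite muS ltry.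
have bd (s : B) : S s -> `|complex.Re (ntensmx (s : 'M[C]_d) n i j)| <= 1 /\ `|complex.Im (ntensmx (s : 'M[C]_d) n i j)| <= 1.
  move=> /dS /(density_ntens n) ds; rewrite -(density_retr ds); exact: psd_entry_le ds.1.
split; apply: measurable_bounded_integrable => //; try exact: measurable_funTS.
  by exists 1; split => // M M1 s Ss; apply: le_trans (bd s Ss).1 (ltW M1).
by exists 1; split => // M M1 s Ss; apply: le_trans (bd s Ss).2 (ltW M1).
Qed.

(** Linear functionals commute with the entrywise integral defining [mixture], so positivity, trace
    and test bounds of mixtures become statements about integrands. *)
Lemma integrable_retr_ntens n (X : 'M[C]_(d ^ n)) :
  mu.-integrable S (EFin \o (fun s : B => retr (ntensmx (s : 'M[C]_d) n *m X))) /\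
  Rintegral mu S (fun s : B => retr (ntensmx (s : 'M[C]_d) n *m X)) = retr (mixture S mu n *m X).
Proof.
pose f (p : 'I_(d ^ n) * 'I_(d ^ n)) (s : B) := complex.Re (ntensmx (s : 'M[C]_d) n p.1 p.2) * complex.Re (X p.2 p.1) - complex.Im (ntensmx (s : 'M[C]_d) n p.1 p.2) * complex.Im (X p.2 p.1).
have -> : (fun s : B => retr (ntensmx (s : 'M[C]_d) n *m X)) = (fun s => \sum_p f p s).
  by apply/funext => s; rewrite retr_mulE pair_bigA.
have int1 p : mu.-integrable S (EFin \o (fun s : B => complex.Re (ntensmx (s : 'M[C]_d) n p.1 p.2) * complex.Re (X p.2 p.1))).
  have -> : EFin \o (fun s : B => complex.Re (ntensmx (s : 'M[C]_d) n p.1 p.2) * complex.Re (X p.2 p.1)) = (fun s => (complex.Re (X p.2 p.1))%:E * (EFin \o (fun s : B => complex.Re (ntensmx (s : 'M[C]_d) n p.1 p.2))) s)%E.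
    by apply/funext => s /=; rewrite -EFinM mulrC.
  by apply: integrableZl => //; exact: (integrable_ntens p.1 p.2).1.
have int2 p : mu.-integrable S (EFin \o (fun s : B => complex.Im (ntensmx (s : 'M[C]_d) n p.1 p.2) * complex.Im (X p.2 p.1))).
  have -> : EFin \o (fun s : B => complex.Im (ntensmx (s : 'M[C]_d) n p.1 p.2) * complex.Im (X p.2 p.1)) = (fun s => (complex.Im (X p.2 p.1))%:E * (EFin \o (fun s : B => complex.Im (ntensmx (s : 'M[C]_d) n p.1 p.2))) s)%E.
    by apply/funext => s /=; rewrite -EFinM mulrC.
  by apply: integrableZl => //; exact: (integrable_ntens p.1 p.2).2.
have intf p : mu.-integrable S (EFin \o f p).
  rewrite (_ : EFin \o f p = (EFin \o (fun s : B => complex.Re (ntensmx (s : 'M[C]_d) n p.1 p.2) * complex.Re (X p.2 p.1))%R) \- (EFin \o (fun s : B => complex.Im (ntensmx (s : 'M[C]_d) n p.1 p.2) * complex.Im (X p.2 p.1))%R))%E; first exact: integrableB.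
  by apply/funext => s /=; rewrite -EFinB.
have [i1 ->] := RintegralS_sum (index_enum _) intf; split=> //.
rewrite retr_mulE pair_bigA /=; apply: eq_bigr => p _.
rewrite /f RintegralB// RintegralZr//; last exact: (integrable_ntens p.1 p.2).1.
rewrite RintegralZr//; last exact: (integrable_ntens p.1 p.2).2.
by rewrite !mxE.
Qed.

Lemma mixture_herm n : herm (mixture S mu n).
Proof.
apply/matrixP => i j; rewrite adjmxE !mxE /=; apply/eqP; rewrite eq_complex /=.
have hs (s : B) : S s -> ntensmx (s : 'M[C]_d) n i j = conjc (ntensmx (s : 'M[C]_d) n j i).
  by move=> /dS /(density_ntens n) [[h _] _]; rewrite -adjmxE h.
apply/andP; split; apply/eqP.
  by apply: eq_Rintegral => s; rewrite inE => /hs ->; case: (ntensmx _ _ _ _).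
rewrite -mulN1r -RintegralZl//; last exact: (integrable_ntens j i).2.
by apply: eq_Rintegral => s; rewrite inE => /hs ->; case: (ntensmx _ _ _ _) => a b /=; rewrite mulN1r.
Qed.

Lemma mixture_density n : density (mixture S mu n).
Proof.
have hm := mixture_herm n.
split; [split=> // x|].
  rewrite -/(qf _ _) qf_retr -(integrable_retr_ntens _).2; apply: Rintegral_ge0 => s Ss.
  by rewrite -qf_retr; apply: psd_qf; exact: (density_ntens n (dS Ss)).1.
rewrite (herm_tr_real hm) -[mixture S mu n]mulmx1 -(integrable_retr_ntens _).2.
rewrite (@eq_Rintegral _ _ _ mu S (cst 1)); last first.
  by move=> s; rewrite inE => Ss; rewrite mulmx1 density_retr//; exact: density_ntens (dS Ss).
have -> : Rintegral mu S (cst 1) = 1 :> R by rewrite Rintegral_prob_cst.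
by [].
Qed.

Lemma mixture_retr_le n (E : 'M[C]_(d ^ n)) beta :
  (forall s, S s -> retr (ntensmx s n *m E) <= beta) -> retr (mixture S mu n *m E) <= beta.
Proof.
move=> hb; rewrite -(integrable_retr_ntens _).2.
have -> : beta = Rintegral mu S (cst beta) by rewrite Rintegral_prob_cst.
apply: le_Rintegral => //; first exact: (integrable_retr_ntens _).1.
by apply: (integrableS measurableT) => //; apply: finite_measure_integrable_cst.
Qed.

End Fixed.

Section ToProbability.
Variables (m : {measure set B -> \bar R}) (m1 : m setT = 1%E).
(** An alias that remembers the proof of total mass 1, so that the probability structure can be
    attached to it. *)
Definition mprob (_ : m setT = 1%E) : set B -> \bar R := m.
HB.instance Definition _ := Measure.copy (mprob m1) (m : set B -> \bar R).
HB.instance Definition _ := Measure_isProbability.Build _ _ _ (mprob m1) m1.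
Definition probability_of : probability B R := mprob m1.
End ToProbability.

Section MixtureMeasure.
Variables (S : set 'M[C]_d) (mS : measurable (S : set B)) (dS : S `<=` @density R d).

(** Equal to 1 / ((n + 1) (n + 2)); this form telescopes to total mass 1. *)
Definition polyweight n : R := (n.+1%:R)^-1 - (n.+2%:R)^-1.

Lemma polyweight_gt0 n : 0 < polyweight n.
Proof. by rewrite subr_gt0 ltf_pV2 ?posrE// ltr_nat. Qed.

Lemma polyweight_sum : (\sum_(n <oo) (polyweight n)%:E = 1)%E.
Proof.
apply: cvg_lim => //.
rewrite (_ : (fun n => _) = (fun n => (1 - (n.+1%:R)^-1 : R)%:E)); last first.
  apply/funext => n; rewrite sumEFin; congr EFin.
  elim: n => [|n IH]; first by rewrite big_geq// invr1 subrr.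
  by rewrite big_nat_recr//= IH /polyweight addrA subrK.
apply: cvg_EFin; first by near=> n.
rewrite -[X in _ --> X](subr0 1); apply: cvgB; first exact: cvg_cst.
exact: cvg_harmonic.
Unshelve. all: by end_near. Qed.

(** The measure is a weighted series of finitely supported measures, the n-th representing sig n. On
    n copies that term alone gives the bound, and the others contribute nonnegatively. *)
Lemma exists_mixture (sig : forall n, 'M[C]_(d ^ n)) : (forall n, co (iidset S n) (sig n)) ->
  exists mu : probability B R, probOn S mu /\
    forall n, psd (mixture S mu n - ((polyweight n)%:C)%C *: sig n).
Proof.
move=> hs.
(* Weights and points are extended from ordinals to [nat], the index type of sums of measures; past
   the end [inord] falls back to an existing index, which keeps the points in S. *)
have hs' n : exists kwx : (nat * ((nat -> R) * (nat -> 'M[C]_d))),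
  [/\ forall i, 0 <= kwx.2.1 i, \sum_(i < kwx.1) kwx.2.1 i = 1, forall i, S (kwx.2.2 i) &
      sig n = \sum_(i < kwx.1) ((kwx.2.1 i)%:C)%C *: ntensmx (kwx.2.2 i) n].
  have [k [w [x [w0 w1 Sx ->]]]] := hs n.
  case: k w x w0 w1 Sx => [w x _|k w x w0 w1 Sx]; first by rewrite big_ord0 => /esym/eqP; rewrite oner_eq0.
  have [y hy] := choice (fun i => let: ex_intro2 a b c := Sx i in ex_intro (fun a => S a /\ ntensmx a n = x i) a (conj b c)).
  exists (k.+1, (fun i => w (inord i), fun i => y (inord i))); split=> //=.
  - by rewrite -w1; apply: eq_bigr => i _; rewrite inord_val.
  - by move=> i; exact: (hy _).1.
  - by apply: eq_bigr => i _; rewrite inord_val (hy _).2.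
have [F hF] := choice hs'.
pose mm n : {measure set B -> \bar R} := mscale (NngNum (ltW (polyweight_gt0 n)))
   (msum (fun j => mscale (NngNum ((let: And4 h _ _ _ := hF n in h) j)) (dirac ((F n).2.2 j : B))) (F n).1).
pose m : {measure set B -> \bar R} := mseries mm 0.
have tot (A : set B) : measurable A -> (forall x, S x -> A x) -> m A = 1%E.
  move=> mA SA; rewrite /m /= /mseries /= -polyweight_sum; apply: eq_eseriesr => n _.
  have [w0 w1 Sx _] := hF n.
  rewrite /mm /= /mscale /= /msum /= -[RHS]mule1; congr (_ * _)%E.
  rewrite (eq_bigr (fun j : 'I_ _ => ((F n).2.1 j)%:E)); first by rewrite sumEFin w1.
  by move=> j _; rewrite /mscale /= diracE mem_set ?mule1//; exact: SA.
have m1 : m setT = 1%E by exact: tot.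
pose mu : probability B R := probability_of m1.
have hmu A : mu A = m A by [].
have muS : mu S = 1%E by rewrite hmu tot.
exists mu; split=> // n.
have [w0 w1 Sx ->] := hF n.
split.
  rewrite /herm adjmxB adjmxZ (mixture_herm mS dS muS) adjmx_sum; congr (_ - _ *: _).
  by apply: eq_bigr => j _; rewrite adjmxZ; have [[-> _] _] := density_ntens n (dS (Sx j)).
move=> v; rewrite -/(qf _ _) qfB qfZ subr_ge0.
pose f (s : B) := qf (ntensmx (s : 'M[C]_d) n) v.
have fE : f = (fun s : B => retr (ntensmx (s : 'M[C]_d) n *m (v *m adjmx v))).
  by apply/funext => s; rewrite /f qf_retr.
have f0 s : S s -> 0 <= f s by move=> Ss; apply: psd_qf; exact: (density_ntens n (dS Ss)).1.
have intf := (integrable_retr_ntens mS dS muS (v *m adjmx v)).1.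
rewrite (qf_retr (mixture S mu n)) -(integrable_retr_ntens mS dS muS _).2 -fE.
rewrite -fE in intf.
have mf : measurable_fun (S : set B) (EFin \o f) by case/integrableP: intf.
rewrite -lee_fin /Rintegral fineK; last exact: integral_fune_fin_num.
rewrite (eq_measure_integral m); last by move=> A _ _; exact: hmu.
rewrite ge0_integral_measure_series//.
have term : (\int[mm n]_(x in (S : set B)) (EFin \o f) x = (polyweight n * qf (\sum_(i < (F n).1) (((F n).2.1 i)%:C)%C *: ntensmx ((F n).2.2 i) n) v)%:E)%E.
  rewrite ge0_integral_mscale//=.
  rewrite EFinM; congr (_ * _)%E.
  rewrite ge0_integral_measure_sum//.
  rewrite qf_retr mulmx_suml retr_sum -sumEFin; apply: eq_bigr => j _.
  rewrite ge0_integral_mscale//=.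
  by rewrite integral_dirac// diracE mem_set// mul1e -scalemxAl retrZ EFinM fE.
rewrite -term (nneseriesD1 (n := n))//; last first.
  by move=> k _; apply: integral_ge0 => s Ss; rewrite lee_fin; exact: f0.
by rewrite leeDl//; apply: nneseries_ge0 => k _ _; apply: integral_ge0 => s Ss; rewrite lee_fin; exact: f0.
Qed.

End MixtureMeasure.

End Mixture.

(** * Stein exponents *)

Section SteinLimits.
Variables (R : realType) (d : nat).
Local Notation C := (R[i]).
Implicit Types A B : forall n, set 'M[C]_(d ^ n).

Lemma limn_einf_gt (u : (\bar R)^nat) x : (x < limn_einf u)%E -> exists N, forall k, (N <= k)%N -> (x < u k)%E.
Proof.
rewrite limn_einf_lim (cvg_lim _ (@cvg_einfs_sup _ _))// => /ereal_sup_gt[_ [N _ <-] h].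
exists N => k Nk; apply: (lt_le_trans h); apply: ereal_inf_lbound; exists k => //.
Qed.

Lemma limn_einf_ge (u : (\bar R)^nat) x : (exists N, forall k, (N <= k)%N -> (x <= u k)%E) -> (x <= limn_einf u)%E.
Proof.
move=> [N h]; rewrite limn_einf_lim (cvg_lim _ (@cvg_einfs_sup _ _))//.
apply: (@le_trans _ _ (einfs u N)); last by apply: ereal_sup_ubound; exists N.
by apply: le_ereal_inf_tmp => _ [k /= Nk <-]; exact: h.
Qed.

Lemma ereal_nlog_le (x y : \bar R) : (x <= y)%E -> (ereal_nlog y <= ereal_nlog x)%E.
Proof.
case: x y => [x| |] [y| |] //=; rewrite ?leey ?leNye// lee_fin => xy.
case: ltP => y0; case: ltP => x0; rewrite ?leey//; last by have := lt_le_trans x0 xy; rewrite ltNge y0.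
by rewrite lee_fin lerN2 ler_ln// posrE.
Qed.

Lemma ereal_nlog_ge (x : \bar R) (c : R) : (x <= (expR (- c))%:E)%E -> (c%:E <= ereal_nlog x)%E.
Proof.
by move=> /ereal_nlog_le; apply: le_trans; rewrite /= expR_gt0 expRK opprK.
Qed.

Lemma ereal_nlog_gt (x : \bar R) (c : R) : (c%:E < ereal_nlog x)%E -> (x < (expR (- c))%:E)%E.
Proof.
case: x => [x| |] //=; last by rewrite ltNyr.
case: (ltP 0 x) => x0; last by move=> _; rewrite lte_fin (le_lt_trans x0) ?expR_gt0.
by rewrite !lte_fin ltrNr -ltr_expR lnK.
Qed.

Lemma beta_err_le m (eps eps' : R) (An Bn : set 'M[C]_m) : eps <= eps' ->
  (beta_err eps' An Bn <= beta_err eps An Bn)%E.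
Proof.
move=> ee; apply: ereal_inf_le_tmp => _ [E [pE [pF h]] <-]; exists E => //; split=> //; split=> //.
by apply: (le_trans h); rewrite lee_fin.
Qed.

Lemma limn_einf_le (u v : (\bar R)^nat) : (forall n, (u n <= v n)%E) -> (limn_einf u <= limn_einf v)%E.
Proof.
move=> uv; rewrite !limn_einf_lim !(cvg_lim _ (@cvg_einfs_sup _ _))//.
apply: ge_ereal_sup => _ [N _ <-]; apply: (@le_trans _ _ (einfs v N)); last by apply: ereal_sup_ubound; exists N.
apply: le_ereal_inf_tmp => _ [k /= Nk <-]; apply: le_trans (uv k).
by apply: ereal_inf_lbound; exists k.
Qed.

Lemma stein_eps_le A B (e e' : R) : e <= e' -> (stein_eps A B e <= stein_eps A B e')%E.
Proof.
move=> ee; apply: limn_einf_le => n; apply: lee_wpmul2l; first by rewrite lee_fin invr_ge0.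
by apply: ereal_nlog_le; exact: beta_err_le.
Qed.

(** [stein_eps] is monotone in eps, so the one-sided limit at 0 is an infimum. *)
Lemma SteinE A B : Stein A B = ereal_inf (stein_eps A B @` `]0, 1[%classic).
Proof.
apply: cvg_lim => //; apply: (@nondecreasing_at_right_cvge _ (stein_eps A B) 0 (BLeft 1)).
  by rewrite bnd_simp.
by move=> x y _ _; exact: stein_eps_le.
Qed.

Lemma Stein_le_eps A B e : 0 < e < 1 -> (Stein A B <= stein_eps A B e)%E.
Proof. by move=> he; rewrite SteinE; apply: ereal_inf_lbound; exists e => //=; rewrite in_itv. Qed.

Lemma Stein_ge A B x : (forall e, 0 < e < 1 -> (x <= stein_eps A B e)%E) -> (x <= Stein A B)%E.
Proof. by move=> h; rewrite SteinE; apply: le_ereal_inf_tmp => _ [e /= he <-]; apply: h; move: he; rewrite in_itv. Qed.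

Lemma stein_eps_test A B (e r : R) : (r%:E < stein_eps A B e)%E ->
  exists N, forall n, (N <= n)%N -> exists E : 'M[C]_(d ^ n),
    [/\ psd E, psd (1%:M - E), forall rho, A n rho -> retr (rho *m (1%:M - E)) <= e &
     forall sigma, B n sigma -> retr (sigma *m E) <= expR (- (n%:R * r))].
Proof.
(* N.+1 excludes n = 0, where the factor n^-1 is 0 and the rate says nothing about tests. *)
move=> /limn_einf_gt[N h]; exists N.+1 => n Nn.
have n0 : (0 < n)%N by exact: leq_trans Nn.
have := h n (ltnW Nn); rewrite lte_pdivlMl ?ltr0n// -EFinM => /ereal_nlog_gt.
move=> /ereal_inf_lt[_ [E [pE [pF h1]] <-] h2]; exists E; split=> //.
  move=> rho Ar; rewrite -lee_fin; apply: le_trans h1; apply: ereal_sup_ubound; by exists rho.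
move=> sg Bs; rewrite -lee_fin; apply: le_trans (ltW h2); apply: ereal_sup_ubound; by exists sg.
Qed.

Lemma stein_eps_ge A B (e r : R) :
  (exists N, forall n, (N <= n)%N -> exists E : 'M[C]_(d ^ n),
    [/\ psd E, psd (1%:M - E), forall rho, A n rho -> retr (rho *m (1%:M - E)) <= e &
     forall sigma, B n sigma -> retr (sigma *m E) <= expR (- (n%:R * r))]) ->
  (r%:E <= stein_eps A B e)%E.
Proof.
move=> [N h]; apply: limn_einf_ge; exists N.+1 => n Nn.
have n0 : (0 < n)%N by exact: leq_trans Nn.
rewrite lee_pdivlMl ?ltr0n// -EFinM; apply: ereal_nlog_ge.
have [E [pE pF h1 h2]] := h n (ltnW Nn).
apply: (@le_trans _ _ (ereal_sup [set (retr (sigma *m E))%:E | sigma in B n])).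
  by apply: ereal_inf_lbound; exists E => //; split=> //; split=> //; apply: ge_ereal_sup => _ [rho Ar <-]; rewrite lee_fin; exact: h1.
by apply: ge_ereal_sup => _ [sg Bs <-]; rewrite lee_fin; exact: h2.
Qed.

End SteinLimits.

Section SteinBounds.
Variables (R : realType) (d : nat).
Local Notation C := (R[i]).
Implicit Types A B : forall n, set 'M[C]_(d ^ n).

Lemma natr_mul_unbounded (a K : R) : 0 < a -> exists N, forall n, (N <= n)%N -> K <= n%:R * a.
Proof.
move=> a0; exists (Num.bound (K / a)) => n Nn.
rewrite -ler_pdivrMr//; apply: (le_trans (ler_norm _)); apply: ltW.
by apply: (lt_le_trans (archi_boundP (normr_ge0 _))); rewrite ler_nat (leq_trans _ Nn)// /Num.bound normr_id.
Qed.

(** tau satisfies every linear upper bound valid on S. Hull elements and integrals over S have this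
    property, and so do products of hull elements relative to product states. *)
Definition test_dominated n (S : set 'M[C]_(d ^ n)) (tau : 'M[C]_(d ^ n)) :=
  forall E beta, (forall sigma, S sigma -> retr (sigma *m E) <= beta) -> retr (tau *m E) <= beta.

Lemma co_test_dominated n (S : set 'M[C]_(d ^ n)) tau : co S tau -> test_dominated S tau.
Proof.
move=> [k [w [x [w0 w1 Sx ->]]]] E beta h.
rewrite mulmx_suml retr_sum -[beta]mul1r -w1 mulr_suml; apply: ler_sum => i _.
by rewrite -scalemxAl retrZ ler_wpM2l// h.
Qed.

(** The threshold N depends on r alone, not on rho or tau, so both states may be chosen anew for
    each n. *)
Lemma Stein_converse A B (r : R) : (forall n, A n `<=` @density R _) -> (r%:E < Stein A B)%E ->
  exists N, forall n, (N <= n)%N -> forall rho tau, co (A n) rho -> density tau -> test_dominated (B n) tau ->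
  ((n%:R * r)%:E <= relent rho tau)%E.
Proof.
move=> dA rS.
have [r0|r0] := ltP r 0.
  (* For negative r the trivial test with t = 1 gives D >= -1, which is at least n r for large n. *)
  have [N hN] := @natr_mul_unbounded (- r) 1 ltac:(by rewrite oppr_gt0).
  exists N => n /hN Nn rho tau cr dt _.
  have dr := co_density (@dA n) cr.
  have := @relent_test_ge R _ rho tau 1%:M (retr (rho *m (1%:M - 1%:M))) (retr (tau *m 1%:M)) 1 dr dt.1.
  rewrite density_retr// subrr => /(_ (lexx _) (psd1 _ _) (psd0 _ _) (lexx _) (lexx _) (lexx _)).
  by apply: le_trans; rewrite lee_fin ln1 mul0r sub0r; lra.
have [r' rr' r'S] : exists2 r', r < r' & (r'%:E < Stein A B)%E.
  case: (Stein A B) rS => [s| |]//.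
    by rewrite lte_fin => rs; exists ((r + s) / 2); rewrite ?lte_fin; lra.
  by move=> _; exists (r + 1); rewrite ?ltry//; lra.
(* The parameter is t = e^(n r2) with r < r2 < r': t beta <= e^(- n (r' - r2)) is eventually below
   e, and the loss 4 e n r2 + 1 fits into n (r2 - r). *)
pose r2 := (r + r') / 2.
have r2r : r < r2 by rewrite /r2; lra.
have r2r' : r2 < r' by rewrite /r2; lra.
have r20 : 0 < r2 by exact: le_lt_trans r2r.
clearbody r2.
have r28 : 0 < 8 * r2 by rewrite mulr_gt0.
pose e := Num.min (2^-1) ((r2 - r) / (8 * r2)).
have e0 : 0 < e by rewrite lt_min invr_gt0 ltr0n /= divr_gt0 ?subr_gt0//.
have e1 : e < 1 by rewrite gt_min; apply/orP; left; lra.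
have e2 : 4 * e * r2 <= (r2 - r) / 2.
  have : e <= (r2 - r) / (8 * r2) by rewrite ge_min lexx orbT.
  by rewrite ler_pdivlMr//; move: r20; clear; lra.
have [|N1 h1] := @stein_eps_test R d A B e r'.
  by apply: (lt_le_trans r'S); apply: Stein_le_eps; rewrite e0 e1.
have [N2 h2] := @natr_mul_unbounded (r' - r2) (- ln e) ltac:(by rewrite subr_gt0).
have [N3 h3] := @natr_mul_unbounded ((r2 - r) / 2) 1 ltac:(by rewrite divr_gt0// subr_gt0).
exists (maxn N1 (maxn N2 N3)) => n; rewrite !geq_max => /and3P[/h1[E [pE pF hA hB]] /h2 k2 /h3 k3].
move=> rho tau cr dt dom.
have dr := co_density (@dA n) cr.
have tI : retr (rho *m (1%:M - E)) <= e by apply: (co_test_dominated cr).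
have tII : retr (tau *m E) <= expR (- (n%:R * r')) by apply: dom.
have t1 : 1 <= expR (n%:R * r2) by rewrite -expR0 ler_expR mulr_ge0// ltW.
have tr1 : retr tau <= 1 by rewrite density_retr.
apply: le_trans (relent_test_ge dr dt.1 tr1 pE pF tI tII t1).
rewrite expRK -expRD lee_fin.
have : expR (n%:R * r2 + - (n%:R * r')) <= e.
  by rewrite -[leRHS]lnK// ler_expR; lra.
move: (expR (n%:R * r2 + - (n%:R * r'))) => y ye.
have nn : 0 <= n%:R :> R by [].
have : n%:R * r2 * (1 - 2 * (e + e)) <= n%:R * r2 * (1 - 2 * (e + y)).
  apply: ler_wpM2l; first by rewrite mulr_ge0// ltW.
  by move: ye; clear; lra.
have : n%:R * (4 * e * r2) <= n%:R * ((r2 - r) / 2) by rewrite ler_wpM2l.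
by move: k3; clear; lra.
Qed.

Lemma Stein_ge_block m (X : finType) (M : X -> 'M[C]_(d ^ m)) (t : X -> R) (V : R)
    (FA FB : set (nat -> 'M[C]_d)) : (0 < m)%N ->
  povm M -> (forall x, 0 < t x) ->
  (forall f k, FA f -> FA (fun i => f (k + i)%N)) -> (forall f i, FA f -> density (f i)) ->
  (forall f k, FB f -> FB (fun i => f (k + i)%N)) -> (forall f i, FB f -> density (f i)) ->
  (forall f, FA f -> V <= \sum_x ln (t x) * retr (ptens f m *m M x)) ->
  (forall f, FB f -> \sum_x t x * retr (ptens f m *m M x) <= 1) ->
  ((V / m%:R)%:E <= Stein (prodset FA) (prodset FB))%E.
Proof.
move=> m0 [pM sM] t0 sA dA sB dB hA hB; apply: Stein_ge => e /andP[e0 _].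
have mR : 0 < m%:R :> R by rewrite ltr0n.
apply/lee_addgt0Pr => e1 e10.
rewrite -leeBlDr// -EFinB; set r := _ - e1.
have rE : m%:R * r = V - m%:R * e1 by rewrite /r mulrBr mulrC divfK ?gt_eqF.
(* With q = n / m, n r = q (V - 2 del) + (n mod m) r: one del is the loss in [block_tests], the
   other absorbs the remainder, at most m |r|. *)
pose del := m%:R * e1 / 2.
have del0 : 0 < del by rewrite divr_gt0 ?mulr_gt0.
have [q0 hq] := block_tests pM sM t0 sA dA sB dB hA hB del0 e0.
have [q1 hq1] := @natr_mul_unbounded del (m%:R * `|r|) del0.
apply: stein_eps_ge; exists (maxn q0 q1 * m)%N => n nN.
have : (maxn q0 q1 <= n %/ m)%N by rewrite leq_divRL.
rewrite geq_max => /andP[k0 k1].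
have [E [pE pF h1 h2]] := hq (n %/ m)%N (n %% m)%N k0 n (divn_eq n m).
exists E; split=> //; [by move=> _ [f Ff <-]; exact: h1|move=> _ [f Ff <-]].
apply: (le_trans (h2 f Ff)); rewrite ler_expR lerN2.
rewrite [in leLHS](divn_eq n m) natrD natrM mulrDl -mulrA rE.
have : (n %% m)%N%:R * r <= m%:R * `|r|.
  apply: (le_trans (ler_wpM2l (ler0n _ _) (ler_norm r))).
  by rewrite ler_wpM2r// ler_nat ltnW// ltn_mod.
have := hq1 _ k1; rewrite /del; move: ((n %/ m)%N%:R : R) ((n %% m)%N%:R * r) => a b.
clear; lra.
Qed.

Lemma Fiid_shift (S : set 'M[C]_d) f k : Fiid S f -> Fiid S (fun i => f (k + i)%N).
Proof. by move=> [A SA ->]; exists A. Qed.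

Lemma Fav_shift (S : set 'M[C]_d) f k : Fav S f -> Fav S (fun i => f (k + i)%N).
Proof. by move=> h i; exact: h. Qed.

Lemma co_iidspan (S : set 'M[C]_d) n sigma : co (iidset S n) sigma -> iidspan sigma.
Proof.
move=> [k [w [x [w0 w1 Sx ->]]]].
have [y hy] := choice (fun i => let: ex_intro2 a b c := Sx i in ex_intro (fun a => ntensmx a n = x i) a c).
exists [seq (((w i)%:C)%C, y i) | i <- enum 'I_k]; rewrite big_map big_enum /=.
by apply: eq_bigr => i _; rewrite -ntensE hy.
Qed.

(** The excess ln (ntypes d m) pays for measuring the eigenspaces of a hull element of the i.i.d.
    family. It serves contrapositively: if V / m exceeds the exponent, some pair in the hulls has
    small relative entropy. *)
Lemma block_rate (FA : set (nat -> 'M[C]_d)) (S : set 'M[C]_d) m (V : R) :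
  (forall f i, FA f -> density (f i)) -> cparam FA -> FA !=set0 ->
  S `<=` @density R d -> compact (@mxcoord R d @` S) -> S !=set0 ->
  (forall rho sigma, co (prodset FA m) rho -> co (iidset S m) sigma ->
     (V%:E + (ln (ntypes d m)%:R)%:E < relent rho sigma)%E) ->
  exists (X' : finType) (M : X' -> 'M[C]_(d ^ m)) (t : X' -> R), [/\ povm M, forall x, 0 < t x,
    forall f, FA f -> V <= \sum_x ln (t x) * retr (ptens f m *m M x) &
    forall f, Fiid S f -> \sum_x t x * retr (ptens f m *m M x) <= 1].
Proof.
move=> dA cA nA dS cS [s0 Ss0] h.
have dB f i : Fiid S f -> density (f i) by move=> [A SA ->]; exact: dS.
have nB : Fiid S !=set0 by exists (fun=> s0); exists s0.
apply: (@block_minimax R d FA (Fiid S) m ('I_(d ^ m) * 'I_(d ^ m))%type V cA (cparam_iid cS) nA nB dA dB).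
move=> rho sigma cr; rewrite -iidset_prodset => cs.
have dr : density rho.
  by apply: (co_density _ cr) => _ [f Ff <-]; apply: density_ptens => i; exact: dA.
have ds : density sigma.
  by apply: (co_density _ cs) => _ [A SA <-]; apply: density_ntens; exact: dS.
have [|M [t [p1 p2 p3 p4]]] := @measured_relent_iid R d m rho sigma V dr ds.1 _ (co_iidspan cs) (h _ _ cr cs).
  by rewrite density_retr.
by exists M, t.
Qed.

End SteinBounds.

(** * Subexponential error terms *)

Section SubExp.
Variable R : realType.

(** One-sided: limsup u n / n <= 0, which is what upper bounds on rates call for. *)
Definition subexp (u : nat -> R) := forall del, 0 < del -> exists N, forall n, (N <= n)%N -> u n <= n%:R * del.

Lemma subexp_const c : subexp (fun=> c).
Proof. by move=> del d0; apply: natr_mul_unbounded. Qed.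

Lemma subexpD u v : subexp u -> subexp v -> subexp (fun n => u n + v n).
Proof.
move=> hu hv del d0; have d2 : 0 < del / 2 by rewrite divr_gt0.
have [N1 h1] := hu _ d2; have [N2 h2] := hv _ d2.
exists (maxn N1 N2) => n; rewrite geq_max => /andP[/h1 k1 /h2 k2].
move: k1 k2; clear; lra.
Qed.

Lemma subexpZ c u : 0 <= c -> subexp u -> subexp (fun n => c * u n).
Proof.
rewrite le_eqVlt => /predU1P[<-|c0] hu del d0.
  by exists 0%N => n _; rewrite mul0r mulr_ge0// ltW.
have [N h] := hu _ (divr_gt0 d0 c0); exists N => n /h.
by rewrite mulrA ler_pdivlMr// mulrC.
Qed.

Lemma subexp_le u v : (forall n, u n <= v n) -> subexp v -> subexp u.
Proof. by move=> uv hv del /hv[N h]; exists N => n /h; apply: le_trans. Qed.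

(** ln (a (n + 1)) <= a (n + 1) - 1 with a = del / 2: slope del / 2, and the other half of del
    absorbs the constant. *)
Lemma subexp_ln : subexp (fun n => ln n.+1%:R).
Proof.
move=> del d0; pose a := del / 2.
have a0 : 0 < a by rewrite divr_gt0.
have [N h] := natr_mul_unbounded (a - 1 - ln a) a0.
exists N => n /h k.
have := ln_le_subr1 (mulr_gt0 a0 (ltr0Sn R n)).
rewrite lnM ?posrE// -natr1 mulrDr mulr1.
have : del = a + a by rewrite /a; lra.
move: (ln (n%:R + 1)) k => y k -> hh; move: k hh; clear; nra.
Qed.

Lemma subexp_ntypes d : subexp (fun n => ln (ntypes d n)%:R).
Proof.
apply: (@subexp_le _ (fun n => (d * d)%:R * ln n.+1%:R)).
  by move=> n; rewrite /ntypes natrX lnXn// mulr_natl.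
by apply: subexpZ => //; exact: subexp_ln.
Qed.

Lemma subexp_ntypes2 d : subexp (fun n => ln (2 * ntypes d n).+1%:R).
Proof.
have := subexpD (subexp_const (ln 3)) (subexp_ntypes d).
apply: subexp_le => n.
have v0 : (0 < ntypes d n)%N by rewrite expn_gt0.
rewrite -lnM ?posrE ?ltr0n// ler_ln ?posrE ?mulr_gt0 ?ltr0n// -natrM ler_nat.
by move: v0; clear; lia.
Qed.

Lemma subexp_polyweight : subexp (fun n => - ln (polyweight R n)).
Proof.
have := subexpD (subexp_const (ln 2)) (subexpD subexp_ln subexp_ln).
apply: subexp_le => n.
rewrite -lnV ?posrE ?polyweight_gt0// -!lnM ?posrE ?mulr_gt0//.
rewrite ler_ln ?posrE ?mulr_gt0 ?invr_gt0 ?polyweight_gt0//.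
have -> : polyweight R n = (n.+1%:R * n.+2%:R)^-1.
  rewrite /polyweight; have n1 : n.+1%:R != 0 :> R by [].
  have n2 : n.+2%:R != 0 :> R by [].
  have e : n.+2%:R = n.+1%:R + 1 :> R by rewrite natr1.
  by rewrite -[X in X - _]div1r -[X in _ - X]div1r -mulNr addf_div// mul1r mulN1r {1}e addrAC subrr add0r div1r.
rewrite invrK -!natrM ler_nat; clear; nia.
Qed.

End SubExp.

(** * Attainment of the minimum *)

Section EventualBounds.
Variable R : realType.

Lemma cvge_eventually_le (u : (\bar R)^nat) l x : u n @[n --> \oo] --> l ->
  (exists N, forall n, (N <= n)%N -> (x <= u n)%E) -> (x <= l)%E.
Proof.
move=> ul [N h]; rewrite -(cvg_lim _ ul)//; apply: lime_ge; first by apply/cvg_ex; exists l.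
by near=> n; apply: h; near: n; exact: nbhs_infty_ge.
Unshelve. all: by end_near. Qed.

Lemma le_of_lt_real (x y : \bar R) : (forall r : R, (r%:E < x)%E -> (r%:E <= y)%E) -> (x <= y)%E.
Proof.
case: x => [x| |] h; last by rewrite leNye.
  apply/lee_addgt0Pr => e e0; rewrite -leeBlDr// -EFinB; apply: h; rewrite lte_fin; lra.
case: y h => [y| |] h; rewrite ?leey//.
  by have := h (y + 1) (ltry _); rewrite lee_fin gerDl ler10.
by have := h 0 (ltry _).
Qed.

Lemma cvge_bounds (u : (\bar R)^nat) (s : R) :
  (forall e, 0 < e -> exists N, forall n, (N <= n)%N -> ((s - e)%:E <= u n /\ u n <= (s + e)%:E)%E) ->
  u n @[n --> \oo] --> s%:E.
Proof.
move=> h; apply/fine_cvgP; split.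
  have [N hN] := h 1 ltr01; near=> n.
  have /hN[] : (N <= n)%N by near: n; exact: nbhs_infty_ge.
  by case: (u n).
apply/cvgrPdist_le => e e0; have [N hN] := h e e0; near=> n.
have /hN[] : (N <= n)%N by near: n; exact: nbhs_infty_ge.
rewrite /=; case: (u n) => [x| |]//=; rewrite !lee_fin => h1 h2; rewrite ler_norml; apply/andP; split; lra.
Unshelve. all: by end_near. Qed.

Lemma cvge_pinfty (u : (\bar R)^nat) :
  (forall r : R, exists N, forall n, (N <= n)%N -> (r%:E <= u n)%E) -> u n @[n --> \oo] --> +oo%E.
Proof.
move=> h; apply/cvgeyPge => r; have [N hN] := h r; near=> n; apply: hN; near: n; exact: nbhs_infty_ge.
Unshelve. all: by end_near. Qed.

Lemma cvge_of_bounds (u : (\bar R)^nat) (s : \bar R) : (0 <= s)%E ->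
  (forall r : R, (r%:E < s)%E -> exists N, forall n, (N <= n)%N -> (r%:E <= u n)%E) ->
  (forall r : R, (s < r%:E)%E -> exists N, forall n, (N <= n)%N -> (u n <= r%:E)%E) ->
  u n @[n --> \oo] --> s.
Proof.
case: s => [s| |]// _ h1 h2; last by apply: cvge_pinfty => r; apply: h1; exact: ltry.
apply: cvge_bounds => e e0.
have [N1 k1] := h1 (s - e) ltac:(by rewrite lte_fin; lra).
have [N2 k2] := h2 (s + e) ltac:(by rewrite lte_fin; lra).
by exists (maxn N1 N2) => n; rewrite geq_max => /andP[/k1 ? /k2 ?].
Qed.

End EventualBounds.

Section MixtureRate.
Variables (R : realType) (d : nat).
Local Notation C := (R[i]).
Local Notation B := (BorelMx R d).
Variables (S : set 'M[C]_d) (S0 : S !=set0) (dS : S `<=` @density R d).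
Hypothesis cS : compact (@mxcoord R d @` S).

Let mS : measurable (S : set B). Proof. exact: measurable_cmx_closed (mxcoord_closed cS). Qed.

Lemma mixture_test_dominated (mu : probability B R) n : probOn S mu -> test_dominated (iidset S n) (mixture S mu n).
Proof. by move=> muS E b h; apply: mixture_retr_le => // s Ss; apply: h; exists s. Qed.

Section Family.
Variable FA : set (nat -> 'M[C]_d).
Hypotheses (dA : forall f i, FA f -> density (f i)) (sA : forall f k, FA f -> FA (fun i => f (k + i)%N)).

Lemma prodset_density n : prodset FA n `<=` @density R _.
Proof. by move=> _ [f Ff <-]; apply: density_ptens => i; exact: dA. Qed.

Lemma iid_density n : iidset S n `<=` @density R _.
Proof. by move=> _ [A SA <-]; apply: density_ntens; exact: dS. Qed.

Lemma Stein_ge0 : (0 <= Stein (prodset FA) (iidset S))%E.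
Proof.
apply: Stein_ge => e /andP[e0 _]; apply: stein_eps_ge; exists 0%N => n _; exists 1%:M; split.
- exact: psd1.
- by rewrite subrr; exact: psd0.
- by move=> rho _; rewrite subrr mulmx0 retr0 ltW.
- by move=> sg /iid_density ds; rewrite mulmx1 (density_retr ds) mulr0 oppr0 expR0.
Qed.

(** Mixtures obey every test bound valid for the i.i.d. powers, so the converse holds for each
    measure; no limit can fall below the exponent. *)
Lemma mixture_lower (mu : probability B R) (r : R) : probOn S mu ->
  (r%:E < Stein (prodset FA) (iidset S))%E ->
  exists N, forall n, (N <= n)%N -> forall rho, co (prodset FA n) rho ->
    (r%:E <= ((n%:R)^-1)%:E * relent rho (mixture S mu n))%E.
Proof.
move=> muS rs; have [N h] := Stein_converse prodset_density rs.
exists N.+1 => n Nn rho cr; have n0 : (0 < n)%N by exact: leq_trans Nn.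
rewrite lee_pdivlMl ?ltr0n// -EFinM; apply: h => //; first exact: ltnW.
  by apply: mixture_density.
exact: mixture_test_dominated.
Qed.

Hypotheses (cA : cparam FA) (A0 : FA !=set0).

(** If every pair had larger relative entropy, [block_rate] with V = n s + 1 would give tests of
    rate at least s + 1/n. The +1 only makes the contradiction strict. *)
Lemma block_minimizers (s : R) : Stein (prodset FA) (iidset S) = s%:E ->
  exists rs : forall n, 'M[C]_(d ^ n) * 'M[C]_(d ^ n), forall n,
    [/\ co (prodset FA n) (rs n).1, co (iidset S n) (rs n).2 &
     (0 < n)%N -> (relent (rs n).1 (rs n).2 <= (n%:R * s + 1 + ln (ntypes d n)%:R)%:E)%E].
Proof.
move=> hs.
suff h n : exists p : 'M[C]_(d ^ n) * 'M[C]_(d ^ n), [/\ co (prodset FA n) p.1, co (iidset S n) p.2 &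
     (0 < n)%N -> (relent p.1 p.2 <= (n%:R * s + 1 + ln (ntypes d n)%:R)%:E)%E].
  by exists (fun n => projT1 (cid (h n))) => n; case: (cid (h n)).
have [f Ff] := A0; have [s0 Ss0] := S0.
case: n => [|n].
  by exists (ptens f 0, ntensmx s0 0); split=> //=; apply: sub_co; [exists f|exists s0].
have dB g i : Fiid S g -> density (g i) by move=> [A SA ->]; exact: dS.
apply: contrapT => /forallNP no.
have [|X [M [t [p1 p2 p3 p4]]]] := @block_rate R d FA S n.+1 (n.+1%:R * s + 1) dA cA A0 dS cS S0.
  move=> rho sg cr cs; rewrite ltNge; apply/negP => le.
  by apply: (no (rho, sg)); split=> // _; rewrite EFinD.
have := @Stein_ge_block R d n.+1 X M t _ FA (Fiid S) isT p1 p2 sA dA (@Fiid_shift R d S) dB p3 p4.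
have -> : prodset (Fiid S) = iidset S by apply: functional_extensionality_dep => m; rewrite iidset_prodset.
have n0 : 0 < n.+1%:R :> R by [].
by rewrite hs lee_fin ler_pdivrMr// mulrC; lra.
Qed.

(** G n is the set over which the infimum is taken. The hypothesis [GE] passes from the hull to G n
    at the subexponential cost kk n, which is 0 when G n is the hull itself. *)
Variable G : forall n, set 'M[C]_(d ^ n).
Arguments G : clear implicits.
Hypothesis GA : forall n, G n `<=` co (prodset FA n).
Variable kk : nat -> R.
Hypothesis kk_sub : subexp kk.
Hypothesis GE : forall n rho sg, co (prodset FA n) rho -> psd sg ->
  exists2 rho', G n rho' & (relent rho' sg <= relent rho sg + (kk n)%:E)%E.

Lemma family_minimizers (s : R) : Stein (prodset FA) (iidset S) = s%:E ->
  exists (rho sg : forall n, 'M[C]_(d ^ n)), (forall n, G n (rho n)) /\ (forall n, co (iidset S n) (sg n)) /\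
   exists2 u, subexp u & forall n, (0 < n)%N -> (relent (rho n) (sg n) <= (n%:R * s + u n)%:E)%E.
Proof.
move=> /block_minimizers[rs hrs].
have hp n : psd (rs n).2 by have [_ h _] := hrs n; exact: (co_density (@iid_density n) h).1.
have ex n := cid2 (GE (let: And3 h _ _ := hrs n in h) (hp n)).
exists (fun n => s2val (ex n)), (fun n => (rs n).2); split; first by move=> n; exact: s2valP.
split; first by move=> n; have [] := hrs n.
exists (fun n => 1 + (ln (ntypes d n)%:R + kk n)).
  by apply: subexpD; [exact: subexp_const|apply: subexpD; [exact: subexp_ntypes|]].
move=> n n0; apply: (le_trans (s2valP' (ex n))).
have [_ _ /(_ n0) h] := hrs n; apply: (le_trans (leeD2r _ h)).
by rewrite -EFinD lee_fin; lra.
Qed.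

Lemma minstar_mixture :
  minstar (@probOn R d S)
     (fun mu n => ((n%:R)^-1)%:E * ereal_inf [set relent rhon (mixture S mu n) | rhon in G n])%E
     (Stein (prodset FA) (iidset S)).
Proof.
have low (mu : probability B R) (r : R) : probOn S mu -> (r%:E < Stein (prodset FA) (iidset S))%E ->
    exists N, forall n, (N <= n)%N -> (r%:E <= ((n%:R)^-1)%:E * ereal_inf [set relent rhon (mixture S mu n) | rhon in G n])%E.
  move=> pm /(mixture_lower pm)[N h]; exists N.+1 => n Nn.
  have n0 : (0 < n)%N by exact: leq_trans Nn.
  rewrite lee_pdivlMl ?ltr0n//; apply: le_ereal_inf_tmp => _ [rho Gr <-].
  by rewrite -lee_pdivlMl ?ltr0n//; apply: h; [exact: ltnW|exact: GA].
suff [mu pm up] : exists2 mu : probability B R, probOn S mu & forall r : R, (Stein (prodset FA) (iidset S) < r%:E)%E ->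
    exists N, forall n, (N <= n)%N -> (((n%:R)^-1)%:E * ereal_inf [set relent rhon (mixture S mu n) | rhon in G n] <= r%:E)%E.
  exists mu; split=> //.
    apply: cvge_of_bounds => //; [exact: Stein_ge0|by move=> r; exact: low].
  move=> nu l pn cl; apply: le_of_lt_real => r rs.
  by apply: (cvge_eventually_le cl); exact: low.
have [s0 Ss0] := S0.
(* An infinite exponent needs no upper bound: the lower bound forces divergence, and any measure on
   S will do. *)
have [sfin|] := boolP (Stein (prodset FA) (iidset S) \is a fin_num); last first.
  rewrite ge0_fin_numE ?Stein_ge0// ltey negbK => /eqP sy.
  have [|mu [pm _]] := @exists_mixture R d S mS dS (fun n => ntensmx s0 n); first by move=> n; apply: sub_co; exists s0.
  by exists mu => // r; rewrite sy.
have [rho [sg [hr [hs [u su hu]]]]] := family_minimizers (esym (fineK sfin)).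
have [mu [pm hmu]] := exists_mixture mS dS hs.
exists mu => // r; rewrite -(fineK sfin) lte_fin; set s := fine _ => sr.
(* The near-optimality error u and the cost - ln (polyweight n) of the weight share the slack r -
   s. *)
have [N hN] := subexpD su (@subexp_polyweight R) (ltac:(by rewrite subr_gt0) : 0 < r - s).
exists N.+1 => n Nn; have n0 : (0 < n)%N by exact: leq_trans Nn.
rewrite lee_pdivrMl ?ltr0n//.
apply: (@le_trans _ _ (relent (rho n) (mixture S mu n))); first by apply: ereal_inf_lbound; exists (rho n).
have dr : density (rho n) by apply: (co_density (@prodset_density n)); apply: GA.
have ds : density (sg n) by apply: (co_density (@iid_density n)).
apply: (le_trans (relent_op_antitone dr ds.1 (@polyweight_gt0 R n) (hmu n))).
apply: (le_trans (leeB (hu n n0) (lexx _))).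
rewrite -EFinB -EFinM lee_fin -/s; have := hN n (ltnW Nn); clearbody s; lra.
Qed.

End Family.
End MixtureRate.

(** * Extraction of one i.i.d. component *)

Section IidMixtures.
Variables (R : realType) (d : nat).
Local Notation C := (R[i]).

(** The entries of a tensor power are the monomials of the types, so mixtures have 2 * ntypes d n
    real coordinates. Caratheodory leaves polynomially many components whatever their original
    number, and [relent_mix_component] selects one at logarithmic cost. *)
Lemma iid_component (S : set 'M[C]_d) n rho sg : S `<=` @density R d ->
  co (iidset S n) rho -> psd sg ->
  exists2 rho', iidset S n rho' & (relent rho' sg <= relent rho sg + (ln (2 * ntypes d n).+1%:R)%:E)%E.
Proof.
move=> dS [k [w [x [w0 w1 Sx ->]]]] psg.
have [y hy] := choice (fun i => let: ex_intro2 a b c := Sx i in ex_intro (fun a => S a /\ ntensmx a n = x i) a (conj b c)).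
pose J : finType := (bool * {ffun 'I_d * 'I_d -> 'I_n.+1})%type.
pose mono (A : 'M[C]_d) (ty : {ffun 'I_d * 'I_d -> 'I_n.+1}) := \prod_pq A pq.1 pq.2 ^+ ty pq.
pose e (A : 'M[C]_d) (j : J) := if j.1 then complex.Re (mono A j.2) else complex.Im (mono A j.2).
have [w' [y' [k1 k2 k3 k4]]] := @caratheodory R _ J e _ w y w0 w1.
have Sy' i : S (y' i) by have [j ->] := k3 i; exact: (hy j).1.
have E : \sum_i ((w i)%:C)%C *: x i = \sum_i ((w' i)%:C)%C *: ntensmx (y' i) n.
  apply/matrixP => i j; rewrite !summxE.
  have := k4 (true, ptype i j); have := k4 (false, ptype i j); rewrite /e /= => hi hr.
  apply/eqP; rewrite eq_complex !Re_sum !Im_sum.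
  apply/andP; split; apply/eqP; symmetry; [move: hr|move: hi] => hh; (etransitivity; [|etransitivity; [exact: hh|]]); apply: eq_bigr => l _.
  - by rewrite mxE ReZ ntensE ptens_ptype.
  - by rewrite mxE ReZ -(hy l).2 ntensE ptens_ptype.
  - by rewrite mxE ImZ ntensE ptens_ptype.
  - by rewrite mxE ImZ -(hy l).2 ntensE ptens_ptype.
have [i hi] := @relent_mix_component R _ _ w' (fun i => ntensmx (y' i) n) sg k1 k2 (fun i => density_ntens n (dS _ (Sy' i))) psg.
exists (ntensmx (y' i) n); first by exists (y' i).
have cJ : #|J| = (2 * ntypes d n)%N by rewrite card_prod card_bool card_types.
by rewrite E -cJ.
Qed.

End IidMixtures.

(** * Minimum formulas for i.i.d. alternatives *)

Section FirstClaims.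
Variables (R : realType) (d : nat).
Local Notation C := (R[i]).
Variables (A1 B1 : set 'M[C]_d).
Hypotheses (A0 : A1 !=set0) (B0 : B1 !=set0) (cA : cmx_closed A1) (cB : cmx_closed B1).
Hypotheses (dA : A1 `<=` @density R d) (dB : B1 `<=` @density R d).

Lemma prodset_iid (S : set 'M[C]_d) : prodset (Fiid S) = iidset S.
Proof. by apply: functional_extensionality_dep => m; rewrite iidset_prodset. Qed.

Lemma Fiid_density (S : set 'M[C]_d) f i : S `<=` @density R d -> Fiid S f -> density (f i).
Proof. by move=> dS [A SA ->]; exact: dS. Qed.

Lemma Fiid_nonempty (S : set 'M[C]_d) : S !=set0 -> Fiid S !=set0.
Proof. by move=> [s Ss]; exists (fun=> s); exists s. Qed.

Lemma minstar_iid :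
   minstar (@probOn R d B1)
     (fun mu n => ((n%:R)^-1)%:E *
        ereal_inf [set relent (ntensmx rho n) (mixture B1 mu n) | rho in A1])%E
     (Stein (iidset A1) (iidset B1)).
Proof.
have := @minstar_mixture R d B1 B0 dB (compact_states cB dB) (Fiid A1)
  (fun f i => @Fiid_density A1 f i dA) (@Fiid_shift R d A1) (cparam_iid (compact_states cA dA)) (Fiid_nonempty A0)
  (iidset A1) _ _ (@subexp_ntypes2 R d).
rewrite prodset_iid => /(_ (fun n => @sub_co R _ _)) /(_ (fun n rho sg => @iid_component R d A1 n rho sg dA)).
rewrite (_ : (fun mu n => _) = (fun mu n => ((n%:R)^-1)%:E *
        ereal_inf [set relent (ntensmx rho n) (mixture B1 mu n) | rho in A1])%E)//.
by apply/funext => mu; apply/funext => n; rewrite /iidset image_comp.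
Qed.

Lemma minstar_av :
   minstar (@probOn R d B1)
     (fun mu n => ((n%:R)^-1)%:E *
        ereal_inf [set relent rhon (mixture B1 mu n) | rhon in co (avset A1 n)])%E
     (Stein (avset A1) (iidset B1)).
Proof.
have [a Aa] := A0.
apply: (@minstar_mixture R d B1 B0 dB (compact_states cB dB) (Fav A1)
  (fun f i (Ff : Fav A1 f) => dA (Ff i)) (@Fav_shift R d A1) (cparam_av (compact_states cA dA)) _
  (fun n => co (avset A1 n)) _ _ (@subexp_const R 0)) => //.
- by exists (fun=> a).
- by move=> n; exact: subset_refl.
by move=> n rho sg cr _; exists rho => //; rewrite adde0.
Qed.

Lemma continuous_retr_mul (T : topologicalType) N (F : T -> 'M[C]_N) (X : 'M[C]_N) :
  (forall i j, continuous (fun x => complex.Re (F x i j))) -> (forall i j, continuous (fun x => complex.Im (F x i j))) ->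
  continuous (fun x => retr (F x *m X)).
Proof.
move=> h1 h2; rewrite (_ : (fun x => _) = (fun x => \sum_i \sum_j (complex.Re (F x i j) * complex.Re (X j i) - complex.Im (F x i j) * complex.Im (X j i)))).
  apply: continuous_sumr => i; apply: continuous_sumr => j x.
  by apply: cvgB; (apply: cvgM; last exact: cvg_cst); [exact: h1|exact: h2].
by apply/funext => x; rewrite retr_mulE.
Qed.

Lemma continuous_block m (X : finType) (M : X -> 'M[C]_(d ^ m)) (c : X -> R) :
  continuous (fun z : 'M[R]_d * 'M[R]_d => \sum_x c x * retr (ptens (fun=> cmx_of z) m *m M x)).
Proof.
have ent i j : continuous (fun z : 'M[R]_d * 'M[R]_d => complex.Re (ptens (fun=> cmx_of z) m i j)) /\
    continuous (fun z : 'M[R]_d * 'M[R]_d => complex.Im (ptens (fun=> cmx_of z) m i j)).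
  have [|| h1 h2] := @continuous_prodc R ('M[R]_d * 'M[R]_d)%type m (fun k z => cmx_of z (dig i k) (dig j k)).
  - move=> k; rewrite (_ : (fun x => _) = (fun z : 'M[R]_d * 'M[R]_d => z.1 (dig i k) (dig j k))); first exact: continuous_coord1.
    by apply/funext => z; rewrite mxE.
  - move=> k; rewrite (_ : (fun x => _) = (fun z : 'M[R]_d * 'M[R]_d => z.2 (dig i k) (dig j k))); first exact: continuous_coord2.
    by apply/funext => z; rewrite mxE.
  split.
    by rewrite (_ : (fun x => _) = (fun z : 'M[R]_d * 'M[R]_d => complex.Re (\prod_k cmx_of z (dig i k) (dig j k))))//; apply/funext => z; rewrite ptensE.
  by rewrite (_ : (fun x => _) = (fun z : 'M[R]_d * 'M[R]_d => complex.Im (\prod_k cmx_of z (dig i k) (dig j k))))//; apply/funext => z; rewrite ptensE.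
apply: continuous_sumr => x z; apply: cvgM; first exact: cvg_cst.
by apply: (@continuous_retr_mul _ _ (fun z => ptens (fun=> cmx_of z) m)) => i j; have [] := ent i j.
Qed.

(** The block length m is fixed before n grows: the mean score on m copies is continuous in the
    state, while the exponent of a single state has no evident continuity. *)
Lemma iid_worst_state (s : R) : Stein (iidset A1) (iidset B1) = s%:E ->
  exists2 rho, A1 rho & (Stein (iidset [set rho]) (iidset B1) <= s%:E)%E.
Proof.
(* The arithmetic of the constants, stated on bare reals. *)
have aux1 (a b c e : R) : b <= a * e -> 0 < a * e -> a * (c + 2 * e) + b < a * (c + 4 * e) by lra.
have aux2 (a b c e : R) : 0 < a * e -> b <= a * (e / 4) -> a * (c + e / 2) <= a * c + b -> False by lra.
have aux3 (a b : R) : 0 < b -> (a + b / 2) < (a + b) by lra.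
have aux4 (a b : R) : 0 < b -> a + b < a + 2 * b by lra.
move=> hs; have cS := compact_states cB dB.
have [rho_ [sg [hr [hg [u su hu]]]]] := @family_minimizers R d B1 B0 dB cS (Fiid A1)
  (fun f i => @Fiid_density A1 f i dA) (@Fiid_shift R d A1) (cparam_iid (compact_states cA dA)) (Fiid_nonempty A0)
  (iidset A1) _ (@subexp_ntypes2 R d) (fun n rho sg => ltac:(rewrite prodset_iid; exact: (@iid_component R d A1 n rho sg dA))) s (ltac:(by rewrite prodset_iid)).
have [r_ hr_] := choice (fun n => let: ex_intro2 a b c := hr n in ex_intro (fun a => A1 a /\ ntensmx a n = rho_ n) a (conj b c)).
have FF : ProperFilter ((fun n => mxcoord (r_ n)) @ \oo) by exact: fmap_proper_filter.
have FA : ((fun n => mxcoord (r_ n)) @ \oo) (@mxcoord R d @` A1).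
  by exists 0%N => // n _; exists (r_ n) => //; exact: (hr_ n).1.
have [z [[rho Arho <-] clz]] := compact_states cA dA FF FA.
exists rho => //; rewrite leNgt; apply/negP => lt.
have [v sv vS] : exists2 v, s < v & (v%:E < Stein (iidset [set rho]) (iidset B1))%E.
  case: (Stein (iidset [set rho]) (iidset B1)) lt => [x| |]//.
    by rewrite lte_fin => rs; exists ((s + x) / 2); rewrite ?lte_fin; lra.
  by move=> _; exists (s + 1); rewrite ?ltry//; lra.
have d1 : [set rho] `<=` @density R d by move=> _ ->; exact: dA.
have dn n : iidset [set rho] n `<=` @density R _ by exact: iid_density.
have [N1 h1] := Stein_converse dn vS.
(* Levels between s and v = s + 4 del: the measurement certifies s + 2 del at rho and s + del
   nearby; the converse there is used at s + del / 2, against minimizers of rate at most s + del /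
   4. *)
pose del := (v - s) / 4; have del0 : 0 < del by rewrite divr_gt0// subr_gt0.
have vE : v = s + 4 * del by rewrite /del; lra.
clearbody del.
have [N2 h2] := @subexp_ntypes R d del del0.
pose m := (maxn N1 N2).+1; have mN1 : (N1 <= m)%N by rewrite ltnW// ltnS leq_maxl.
have mN2 : (N2 <= m)%N by rewrite ltnW// ltnS leq_maxr.
have mN0 : (0 < m)%N by [].
clearbody m.
have m0 : 0 < m%:R :> R by rewrite ltr0n.
have k1 : compact (@mxcoord R d @` [set rho]) by rewrite image_set1; exact: compact_set1.
have ne1 : [set rho] !=set0 by exists rho.
have [|X [M [t [p1 p2 p3 p4]]]] := @block_rate R d (Fiid [set rho]) B1 m (m%:R * (s + 2 * del))
   (fun f i => @Fiid_density [set rho] f i d1) (cparam_iid k1) (Fiid_nonempty ne1) dB cS B0.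
  move=> rho' sg'; rewrite prodset_iid => c1 c2.
  have ds : density sg' by apply: (co_density (@iid_density R d B1 dB m) c2).
  apply: lt_le_trans (h1 m mN1 rho' sg' c1 ds (co_test_dominated c2)).
  rewrite -EFinD lte_fin; have := h2 m mN2; rewrite vE => k2.
  by apply: aux1 => //; rewrite mulr_gt0.
pose g (A : 'M[C]_d) := \sum_x ln (t x) * retr (ptens (fun=> A) m *m M x).
(* States on which the same measurement certifies s + del; every r_n close enough to rho lies in
   A2. *)
pose A2 : set 'M[C]_d := [set A | A1 A /\ m%:R * (s + del) <= g A].
have dA2 : A2 `<=` @density R d by move=> A [AA _]; exact: dA.
have lowA2 : ((s + del)%:E <= Stein (iidset A2) (iidset B1))%E.
  have := @Stein_ge_block R d m X M t (m%:R * (s + del)) (Fiid A2) (Fiid B1) mN0 p1 p2 (@Fiid_shift R d A2)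
    (fun f i => @Fiid_density A2 f i dA2) (@Fiid_shift R d B1) (fun f i => @Fiid_density B1 f i dB).
  have -> : m%:R * (s + del) / m%:R = s + del by rewrite mulrC mulKf// gt_eqF.
  rewrite (prodset_iid A2) (prodset_iid B1); apply => //.
  by move=> _ [A [_ hA] ->].
have lt3 : ((s + del / 2)%:E < (s + del)%:E)%E by rewrite lte_fin; exact: aux3.
have [N3 h3] := @Stein_converse R d (iidset A2) (iidset B1) (s + del / 2) (@iid_density R d A2 dA2)
  (lt_le_trans lt3 lowA2).
have d4 : 0 < del / 4 by rewrite divr_gt0.
have [N4 h4] := su (del / 4) d4.
pose N := (maxn N3 N4).+1.
have nbU : nbhs (mxcoord rho) [set z | m%:R * (s + del) < g (cmx_of z)].
  have cg := @continuous_block m X M (fun x => ln (t x)) (mxcoord rho).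
  have : m%:R * (s + del) < g (cmx_of (mxcoord rho)).
    rewrite mxcoordK; apply: lt_le_trans (p3 (fun=> rho) (ex_intro2 _ _ rho erefl erefl)).
    by rewrite ltr_pM2l//; exact: aux4.
  by move=> lt1; exact: (cvgr_gt _ cg _ lt1).
have FN : ((fun n => mxcoord (r_ n)) @ \oo) [set mxcoord (r_ n) | n in [set n | (N <= n)%N]].
  by exists N => // n /= Nn; exists n.
have [_ [[n Nn <-] hz]] := clz _ _ FN nbU.
rewrite /= mxcoordK in hz.
have Nn' : (N3 <= n)%N /\ (N4 <= n)%N by move: Nn => /= Nn; split; apply: leq_trans (ltnW Nn); rewrite ?leq_maxl ?leq_maxr.
have n0 : (0 < n)%N by apply: leq_trans Nn.
have cr : co (iidset A2 n) (rho_ n).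
  by apply: sub_co; exists (r_ n); [split; [exact: (hr_ n).1|exact: ltW]|exact: (hr_ n).2].
have ds : density (sg n) by apply: (co_density (@iid_density R d B1 dB n)).
have := le_trans (h3 n Nn'.1 _ _ cr ds (co_test_dominated (hg n))) (hu n n0).
rewrite lee_fin; apply: aux2; last exact: h4 n Nn'.2.
by rewrite mulr_gt0// ltr0n.
Qed.

End FirstClaims.

Section IidPair.
Variables (R : realType) (d : nat).
Local Notation C := (R[i]).
Variables (A1 B1 : set 'M[C]_d).
Hypotheses (A0 : A1 !=set0) (B0 : B1 !=set0) (cA : cmx_closed A1) (cB : cmx_closed B1).
Hypotheses (dA : A1 `<=` @density R d) (dB : B1 `<=` @density R d).

(** For the state rho of [iid_worst_state], the measure is the optimal one for the null hypothesis
    {rho}, where the infimum is the relative entropy itself. Lower bounds come from the exponent of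
    the whole A1. *)
Lemma minstar_iid_pair :
   minstar (fun p : 'M[C]_d * probability (BorelMx R d) R => A1 p.1 /\ probOn B1 p.2)
     (fun p n => ((n%:R)^-1)%:E * relent (ntensmx p.1 n) (mixture B1 p.2 n))%E
     (Stein (iidset A1) (iidset B1)).
Proof.
have cS := compact_states cB dB.
have low p (r : R) : A1 p.1 -> probOn B1 p.2 -> (r%:E < Stein (iidset A1) (iidset B1))%E ->
    exists N, forall n, (N <= n)%N -> (r%:E <= ((n%:R)^-1)%:E * relent (ntensmx p.1 n) (mixture B1 p.2 n))%E.
  move=> Ap pm; rewrite -prodset_iid => rs.
  have [N h] := @mixture_lower R d B1 dB cS (Fiid A1) (fun f i => @Fiid_density R d A1 f i dA) p.2 r pm rs.
  by exists N => n /h; apply; rewrite prodset_iid; apply: sub_co; exists p.1.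
have fin : (0 <= Stein (iidset A1) (iidset B1))%E by rewrite -[iidset A1]prodset_iid; exact: Stein_ge0.
suff [p [Ap pm cp]] : exists p : 'M[C]_d * probability (BorelMx R d) R, [/\ A1 p.1, probOn B1 p.2 &
    (((n%:R)^-1)%:E * relent (ntensmx p.1 n) (mixture B1 p.2 n))%E @[n --> \oo] --> Stein (iidset A1) (iidset B1)].
  exists p; split=> // q l [Aq pq] cl; apply: le_of_lt_real => r rs.
  by apply: (cvge_eventually_le cl); exact: low.
have [a Aa] := A0.
have [sfin|] := boolP (Stein (iidset A1) (iidset B1) \is a fin_num); last first.
  rewrite ge0_fin_numE// ltey negbK => /eqP sy.
  have [mu [pm _ _]] := minstar_iid A0 B0 cA cB dA dB.
  exists (a, mu); split; [exact: Aa|exact: pm|].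
  apply: (cvge_of_bounds fin); first by move=> r; exact: (@low (a, mu) r Aa pm).
  by move=> r; rewrite sy.
have [rho Arho le] := iid_worst_state A0 B0 cA cB dA dB (esym (fineK sfin)).
have d1 : [set rho] `<=` @density R d by move=> _ ->; exact: dA.
have c1 : cmx_closed [set rho] by rewrite /cmx_closed image_set1; apply: compact_closed; [exact: norm_hausdorff|exact: compact_set1].
have [mu [pm cmu _]] := minstar_iid (ex_intro _ rho erefl : [set rho] !=set0) B0 c1 cB d1 dB.
exists (rho, mu); split; [exact: Arho|exact: pm|].
apply: (cvge_of_bounds fin); first by move=> r; exact: (@low (rho, mu) r Arho pm).
move=> r sr; have lr : (Stein (iidset [set rho]) (iidset B1) < r%:E)%E by apply: le_lt_trans sr; rewrite -(fineK sfin).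
have [N _ hN] : \forall n \near \oo, (((n%:R)^-1)%:E * ereal_inf [set relent (ntensmx rho0 n) (mixture B1 mu n) | rho0 in [set rho]] < r%:E)%E.
  apply: (cmu [set x | (x < r%:E)%E]); apply: open_nbhs_nbhs; split=> //; exact: open_ereal_lt_ereal.
by exists N => n Nn; have := hN n Nn; rewrite image_set1 ereal_inf1 => /ltW.
Qed.

End IidPair.

(** * Arbitrarily varying alternatives *)

Section SymmetricExpectation.
Variables (R : realType) (T : finType) (w : T -> R).
Hypothesis w0 : forall k, 0 <= w k.

(** Sum over words s of length n of X(s) times the product of the w(s_i), unfolded letter by letter
    as [ptensS] unfolds tensor powers. *)
Fixpoint expect n (X : seq T -> R) : R :=
  if n is n'.+1 then \sum_k w k * expect n' (fun s => X (k :: s)) else X [::].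

Lemma expectS n X : expect n.+1 X = \sum_k w k * expect n (fun s => X (k :: s)).
Proof. by []. Qed.

Lemma expect_ge0 n X : (forall s, size s = n -> 0 <= X s) -> 0 <= expect n X.
Proof.
elim: n X => [|n IH] X h /=; first exact: h.
by apply: sumr_ge0 => k _; apply: mulr_ge0 => //; apply: IH => s hs; apply: h; rewrite /= hs.
Qed.

Lemma sum_count_mem (s : seq T) : (\sum_k count_mem k s = size s)%N.
Proof.
elim: s => [|x s IH] /=; first by rewrite big1.
by rewrite big_split /= IH (bigD1 x)//= eqxx big1 ?addn0 ?add1n// => k; rewrite eq_sym => /negbTE->.
Qed.

(** Only the rearrangements of s are kept: n! / prod c_k! words, each of weight prod w_k^(c_k). The
    induction writes the length as the sum of the letter counts and lets the first letter range over
    its possible values. *)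
Lemma expect_ge n X s : (forall s, size s = n -> 0 <= X s) ->
  (forall s s', size s = n -> perm_eq s s' -> X s = X s') -> size s = n ->
  n`!%:R * \prod_k (w k ^+ count_mem k s / (count_mem k s)`!%:R) * X s <= expect n X.
Proof.
elim: n X s => [|n IH] X s X0 Xs hs.
  by rewrite (size0nil hs) /= big1 ?mulr1 ?mul1r// => k _; rewrite divr1.
set P := \prod_k _.
have -> : (n.+1)`!%:R * P * X s = \sum_k (count_mem k s)%:R * (n`!%:R * P * X s).
  by rewrite -mulr_suml -natr_sum sum_count_mem hs factS natrM !mulrA.
apply: ler_sum => k _.
have [ks|ks] := boolP (k \in s); last first.
  rewrite (count_memPn ks) mul0r mulr_ge0//; apply: expect_ge0 => t ht.
  by apply: X0; rewrite /= ht.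
have pk : perm_eq s (k :: rem k s) by exact: perm_to_rem.
have sr : size (rem k s) = n by have := perm_size pk; rewrite hs /= => -[].
have := IH (fun t => X (k :: t)) (rem k s) _ _ sr.
rewrite -(Xs s _ hs pk) => H.
apply: le_trans (ler_wpM2l (w0 k) (H _ _)); last 2 first.
- by move=> t ht; apply: X0; rewrite /= ht.
- by move=> t t' ht tt'; apply: Xs; rewrite /= ?ht ?perm_cons.
rewrite le_eqVlt; apply/orP; left; apply/eqP.
have cE l : count_mem l s = ((k == l) + count_mem l (rem k s))%N by rewrite (permP pk).
rewrite /P (bigD1 k)//= [in RHS](bigD1 k)//=.
have -> : \prod_(i | i != k) (w i ^+ count_mem i s / (count_mem i s)`!%:R) =
          \prod_(i | i != k) (w i ^+ count_mem i (rem k s) / (count_mem i (rem k s))`!%:R).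
  by apply: eq_bigr => i ik; rewrite cE eq_sym (negbTE ik).
rewrite (cE k) eqxx add1n factS natrM exprS.
have c0 : (count_mem k (rem k s)).+1%:R != 0 :> R by [].
have f0 : (count_mem k (rem k s))`!%:R != 0 :> R by rewrite pnatr_eq0 -lt0n fact_gt0.
move: c0 f0; move: (_.+1%:R : R) (_`!%:R : R) (w k ^+ _) (\prod_(_ | _) _) => a b c e a0 b0.
by field; rewrite a0 b0.
Qed.

End SymmetricExpectation.

Section ExpectTensor.
Variables (R : realType) (d : nat) (T : finType) (w : T -> R) (tau : T -> 'M[R[i]]_d) (k0 : T).

Lemma expect_ptens n (L : 'M[R[i]]_(d ^ n) -> R) :
  (forall A B, L (A + B) = L A + L B) -> (forall a A, L ((a%:C)%C *: A) = a * L A) ->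
  L (ptens (fun=> \sum_k ((w k)%:C)%C *: tau k) n) = expect w n (fun s => L (ptens (fun i => tau (nth k0 s i)) n)).
Proof.
elim: n L => [|n IH] L LD LZ; first by [].
have L0 : L 0 = 0 by have := LZ 0 0; rewrite scaler0 mul0r.
rewrite ptensS expectS /btens tensb_suml (big_morph L LD L0); apply: eq_bigr => k _.
rewrite tensbZl LZ -/(btens (m := 1) _ _); congr (_ * _).
rewrite (IH (fun Y => L (btens (m := 1) (tau k : 'M[R[i]]_(d ^ 1)) Y))).
- by congr expect; apply/funext => s; rewrite [in RHS]ptensS.
- by move=> A B; rewrite -LD; congr L; apply/matrixP => i j; rewrite !mxE mulrDr.
- by move=> a A; rewrite /btens tensbZr LZ.
Qed.

End ExpectTensor.

(** * Stirling-type estimates *)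

Section Factorial.
Variable R : realType.

Lemma expR_nat1 (c : nat) : (c.+1%:R ^+ c : R) <= expR 1 * c%:R ^+ c.
Proof.
case: c => [|c]; first by rewrite !expr0 mulr1 -expR0 ler_expR.
have c0 : 0 < c.+1%:R :> R by [].
rewrite -ler_pdivrMr ?exprn_gt0// -expr_div_n.
have -> : c.+2%:R / c.+1%:R = 1 + (c.+1%:R)^-1 :> R by rewrite -natr1 mulrDl divff ?gt_eqF// mul1r.
apply: (@le_trans _ _ (expR (c.+1%:R^-1) ^+ c.+1)).
  by rewrite lerXn2r ?nnegrE ?expR_ge0 ?addr_ge0 ?invr_ge0//; exact: expR_ge1Dx.
by rewrite -expRM_natl mulfV ?gt_eqF.
Qed.

Lemma expR_nat2 (c : nat) : expR 1 * c%:R ^+ c.+1 <= (c.+1%:R ^+ c.+1 : R).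
Proof.
have c0 : 0 < c.+1%:R :> R by [].
have h : c%:R / c.+1%:R <= expR (- (c.+1%:R^-1)) :> R.
  have -> : c%:R / c.+1%:R = 1 - (c.+1%:R)^-1 :> R.
    by rewrite -[in X in X / _ = _](addrK 1 c%:R) natr1 mulrBl divff ?gt_eqF// mul1r.
  exact: expR_ge1Dx.
rewrite mulrC -ler_pdivlMr ?expR_gt0// -expRN.
have : (c%:R / c.+1%:R) ^+ c.+1 <= expR (- 1) :> R.
  have -> : expR (-1) = expR (- (c.+1%:R^-1)) ^+ c.+1 :> R by rewrite -expRM_natl mulrN mulfV ?gt_eqF.
  by rewrite lerXn2r ?nnegrE ?expR_ge0 ?divr_ge0.
by rewrite expr_div_n ler_pdivrMr ?exprn_gt0// mulrC.
Qed.

Lemma fact_le_expR (c : nat) : c%:R ^+ c <= expR c%:R * c`!%:R :> R.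
Proof.
elim: c => [|c IH]; first by rewrite expR0 mulr1.
rewrite exprS factS natrM mulrCA ler_wpM2l//.
apply: (le_trans (expR_nat1 c)); rewrite -natr1 addrC expRD -mulrA ler_wpM2l// expR_ge0.
Qed.

Lemma expR_le_fact (c : nat) : expR c%:R * c`!%:R <= expR 1 * c.+1%:R * c%:R ^+ c :> R.
Proof.
have h n : expR n.+1%:R * (n.+1)`!%:R <= expR 1 * n.+1%:R * n.+1%:R ^+ n.+1 :> R.
  elim: n => [|n IH]; first by rewrite (_ : 1`! = 1%N)// !mulr1.
  rewrite factS natrM -natr1 addrC expRD.
  have := expR_nat2 n.+1.
  have n2 : 0 <= n.+2%:R :> R by [].
  have e0 : 0 <= expR 1 :> R by exact: expR_ge0.
  have s1 := ler_wpM2l (mulr_ge0 e0 n2) IH => s2.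
  have s3 := ler_wpM2l (mulr_ge0 e0 n2) s2.
  have -> : 1 + n.+1%:R = n.+2%:R :> R by rewrite addrC natr1.
  have -> : expR 1 * expR n.+1%:R * (n.+2%:R * (n.+1)`!%:R) = expR 1 * n.+2%:R * (expR n.+1%:R * (n.+1)`!%:R) :> R by rewrite mulrACA.
  by apply: (le_trans s1); apply: le_trans s3; rewrite (exprS _ n.+1) !mulrA.
case: c => [|c]; first by rewrite expR0 !mulr1 -expR0 ler_expR.
apply: (le_trans (h c)); rewrite ler_wpM2r ?exprn_ge0// ler_wpM2l ?expR_ge0//.
by rewrite ler_nat.
Qed.

(** Crude Stirling bounds c^c <= e^c c! <= e (c + 1) c^c, with 0^0 = 1, applied to n and to every c
    k. In probabilistic terms, a type class is not exponentially rare under its own empirical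
    distribution. *)
Lemma multinomial_mode (T : finType) (c : T -> nat) n : (\sum_k c k)%N = n ->
  (expR 1 * n.+1%:R) ^- #|T| <= n`!%:R * \prod_k (((c k)%:R / n%:R) ^+ c k / (c k)`!%:R) :> R.
Proof.
move=> cn.
have cle k : (c k <= n)%N by rewrite -cn (bigD1 k)//= leq_addr.
have E : \prod_k (((c k)%:R / n%:R) ^+ c k / (c k)`!%:R) = (\prod_k ((c k)%:R ^+ c k / (c k)`!%:R)) / n%:R ^+ n :> R.
  rewrite -[in RHS]cn -prodrXr -prodfV -big_split /=; apply: eq_bigr => k _.
  by rewrite expr_div_n mulrAC cn.
rewrite E.
have fp m : 0 < m`!%:R :> R by rewrite ltr0n fact_gt0.
have b k : expR (c k)%:R / (expR 1 * n.+1%:R) <= (c k)%:R ^+ c k / (c k)`!%:R :> R.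
  rewrite ler_pdivrMr ?mulr_gt0 ?expR_gt0// mulrAC ler_pdivlMr//.
  apply: (le_trans (expR_le_fact (c k))); rewrite mulrC ler_wpM2l ?exprn_ge0//.
  by apply: ler_wpM2l; [exact: expR_ge0|rewrite ler_nat ltnS cle].
have B : expR n%:R * (expR 1 * n.+1%:R) ^- #|T| <= \prod_k ((c k)%:R ^+ c k / (c k)`!%:R) :> R.
  rewrite -{1}cn natr_sum expR_sum -prodr_const -prodfV -big_split /=.
  by apply: ler_prod => k _; rewrite b divr_ge0 ?expR_ge0// mulr_ge0 ?expR_ge0.
case: n cn cle E b B => [|n] cn cle E b B.
  by rewrite expr0 divr1 mul1r; apply: le_trans B; rewrite expR0 mul1r.
have nn : 0 < n.+1%:R ^+ n.+1 :> R by rewrite exprn_gt0.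
rewrite mulrA ler_pdivlMr// mulrC.
apply: (@le_trans _ _ (expR n.+1%:R * n.+1`!%:R * (expR 1 * n.+2%:R) ^- #|T|)).
  by rewrite ler_wpM2r ?fact_le_expR// invr_ge0 exprn_ge0// mulr_ge0 ?expR_ge0.
by rewrite mulrAC mulrC ler_wpM2l// ltW.
Qed.

End Factorial.

From mathcomp Require Import fingroup perm.

(** * Symmetrisation of tests *)

Section PermutedTests.
Variables (R : realType) (d : nat).
Local Notation C := (R[i]).
Implicit Types f : nat -> 'M[C]_d.

Definition pidx n (s : 'S_n) (i : 'I_(d ^ n)) : 'I_(d ^ n) := undig [ffun k => dig i (s k)].

Lemma dig_pidx n (s : 'S_n) i k : dig (pidx s i) k = dig i (s k).
Proof. by rewrite /pidx undigK ffunE. Qed.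

Lemma pidx_inj n (s : 'S_n) : injective (pidx s).
Proof.
move=> i j h; apply: (can_inj (@digK d n)); apply/ffunP => k.
by rewrite -(permKV s k) -!dig_pidx h.
Qed.

(** Conjugation of E by a permutation of the n tensor factors, written entrywise. *)
Definition permtest n (E : 'M[C]_(d ^ n)) (s : 'S_n) : 'M[C]_(d ^ n) :=
  \matrix_(i, j) E (pidx s i) (pidx s j).

(** Acts on the first n terms and fixes the tail, so that invariance can be demanded of a family of
    infinite sequences. *)
Definition fperm n (s : 'S_n) f : nat -> 'M[C]_d :=
  fun k => if insub k is Some u then f (s (u : 'I_n)) else f k.

Lemma fperm_ord n (s : 'S_n) f (u : 'I_n) : fperm s f u = f (s u).
Proof. by rewrite /fperm valK. Qed.

Lemma fpermM n (s t : 'S_n) f k : fperm s (fperm t f) k = fperm (s * t)%g f k.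
Proof.
rewrite /fperm; case: insubP => [u hu uk|hk]; last by [].
by rewrite valK permM.
Qed.

Lemma retr_permtest n f (E : 'M[C]_(d ^ n)) (s : 'S_n) :
  retr (ptens f n *m permtest E s) = retr (ptens (fperm s f) n *m E).
Proof.
rewrite !retr_mulE [RHS](reindex_inj (@pidx_inj n s)); apply: eq_bigr => i _.
rewrite [RHS](reindex_inj (@pidx_inj n s)); apply: eq_bigr => j _; rewrite mxE.
suff -> : ptens (fperm s f) n (pidx s i) (pidx s j) = ptens f n i j by [].
rewrite !ptensE [RHS](reindex_inj (@perm_inj _ s)); apply: eq_bigr => k _.
by rewrite !dig_pidx fperm_ord.
Qed.

Lemma psd_permtest n (E : 'M[C]_(d ^ n)) s : psd E -> psd (permtest E s).
Proof.
move=> /psd_factor[G ->].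
rewrite (_ : permtest _ s = adjmx (\matrix_(k, i) G k (pidx s i)) *m (\matrix_(k, i) G k (pidx s i))).
  exact: psd_gram.
apply/matrixP => i j; rewrite !mxE; apply: eq_bigr => k _.
by rewrite !mxE.
Qed.

Lemma permtest_compl n (E : 'M[C]_(d ^ n)) s : permtest (1%:M - E) s = 1%:M - permtest E s.
Proof. by apply/matrixP => i j; rewrite !mxE (inj_eq (@pidx_inj n s)). Qed.

Definition symtest n (E : 'M[C]_(d ^ n)) : 'M[C]_(d ^ n) :=
  (((n`!%:R)^-1 : R)%:C)%C *: \sum_s permtest E s.

Lemma card_perm_nat n : #|{perm 'I_n}| = n`!.
Proof. exact: card_Sn. Qed.

Lemma fact_neq0 n : n`!%:R != 0 :> R.
Proof. by rewrite pnatr_eq0 -lt0n fact_gt0. Qed.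

Lemma symtest_compl n (E : 'M[C]_(d ^ n)) : 1%:M - symtest E = symtest (1%:M - E).
Proof.
rewrite /symtest (eq_bigr _ (fun s _ => permtest_compl E s)) sumrB scalerBr sumr_const card_perm_nat.
by rewrite -[1%:M *+ _]scaler_nat scalerA -(rmorph_nat (real_complex R)) -rmorphM mulVf ?fact_neq0// rmorph1 scale1r.
Qed.

Lemma psd_symtest n (E : 'M[C]_(d ^ n)) : psd E -> psd (symtest E).
Proof. by move=> pE; apply: psdZ; [rewrite invr_ge0|apply: psd_sum => s _; exact: psd_permtest]. Qed.

Lemma retr_symtest n f (E : 'M[C]_(d ^ n)) :
  retr (ptens f n *m symtest E) = (n`!%:R)^-1 * \sum_(s : 'S_n) retr (ptens (fperm s f) n *m E).
Proof.
rewrite /symtest -scalemxAr retrZ mulmx_sumr retr_sum; congr (_ * _).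
by apply: eq_bigr => s _; exact: retr_permtest.
Qed.

Lemma retr_symtest_le n f (E : 'M[C]_(d ^ n)) b :
  (forall s : 'S_n, retr (ptens (fperm s f) n *m E) <= b) -> retr (ptens f n *m symtest E) <= b.
Proof.
move=> h; rewrite retr_symtest mulrC ler_pdivrMr ?ltr0n ?fact_gt0//.
rewrite -card_perm_nat mulr_natr -sumr_const; exact: ler_sum.
Qed.

Lemma retr_symtest_perm n f (E : 'M[C]_(d ^ n)) (t : 'S_n) :
  retr (ptens (fperm t f) n *m symtest E) = retr (ptens f n *m symtest E).
Proof.
rewrite !retr_symtest; congr (_ * _); rewrite [RHS](reindex_inj (mulIg t)).
by apply: eq_bigr => s _; congr (retr (_ *m E)); apply: eq_ptens => k _; exact: fpermM.
Qed.

(** A symmetrised test sees only the multiset of factors; this is the invariance asked for by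
    [expect_ge]. *)
Lemma retr_symtest_perm_eq n (T : eqType) (tau : T -> 'M[C]_d) (k0 : T) (E : 'M[C]_(d ^ n)) s s' :
  size s = n -> perm_eq s s' ->
  retr (ptens (fun i => tau (nth k0 s i)) n *m symtest E) = retr (ptens (fun i => tau (nth k0 s' i)) n *m symtest E).
Proof.
move=> hs pp; have sz : size s' == n by rewrite -(perm_size pp) hs.
have /tuple_permP[p hp] : perm_eq s (Tuple sz) by [].
rewrite -(retr_symtest_perm (fun i => tau (nth k0 s' i)) E p); congr (retr (_ *m _)).
apply: eq_ptens => k kn; rewrite -[k]/(val (Ordinal kn)) fperm_ord hp.
by rewrite -(tnth_nth _ _ (Ordinal kn)) tnth_mktuple (tnth_nth k0).
Qed.

End PermutedTests.

Section ConvexHull.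
Variables (R : realType) (m : nat).
Local Notation C := (R[i]).
Variable S : set 'M[C]_m.

Lemma co_fin (I : finType) (w : I -> R) (x : I -> 'M[C]_m) : (forall i, 0 <= w i) -> \sum_i w i = 1 ->
  (forall i, S (x i)) -> co S (\sum_i ((w i)%:C)%C *: x i).
Proof.
have sumE (V : nmodType) (F : I -> V) : \sum_(i < #|I|) F (enum_val i) = \sum_i F i.
  by rewrite -(@big_enum_val _ _ _ _ (mem I) F).
move=> w0 w1 Sx; exists #|I|, (fun i => w (enum_val i)), (fun i => x (enum_val i)); split=> //.
  by rewrite (sumE _ w).
by rewrite (sumE _ (fun i => ((w i)%:C)%C *: x i)).
Qed.

Lemma co_convex (I : finType) (w : I -> R) (x : I -> 'M[C]_m) : (forall i, 0 <= w i) -> \sum_i w i = 1 ->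
  (forall i, co S (x i)) -> co S (\sum_i ((w i)%:C)%C *: x i).
Proof.
move=> w0 w1 Sx.
have F i : {k : nat & {u : 'I_k -> R & {y : 'I_k -> 'M[C]_m |
    [/\ forall j, 0 <= u j, \sum_j u j = 1, forall j, S (y j) & x i = \sum_j ((u j)%:C)%C *: y j]}}}.
  by have /cid[k /cid[u /cid[y h]]] := Sx i; exists k, u, y.
pose K i := projT1 (F i); pose u i : 'I_(K i) -> R := projT1 (projT2 (F i)).
pose y i : 'I_(K i) -> 'M[C]_m := proj1_sig (projT2 (projT2 (F i))).
have h i : [/\ forall j, 0 <= u i j, \sum_j u i j = 1, forall j, S (y i j) & x i = \sum_j ((u i j)%:C)%C *: y i j].
  exact: proj2_sig (projT2 (projT2 (F i))).
pose J : finType := {i : I & 'I_(K i)}.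
have -> : \sum_i ((w i)%:C)%C *: x i = \sum_(p : J) ((w (tag p) * u (tag p) (tagged p))%:C)%C *: y (tag p) (tagged p).
  transitivity (\sum_i \sum_j ((w i * u i j)%:C)%C *: y i j).
    apply: eq_bigr => i _; have [_ _ _ ->] := h i; rewrite scaler_sumr; apply: eq_bigr => j _.
    by rewrite scalerA -rmorphM.
  by rewrite (sig_big_dep _ _ (fun i j => ((w i * u i j)%:C)%C *: y i j)).
apply: co_fin.
- by move=> p; apply: mulr_ge0 => //; have [] := h (tag p).
- rewrite -w1 -(sig_big_dep xpredT (fun _ => xpredT) (fun i j => w i * u i j)); apply: eq_bigr => i _.
  by rewrite -mulr_sumr; have [_ -> _ _] := h i; rewrite mulr1.
- by move=> p; have [] := h (tag p).
Qed.

End ConvexHull.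

(** * Finite nets for the operator order *)

Section FiniteNet.
Variables (R : realType) (d : nat).
Local Notation C := (R[i]).
Variable S : set 'M[C]_d.
Hypotheses (S0 : S !=set0) (dS : S `<=` @density R d).

Let J : finType := (bool * ('I_d * 'I_d))%type.
Let e (A : 'M[C]_d) (j : J) : R := if j.1 then complex.Re (A j.2.1 j.2.2) else complex.Im (A j.2.1 j.2.2).

(** A family in S of maximal real rank spans S; the pseudo-inverse makes the coefficients one fixed
    linear function of the entries, hence bounded on states. *)
Lemma spanning_family : exists k (s : 'I_k.+1 -> 'M[C]_d) (P : 'M[R]_(#|J|, k.+1)), (forall i, S (s i)) /\
  forall A, S A -> A = \sum_i (((\row_j e A (enum_val j)) *m P) 0 i)%:C%C *: s i.
Proof.
pose V k (s : 'I_k -> 'M[C]_d) : 'M[R]_(k, #|J|) := \matrix_(i, j) e (s i) (enum_val j).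
pose Q r := exists k (s : 'I_k.+1 -> 'M[C]_d), (forall i, S (s i)) /\ \rank (V _ s) = r.
have [s0 Ss0] := S0.
have exQ : exists r, `[< Q r >].
  by exists (\rank (V 1%N (fun=> s0))); apply/asboolP; exists 0%N, (fun=> s0).
have bQ r : `[< Q r >] -> (r <= #|J|)%N by move=> /asboolP[k [s [_ <-]]]; exact: rank_leq_col.
case: (ex_maxnP exQ bQ) => r /asboolP[k [s [Ss rk]]] mx.
exists k, s, (pinvmx (V _ s)); split=> // A SA.
set vA := \row_j _.
have sp : (vA <= V _ s)%MS.
  pose s' (i : 'I_(k.+1 + 1)) := match fintype.split i with inl i => s i | inr _ => A end.
  have Vs' : V _ s' = col_mx (V _ s) vA.
    apply/matrixP => i j; rewrite !mxE /s'; case: (fintype.split i) => l; by rewrite !mxE.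
  have sub : (V _ s <= col_mx (V _ s) vA)%MS.
    by have := submx_refl (col_mx (V _ s) vA); rewrite col_mx_sub => /andP[].
  have le : (\rank (V _ s') <= r)%N.
    by apply: mx; apply/asboolP; exists (k + 1)%N, s'; split=> // i; rewrite /s'; case: fintype.split.
  have [lr er] := mxrank_leqif_sup sub.
  have : (col_mx (V _ s) vA <= V _ s)%MS by rewrite -er eqn_leq lr /= -Vs' rk.
  by rewrite col_mx_sub => /andP[].
have := mulmxKpV sp; set c := vA *m _ => cV.
have ec j : e A j = \sum_i c 0 i * e (s i) j.
  have := congr1 (fun M : 'rV_#|J| => M 0 (enum_rank j)) cV; rewrite [in X in _ = X -> _]mxE enum_rankK => <-.
  by rewrite mxE; apply: eq_bigr => i _; rewrite [V _ _ _ _]mxE enum_rankK.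
clearbody c; apply/matrixP => a b; rewrite summxE; apply/eqP; rewrite eq_complex Re_sum Im_sum.
have := ec (true, (a, b)); have := ec (false, (a, b)); rewrite /e /= => -> ->.
by apply/andP; split; apply/eqP; apply: eq_bigr => i _; rewrite mxE ?ReZ ?ImZ.
Qed.

Hypothesis cvx : forall (I : finType) (w : I -> R) x, (forall i, 0 <= w i) -> \sum_i w i = 1 ->
  (forall i, S (x i)) -> S (\sum_i ((w i)%:C)%C *: x i).

(** Domination is wanted rather than closeness in norm, and states of S may be singular. Each
    representative is therefore mixed with the barycentre s0 of the spanning family, which absorbs
    small differences of coefficients along every s_i. *)
Lemma finite_net (del : R) : 0 < del -> exists (T : finType) (tau : T -> 'M[C]_d), (forall t, S (tau t)) /\
  forall A, S A -> exists t, psd ((expR del)%:C%C *: tau t - A).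
Proof.
move=> del0; have [k [s [P [Ss hs]]]] := spanning_family.
pose c A i := ((\row_j e A (enum_val j)) *m P) 0 i.
have k0 : k.+1%:R != 0 :> R by [].
have ed : 1 < expR del by rewrite -expR0 ltr_expR.
(* e^del tau = rep + (e^del - 1) s0, and s0 gives each s_i the weight 1 / (k + 1): eta is the margin
   per coefficient. *)
pose eta := (expR del - 1) / k.+1%:R.
have eta0 : 0 < eta by rewrite divr_gt0// subr_gt0.
pose D := \sum_j \sum_i `|P j i|.
have D0 : 0 <= D by apply: sumr_ge0 => j _; apply: sumr_ge0.
have cD A i : S A -> `|c A i| <= D.
  move=> /dS dA; rewrite /c mxE; apply: (le_trans (ler_norm_sum _ _ _)); apply: ler_sum => j _.
  rewrite mxE normrM (bigD1 i)//= -[leLHS]addr0; apply: lerD; last exact: sumr_ge0.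
  rewrite -[leRHS]mul1r ler_wpM2r// /e.
  have [h1 h2] := psd_entry_le (enum_val j).2.1 (enum_val j).2.2 dA.1.
  by case: ifP => _; rewrite -(density_retr dA).
(* Coefficients in [-D, D] are shifted by D and rounded down in steps of eta, so those in one cell
   differ by at most eta. *)
pose L := Num.truncn ((D + D) / eta).
pose cell A : {ffun 'I_k.+1 -> 'I_L.+1} := [ffun i => inord (Num.truncn ((c A i + D) / eta))].
have cell_eq A A' i : S A -> S A' -> cell A = cell A' -> c A' i + eta >= c A i.
  move=> SA SA' /ffunP/(_ i); rewrite !ffunE => /(congr1 val) /=.
  have nn B : S B -> 0 <= (c B i + D) / eta.
    by move=> /cD-/(_ i); rewrite ler_norml => /andP[h _]; apply: divr_ge0; [rewrite -lerBlDr sub0r|exact: ltW].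
  have bb B : S B -> (Num.truncn ((c B i + D) / eta) < L.+1)%N.
    move=> /cD-/(_ i); rewrite ler_norml => /andP[_ h]; rewrite ltnS; apply: le_truncn.
    by rewrite ler_pM2r ?invr_gt0// lerD2r.
  rewrite !inordK ?bb// => E.
  have /andP[h1 _] := truncn_itv (nn _ SA').
  have /andP[_ h2] := truncn_itv (nn _ SA).
  have : (c A i + D) / eta <= (c A' i + D) / eta + 1.
    by apply: (le_trans (ltW h2)); rewrite E -natr1 lerD2r.
  rewrite -[X in _ <= _ + X](divff (lt0r_neq0 eta0)) -mulrDl ler_pM2r ?invr_gt0//.
  by rewrite addrAC lerD2r.
(* For an empty cell the default [s ord0] keeps the representative in S. *)
pose rep t := xget (s ord0) [set A | S A /\ cell A = t].
have Srep t : S (rep t) by rewrite /rep; case: xgetP => [A _ []|_] //.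
pose s0 := \sum_i ((k.+1%:R^-1)%:C)%C *: s i.
have Ss0 : S s0.
  by apply: cvx => //; rewrite sumr_const card_ord -[LHS]mulr_natr mulVf.
pose w (b : bool) := if b then expR (- del) else 1 - expR (- del).
have w0 b : 0 <= w b by case: b; rewrite /w ?expR_ge0// subr_ge0 -expR0 ler_expR oppr_le0 ltW.
pose tau t := \sum_b ((w b)%:C)%C *: (if b then rep t else s0).
exists {ffun 'I_k.+1 -> 'I_L.+1}, tau; split.
  by move=> t; apply: cvx => //; [rewrite big_bool /w /= addrC subrK|case].
move=> A SA; exists (cell A).
have [Sr cr] : S (rep (cell A)) /\ cell (rep (cell A)) = cell A.
  by apply: (xgetPex (s ord0) (P := [set A' | S A' /\ cell A' = cell A])); exists A.
rewrite /tau big_bool /= scalerDr !scalerA -!rmorphM /= mulrBr mulr1 -expRD subrr expR0 scale1r.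
rewrite (hs _ Sr) [X in _ - X](hs _ SA) scaler_sumr -big_split -sumrB /=.
apply: psd_sum => i _; rewrite scalerA -rmorphM -scalerDl -rmorphD -scalerBl -rmorphB.
apply: psdZ; last exact: (dS (Ss i)).1.
by have := cell_eq A _ i SA Sr (esym cr); rewrite subr_ge0.
Qed.

End FiniteNet.

(** * Product states against i.i.d. powers *)

Section DeFinetti.
Variables (R : realType) (d : nat).
Local Notation C := (R[i]).
Variable S : set 'M[C]_d.
Hypothesis dS : S `<=` @density R d.
Hypothesis cvx : forall (I : finType) (w : I -> R) x, (forall i, 0 <= w i) -> \sum_i w i = 1 ->
  (forall i, S (x i)) -> S (\sum_i ((w i)%:C)%C *: x i).

(** The i.i.d. power of the empirical mean of s is expanded over all words. Its value on the
    symmetrised test is at most b, while the rearrangements of s alone contribute an inverse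
    polynomial multiple of the value at s. *)
Lemma type_class_bound n (T : finType) (tau : T -> 'M[C]_d) (k0 : T) (s : seq T) (E : 'M[C]_(d ^ n)) b :
  (0 < n)%N -> size s = n -> (forall t, S (tau t)) -> psd E -> (forall A, S A -> retr (ntensmx A n *m E) <= b) ->
  retr (ptens (fun i => tau (nth k0 s i)) n *m symtest E) <= (expR 1 * n.+1%:R) ^+ #|T| * b.
Proof.
move=> n0 hs St pE hb.
pose w t : R := (count_mem t s)%:R / n%:R.
have w0 t : 0 <= w t by rewrite divr_ge0.
have sc : (\sum_t count_mem t s)%N = n by rewrite sum_count_mem.
have w1 : \sum_t w t = 1.
  by rewrite -mulr_suml -natr_sum sc divff// pnatr_eq0 -lt0n.
pose X (s : seq T) := retr (ptens (fun i => tau (nth k0 s i)) n *m symtest E).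
have pX s' : 0 <= X s'.
  by apply: psd_retr_mul; [apply: psd_ptens => i; exact: (dS (St _)).1|exact: psd_symtest].
have h1 := @expect_ge R T w w0 n X s (fun s' _ => pX s') (fun s1 s2 => @retr_symtest_perm_eq R d n T tau k0 E s1 s2) hs.
have h2 := @multinomial_mode R T (fun t => count_mem t s) n sc.
have h3 : expect w n X <= b.
  rewrite -(@expect_ptens R d T w tau k0 n (fun Y => retr (Y *m symtest E))).
  - apply: retr_symtest_le => p; rewrite (@eq_ptens _ _ _ (fun=> \sum_k (w k)%:C%C *: tau k)).
      by rewrite -ntensE; apply: hb; exact: cvx.
    by move=> i _; rewrite /fperm; case: insub.
  - by move=> A B; rewrite mulmxDl retrD.
  - by move=> a A; rewrite -scalemxAl retrZ.
have K0 : 0 < (expR 1 * n.+1%:R) ^+ #|T| :> R by rewrite exprn_gt0// mulr_gt0 ?expR_gt0.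
rewrite -ler_pdivrMl//; apply: le_trans h3; apply: le_trans h1.
exact: (ler_wpM2r (pX s) h2).
Qed.

(** Each factor is dominated by e^del times a net point, at total cost e^(n del); what remains is a
    word over the net. *)
Lemma product_state_bound n (del : R) (T : finType) (tau : T -> 'M[C]_d) (f : nat -> 'M[C]_d) (E : 'M[C]_(d ^ n)) b :
  (0 < n)%N -> (forall t, S (tau t)) -> (forall A, S A -> exists t, psd ((expR del)%:C%C *: tau t - A)) ->
  (forall i, S (f i)) -> psd E -> (forall A, S A -> retr (ntensmx A n *m E) <= b) ->
  retr (ptens f n *m symtest E) <= expR (n%:R * del) * ((expR 1 * n.+1%:R) ^+ #|T| * b).
Proof.
move=> n0 St net Sf pE hb.
have [j hj] := choice (fun i => net (f i) (Sf i)).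
have := type_class_bound (j 0%N) n0 (size_mkseq j n) St pE hb.
rewrite (@eq_ptens _ _ _ (fun i => tau (j i))); last by move=> i hi; rewrite nth_mkseq.
move=> /(ler_wpM2l (expR_ge0 (n%:R * del))); apply: le_trans.
have := psd_retr_mul (ptens_ler n (fun i => (dS (Sf i)).1) hj) (psd_symtest pE).
rewrite mulmxBl retrB subr_ge0 => /le_trans; apply.
by rewrite (ptensZ (fun=> (expR del)%:C%C)) prodr_const card_ord -scalemxAl -rmorphXn retrZ -expRM_natl.
Qed.

Hypothesis S0 : S !=set0.

(** Averaging over permutations preserves the bound on the first error since FA is invariant. Half
    of del pays for the net, half for the polynomial factor, whose degree is fixed with the net
    before n grows. *)
Lemma Stein_iid_le_av (FA : set (nat -> 'M[C]_d)) :
  (forall n (p : {perm 'I_n}) f, FA f -> FA (fperm p f)) ->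
  (Stein (prodset FA) (iidset S) <= Stein (prodset FA) (avset S))%E.
Proof.
move=> FAp; apply: Stein_ge => e he; apply: (le_trans (Stein_le_eps _ _ he)).
apply: le_of_lt_real => r /stein_eps_test[N hN].
apply/lee_addgt0Pr => del del0; rewrite -leeBlDr// -EFinB.
have d2 : 0 < del / 2 by rewrite divr_gt0.
have [T [tau [St net]]] := finite_net S0 dS cvx d2.
have sub : subexp (fun n => #|T|%:R * (1 + ln n.+1%:R) : R).
  by apply: subexpZ => //; apply: subexpD; [exact: subexp_const|exact: subexp_ln].
have [N2 hN2] := sub _ d2.
apply: stein_eps_ge; exists (maxn N N2).+1 => n nN.
have n0 : (0 < n)%N by exact: leq_trans nN.
have /andP[nN1 nN2] : (N <= n)%N && (N2 <= n)%N by move: (ltnW nN); rewrite geq_max.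
have [E [pE pF h1 h2]] := hN n nN1.
exists (symtest E); split; [exact: psd_symtest|by rewrite symtest_compl; exact: psd_symtest| |].
  move=> _ [f Ff <-]; rewrite symtest_compl; apply: retr_symtest_le => p.
  by apply: h1; exists (fperm p f) => //; exact: FAp.
move=> _ [f Sf <-].
have hb A : S A -> retr (ntensmx A n *m E) <= expR (- (n%:R * r)) by move=> SA; apply: h2; exists A.
apply: (le_trans (product_state_bound n0 St net Sf pE hb)).
have -> : (expR 1 * n.+1%:R) ^+ #|T| = expR (#|T|%:R * (1 + ln n.+1%:R)) :> R.
  by rewrite expRM_natl expRD lnK// posrE.
rewrite -!expRD ler_expR; have := hN2 n nN2; move: (n%:R : R) (_ * (1 + _)) => a b; lra.
Qed.

End DeFinetti.

(** * Comparison of alternatives on tests *)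

Section Dominated.
Variables (R : realType) (d : nat).
Local Notation C := (R[i]).

Lemma Stein_dominated (A B B' : forall n, set 'M[C]_(d ^ n)) :
  (forall n tau, B n tau -> test_dominated (B' n) tau) -> (Stein A B' <= Stein A B)%E.
Proof.
move=> dom; apply: Stein_ge => e he; apply: (le_trans (Stein_le_eps _ _ he)).
apply: le_of_lt_real => r /stein_eps_test[N hN]; apply: stein_eps_ge; exists N => n /hN[E [pE pF h1 h2]].
by exists E; split=> // tau Bt; exact: dom Bt _ _ h2.
Qed.

Lemma ptens_multilinear n k (kn : (k < n)%N) m (w : 'I_m -> C) (x : 'I_m -> 'M[C]_d) (h : nat -> 'M[C]_d) :
  ptens (fun i => if i == k then \sum_j w j *: x j else h i) n =
  \sum_j w j *: ptens (fun i => if i == k then x j else h i) n.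
Proof.
apply/matrixP => a b; rewrite ptensE summxE (bigD1 (Ordinal kn))//= eqxx summxE mulr_suml.
apply: eq_bigr => j _; rewrite mxE [in RHS]mxE ptensE [in RHS](bigD1 (Ordinal kn))//= eqxx mulrA; congr (_ * _).
apply: eq_bigr => i ik; have /negbTE-> // : val i != k.
by apply: contraNneq ik => ik; apply/eqP/val_inj.
Qed.

(** Factors in the hull are resolved one position at a time; k counts the initial positions still
    allowed in the hull. Terms past n, invisible to [ptens], are reset to s0 so that the induction
    can start at k = n. *)
Lemma avset_co_dominated (S : set 'M[C]_d) n tau : S !=set0 -> avset (co S) n tau -> test_dominated (avset S n) tau.
Proof.
move=> [s0 Ss0] [f cf <-] E b hE.
suff key k : (k <= n)%N -> forall h, (forall i, co S (h i)) -> (forall i, (k <= i)%N -> S (h i)) -> retr (ptens h n *m E) <= b.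
  rewrite (@eq_ptens _ _ _ (fun i => if (i < n)%N then f i else s0)); last by move=> i ->.
  apply: (key n (leqnn n)) => i; first by case: ifP => // _; exact: sub_co.
  by rewrite leqNgt => /negbTE ->.
elim: k => [|k IH] kn h ch Sh; first by apply: hE; exists h => // i; exact: Sh.
have [m [w [x [w0 w1 Sx hx]]]] := ch k.
have -> : h = fun i => if i == k then \sum_j ((w j)%:C)%C *: x j else h i.
  by apply/funext => i; case: eqP => // ->.
rewrite ptens_multilinear// mulmx_suml retr_sum -[b]mul1r -w1 mulr_suml; apply: ler_sum => j _.
rewrite -scalemxAl retrZ ler_wpM2l//; apply: IH; first exact: ltnW.
  by move=> i; case: eqP => // _; exact: sub_co.
by move=> i ki; case: eqP => // ik; apply: Sh; rewrite ltn_neqAle ki eq_sym andbT; apply/eqP.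
Qed.

(** A larger alternative has a smaller exponent, which gives two of the inequalities; multilinearity
    and symmetrisation give the other two. *)
Lemma Stein_av_equalities (FA : set (nat -> 'M[C]_d)) (B1 : set 'M[C]_d) :
  B1 !=set0 -> B1 `<=` @density R d ->
  (forall n (p : {perm 'I_n}) f, FA f -> FA (fperm p f)) ->
  Stein (prodset FA) (avset B1) = Stein (prodset FA) (avset (co B1)) /\
  Stein (prodset FA) (avset (co B1)) = Stein (prodset FA) (iidset (co B1)).
Proof.
move=> B0 dB FAp.
have c0 : co B1 !=set0 by have [b Bb] := B0; exists b; exact: sub_co.
have self (B : forall n, set 'M[C]_(d ^ n)) n tau : B n tau -> test_dominated (B n) tau by move=> Bt E b; exact.
split; apply/eqP; rewrite eq_le; apply/andP; split.
- by apply: Stein_dominated => n tau; exact: avset_co_dominated.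
- apply: Stein_dominated => n _ [f Bf <-]; apply: (self (avset (co B1))).
  by exists f => // i; exact: sub_co.
- apply: Stein_dominated => n _ [A SA <-]; apply: (self (avset (co B1))).
  by exists (fun=> A) => //; rewrite ntensE.
- by apply: Stein_iid_le_av => //; [exact: co_density|move=> I w x; exact: co_convex].
Qed.

End Dominated.

Theorem mainTheorem4 (R : realType) (d : nat) (A1 B1 : set 'M[R[i]]_d) :
  A1 !=set0 -> B1 !=set0 ->
  cmx_closed A1 -> cmx_closed B1 ->
  A1 `<=` @density R d -> B1 `<=` @density R d ->
  [/\
   (* Stein(A1^iid || B1^iid) *)
   minstar (@probOn R d B1)
     (fun mu n => ((n%:R)^-1)%:E *
        ereal_inf [set relent (ntensmx rho n) (mixture B1 mu n) | rho in A1])%E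
     (Stein (iidset A1) (iidset B1)),
   (* Stein(A1^av || B1^iid) *)
   minstar (@probOn R d B1)
     (fun mu n => ((n%:R)^-1)%:E *
        ereal_inf [set relent rhon (mixture B1 mu n) | rhon in co (avset A1 n)])%E
     (Stein (avset A1) (iidset B1)),
   (* B1 convex: Stein(A1^iid || B1^iid) *)
   convex_mxset B1 ->
   minstar (fun p : 'M[R[i]]_d * probability (BorelMx R d) R => A1 p.1 /\ probOn B1 p.2)
     (fun p n => ((n%:R)^-1)%:E * relent (ntensmx p.1 n) (mixture B1 p.2 n))%E
     (Stein (iidset A1) (iidset B1)),
   (* Stein(A1^iid || B1^av) = Stein(A1^iid || co(B1)^av) = Stein(A1^iid || co(B1)^iid) = min* *)
   [/\ Stein (iidset A1) (avset B1) = Stein (iidset A1) (avset (co B1)),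
       Stein (iidset A1) (avset (co B1)) = Stein (iidset A1) (iidset (co B1)) &
       minstar (fun p : 'M[R[i]]_d * probability (BorelMx R d) R =>
                  A1 p.1 /\ probOn (co B1) p.2)
         (fun p n => ((n%:R)^-1)%:E * relent (ntensmx p.1 n) (mixture (co B1) p.2 n))%E
         (Stein (iidset A1) (iidset (co B1)))] &
   (* Stein(A1^av || B1^av) = Stein(A1^av || co(B1)^av) = Stein(A1^av || co(B1)^iid) = min* *)
   [/\ Stein (avset A1) (avset B1) = Stein (avset A1) (avset (co B1)),
       Stein (avset A1) (avset (co B1)) = Stein (avset A1) (iidset (co B1)) &
       minstar (@probOn R d (co B1))
         (fun mu n => ((n%:R)^-1)%:E *
            ereal_inf [set relent rhon (mixture (co B1) mu n) | rhon in co (avset A1 n)])%E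
         (Stein (avset A1) (iidset (co B1)))]].
Proof.
move=> A0 B0 cA cB dA dB.
have cA' := compact_states cA dA; have cB' := compact_states cB dB.
have c0 : co B1 !=set0 by have [b Bb] := B0; exists b; exact: sub_co.
have cC : cmx_closed (co B1) by apply: mxcoord_closed; exact: compact_co.
have dC : co B1 `<=` @density R d by exact: co_density.
have iidp n (p : {perm 'I_n}) f : Fiid A1 f -> Fiid A1 (fperm p f).
  move=> [A AA ->]; exists A => //; apply/funext => k; rewrite /fperm.
  by case: insub.
have avp n (p : {perm 'I_n}) f : Fav A1 f -> Fav A1 (fperm p f).
  by move=> h i; rewrite /fperm; case: insub => [u|]; exact: h.
have [i1 i2] := Stein_av_equalities B0 dB iidp.
have [a1 a2] := Stein_av_equalities B0 dB avp.
rewrite prodset_iid in i1 i2.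
split.
- exact: minstar_iid.
- exact: minstar_av.
- by move=> _; exact: minstar_iid_pair.
- by split; [exact: i1|exact: i2|exact: minstar_iid_pair].
- by split; [exact: a1|exact: a2|exact: minstar_av].
Qed.
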